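(* Let $X$ be the Hunt process generated by a regular lower bounded symmetric semi-Dirichlet form $(\mathscr{E},\mathscr{F})$ on $L^2(E,\mu)$ (i.e. $\mathscr{E}(f,g)=\mathscr{E}(g,f)$ for all $f,g\in\mathscr{F}$), with constant $\beta_0\ge0$ in the definition of lower bounded semi-Dirichlet form, and let $\Omega\subset E$ be an open set. Then for any $\beta>\beta_0$, $$\frac{\beta}{\mathbb{E}_\mu[1-\exp(-\beta\tau_\Omega)]}=\inf_{f\in \mathcal{N}_{\Omega,1}}\mathscr{E}_\beta(f,f).$$ Additionally, if the semi-Dirichlet form $(\mathscr{E}^\Omega,\mathscr{F}^\Omega)$, defined by $\mathscr{E}^\Omega=\mathscr{E}$ on $\mathscr{F}^\Omega$, is transient and $\beta_0=0$, then $$\frac{1}{\mathbb{E}_\mu[\tau_\Omega]}=\inf_{f\in \mathcal{N}_{\Omega,1}}\mathscr{E}(f,f).$$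
   Context: $(E,d)$ is a locally compact separable metric space and $\mu$ is a positive $\sigma$-finite measure on $E$ with full support. $\langle f,g\rangle_2=\int_E fg\,d\mu$ is the scalar product of $L^2(E,\mu)$. $C_0(E)$ is the space of continuous functions with compact support. Lower bounded semi-Dirichlet form: $\mathscr{F}$ is a dense subspace of $L^2(E,\mu)$ and $\mathscr{E}$ is a bilinear form on $\mathscr{F}\times\mathscr{F}$ for which there is a constant $\beta_0\ge0$ such that, with $\mathscr{E}_\beta(f,g):=\mathscr{E}(f,g)+\beta\langle f,g\rangle_2$: (1) $\mathscr{E}_{\beta_0}(f,f)\ge 0$ for all $f\in\mathscr{F}$; (2) there is $C\ge1$ with $|\mathscr{E}(f,g)|\le C\sqrt{\mathscr{E}_{\beta_0}(f,f)}\sqrt{\mathscr{E}_{\beta_0}(g,g)}$ for all $f,g\in\mathscr{F}$; (3) $\mathscr{F}$ is a Hilbert space under the inner product $\frac12(\mathscr{E}_\beta(f,g)+\mathscr{E}_\beta(g,f))$ for all $\beta>\beta_0$; (4) if $f\in\mathscr{F}$ then $f^+\wedge1\in\mathscr{F}$ and $\mathscr{E}(f^+\wedge1,f-f^+\wedge1)\ge0$. It is regular if $\mathscr{F}\cap C_0(E)$ is uniformly dense in $C_0(E)$ and $\mathscr{E}_\beta$-dense in $\mathscr{F}$ for $\beta>\beta_0$. The Hunt process $X=(X_t)_{t\ge0}$ generated by (associated with) such a regular form is the one whose transition semigroup $(P_t)$ on $L^2(E,\mu)$ has resolvent $R_\beta=\int_0^\infty e^{-\beta t}P_t\,dt$ satisfying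 $\mathscr{E}_\beta(R_\beta f,h)=\langle f,h\rangle_2$ for $\beta>\beta_0$, $f\in L^2(E,\mu)$, $h\in\mathscr{F}$. $\mathbb{E}_x$ is expectation for $X$ started at $x$, and $\mathbb{E}_\mu:=\int_E\mathbb{E}_x\,\mu(dx)$. $\tau_\Omega=\inf\{t\ge0:X_t\notin\Omega\}$ is the first exit time (as usual, the cemetery point is not in $\Omega$). ''q.e.'' (quasi-everywhere) means outside a set of zero capacity with respect to the form, and $\check f$ is a quasi-continuous version of $f\in\mathscr{F}$ (usual notions for regular lower bounded semi-Dirichlet forms). $\mathscr{F}^\Omega=\{f\in\mathscr{F}:\check f=0\text{ q.e. on }\Omega^c\}$; equivalently, $\mathscr{F}^\Omega$ is the $\mathscr{E}_\beta$-closure of $C_0(\Omega)\cap\mathscr{F}$ for $\beta>\beta_0$. $\mathcal{N}_{\Omega,1}=\{f\in\mathscr{F}^\Omega:\mu(f):=\int_E f\,d\mu=1\}$. Transience: the resolvent of a lower bounded semi-Dirichlet form extends to a sub-Markov resolvent on $L^\infty$; put $Rf=\lim_{n\to\infty}R_{1/n}f$. The form is transient if there is a strictly positive $f\in L^\infty$ with $Rf<\infty$ a.e. (for $(\mathscr{E}^\Omega,\mathscr{F}^\Omega)$, use $L^\infty(\Omega,\mu|_\Omega)$ and its own resolvent $R^\Omega_\beta f(x)=\mathbb{E}_x\int_0^{\tau_\Omega}e^{-\beta t}f(X_t)\,dt$). Convention: $1/\infty=0$. *)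

(* Defs.v *)
From HB Require Import structures.
From mathcomp Require Import all_boot all_order all_algebra.
From mathcomp Require Import all_classical all_reals all_analysis.
From mathcomp Require Import measurable_realfun.

Set Implicit Arguments.
Unset Strict Implicit.
Unset Printing Implicit Defensive.

Import Order.TTheory GRing.Theory Num.Theory.
Import numFieldNormedType.Exports.

Local Open Scope classical_set_scope.
Local Open Scope ring_scope.

(* Measurable types are pointed in the library, hence so is the state space. *)
#[short(type="pointedMetricType")]
HB.structure Definition PointedMetric (K : numDomainType) :=
  {M of Metric K M & Pointed M}.

Notation borel T := (g_sigma_algebraType (@open T)).

Definition separable_space (T : topologicalType) : Prop :=
  exists D : set T, countable D /\ dense D.

Definition full_support (R : realType) (E : pointedMetricType R)
    (mu : {measure set (borel E) -> \bar R}) : Prop :=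
  forall U : set E, open U -> U !=set0 -> (0 < mu U)%E.

(* C_0(E): continuous functions with compact support *)
Definition Cc (R : realType) (E : pointedMetricType R) : set (E -> R) :=
  [set f | continuous f /\ compact (closure [set x | f x != 0])].

(* Elements of L^2(E, mu) are represented by Borel functions.  A form on L^2 is
   a set F of such functions together with Ef, which is only relevant on
   F x F; both are required to be compatible with mu-a.e. equality (fields
   lbsd_dom_ae, lbsd_form_ae below). *)
Section Forms.
Context {R : realType} {E : pointedMetricType R}.
Variables (mu : {measure set (borel E) -> \bar R}).
Variables (F : set (E -> R)) (Ef : (E -> R) -> (E -> R) -> R).

Definition scalar2 (f g : E -> R) : R := (\int[mu]_x (f x * g x))%R.

Definition form_beta (beta : R) (f g : E -> R) : R :=
  Ef f g + beta * scalar2 f g.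

Definition sym_beta (beta : R) (f g : E -> R) : R :=
  2^-1 * (form_beta beta f g + form_beta beta g f).

Record lower_bounded_semi_dirichlet_form (beta0 : R) : Prop := {
  lbsd_beta0 : 0 <= beta0;
  lbsd_L2 : forall f, F f -> ((f : borel E -> R) \in Lfun mu 2%:E);
  lbsd_dom_ae : forall f g : E -> R,
    F f -> (g : borel E -> R) \in Lfun mu 2%:E ->
    {ae mu, forall x, f x = g x} -> F g;
  lbsd_dom0 : F (fun=> 0);
  lbsd_dom_lin : forall (a : R) (f g : E -> R),
    F f -> F g -> F (fun x => a * f x + g x);
  lbsd_dense : forall f : borel E -> R, f \in Lfun mu 2%:E ->
    forall e : R, 0 < e -> exists2 g : E -> R, F g &
      ('N[mu]_2%:E [(fun x => (f x - g x)%:E)] < e%:E)%E;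
  lbsd_form_ae : forall f f' g g' : E -> R, F f -> F f' -> F g -> F g' ->
    {ae mu, forall x, f x = f' x} -> {ae mu, forall x, g x = g' x} ->
    Ef f g = Ef f' g';
  lbsd_linl : forall (a : R) (f g h : E -> R), F f -> F g -> F h ->
    Ef (fun x => a * f x + g x) h = a * Ef f h + Ef g h;
  lbsd_linr : forall (a : R) (f g h : E -> R), F f -> F g -> F h ->
    Ef h (fun x => a * f x + g x) = a * Ef h f + Ef h g;
  lbsd_ge0 : forall f, F f -> 0 <= form_beta beta0 f f;
  lbsd_sector : exists2 C : R, 1 <= C & forall f g, F f -> F g ->
    `|Ef f g| <= C * Num.sqrt (form_beta beta0 f f)
                   * Num.sqrt (form_beta beta0 g g);
  (* Hilbert space: definiteness (modulo a.e. equality) and completeness *)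
  lbsd_definite : forall beta : R, beta0 < beta -> forall f, F f ->
    0 <= sym_beta beta f f /\
    (sym_beta beta f f = 0 -> {ae mu, forall x, f x = 0});
  lbsd_complete : forall beta : R, beta0 < beta -> forall u : nat -> E -> R,
    (forall n, F (u n)) ->
    (forall e : R, 0 < e -> exists N : nat, forall m n : nat,
       (N <= m)%N -> (N <= n)%N ->
       sym_beta beta (fun x => u m x - u n x) (fun x => u m x - u n x) < e) ->
    exists2 v : E -> R, F v &
      (fun n => sym_beta beta (fun x => u n x - v x) (fun x => u n x - v x))
        @ \oo --> (0 : R);
  lbsd_contraction : forall f : E -> R, F f ->
    let g := fun x => Num.min (Num.max (f x) 0) 1 in
    F g /\ 0 <= Ef g (fun x => f x - g x)
}.

Definition form_symmetric : Prop :=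
  forall f g, F f -> F g -> Ef f g = Ef g f.

Definition regular_form (beta0 : R) : Prop :=
  (forall f, @Cc R E f -> forall e : R, 0 < e ->
     exists g, [/\ F g, @Cc R E g & forall x, `|f x - g x| <= e]) /\
  (forall beta : R, beta0 < beta -> forall f, F f -> forall e : R, 0 < e ->
     exists g, [/\ F g, @Cc R E g &
       form_beta beta (fun x => f x - g x) (fun x => f x - g x) < e]).

(* The capacity associated with the form of index beta (only used for
   symmetric forms). *)
Definition cap_open (beta : R) (U : set E) : \bar R :=
  ereal_inf [set (form_beta beta f f)%:E |
    f in [set f | F f /\ {ae mu, forall x, U x -> 1 <= f x}]].

Definition capacity (beta : R) (A : set E) : \bar R :=
  ereal_inf [set cap_open beta U | U in [set U | open U /\ A `<=` U]].

(* The forms of index beta > beta0 have equivalent norms, so the choice of the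
   index is immaterial in the next two notions. *)
Definition zero_capacity (beta0 : R) (A : set E) : Prop :=
  forall beta : R, beta0 < beta -> capacity beta A = 0%E.

Definition quasi_continuous (beta0 : R) (f : E -> R) : Prop :=
  forall beta : R, beta0 < beta -> forall e : R, 0 < e ->
    exists G : set E, [/\ open G, (capacity beta G < e%:E)%E &
                          {within ~` G, continuous f}].

Definition dom_part (beta0 : R) (Om : set E) : set (E -> R) :=
  [set f | F f /\ exists g : E -> R,
    [/\ quasi_continuous beta0 g,
        {ae mu, forall x, g x = f x} &
        zero_capacity beta0 [set x | ~ Om x /\ g x <> 0]]].

Definition normalized_part (beta0 : R) (Om : set E) : set (E -> R) :=
  [set f | [/\ dom_part beta0 Om f,
               mu.-integrable setT (EFin \o f) &
               (\int[mu]_x (f x)%:E = 1)%E]].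

End Forms.

(* The state space with cemetery: the one-point compactification of E, in which
   the cemetery None is isolated when E is compact. *)
Notation cemetery_ext E := (one_point_compactification E).

Section Processes.
Context {R : realType} {E : pointedMetricType R}.
Context {d : measure_display} {W : measurableType d}.
(* Only the times t >= 0 are relevant in X. *)
Variables (X : R -> W -> cemetery_ext E).
Variables (P : cemetery_ext E -> probability W R).

Definition cylinders (I : set R) : set (set W) :=
  [set A | exists s, I s /\ exists B : set (borel (cemetery_ext E)),
             measurable B /\ A = X s @^-1` B].

Definition history (t : R) : set (set W) := <<s cylinders `[0, t] >>.

Definition history_right (t : R) : set (set W) :=
  [set A | forall s : R, t < s -> history s A].

Definition history_all : set (set W) := <<s cylinders `[0, +oo[ >>.

Definition stopping_time (sigma : W -> \bar R) : Prop :=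
  (forall w, 0 <= sigma w)%E /\
  forall t : R, 0 <= t -> history_right t [set w | (sigma w <= t%:E)%E].

Definition stopped_history (sigma : W -> \bar R) : set (set W) :=
  [set A | history_all A /\ forall t : R, 0 <= t ->
             history_right t (A `&` [set w | (sigma w <= t%:E)%E])].

(* X_infty is the cemetery. *)
Definition at_time (t : \bar R) (w : W) : cemetery_ext E :=
  if t is t'%:E%E then X t' w else None.

(* The strong Markov property and quasi-left continuity are required for the
   stopping times of the right-continuous filtration history_right generated
   by X.  They hold for every larger filtration only if they hold for this one,
   and they extend from it to its augmentation and to all initial laws. *)
Record hunt_process : Prop := {
  hunt_measurable : forall t : R, 0 <= t ->
    measurable_fun [set: W] (X t : W -> borel (cemetery_ext E));
  hunt_law_measurable : forall t : R, 0 <= t ->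
    forall B : set (borel (cemetery_ext E)), measurable B ->
    measurable_fun [set: borel (cemetery_ext E)]
      (fun x : borel (cemetery_ext E) => P x (X t @^-1` B));
  hunt_normal : forall x, P x [set w | X 0 w = x] = 1%E;
  hunt_absorbing : forall (s t : R) w, 0 <= s -> s <= t ->
    X s w = None -> X t w = None;
  hunt_shift : forall t : R, 0 <= t -> exists theta : W -> W,
    forall (s : R) w, 0 <= s -> X s (theta w) = X (s + t) w;
  hunt_right_continuous : forall w (t : R), 0 <= t ->
    X s w @[s --> t^'+] --> X t w;
  hunt_left_limits : forall w (t : R), 0 < t ->
    exists y : cemetery_ext E, X s w @[s --> t^'-] --> y;
  hunt_strong_markov : forall x sigma, stopping_time sigma ->
    forall s : R, 0 <= s ->
    forall B : set (borel (cemetery_ext E)), measurable B ->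
    forall A, stopped_history sigma A ->
    P x (A `&` [set w | B (at_time (sigma w + s%:E)%E w)]) =
    (\int[P x]_(w in A) P (at_time (sigma w) w) (X s @^-1` B))%E;
  hunt_quasi_left_continuous : forall x (sigma_ : nat -> W -> \bar R),
    (forall n, stopping_time (sigma_ n)) ->
    (forall n w, (sigma_ n w <= sigma_ n.+1 w)%E) ->
    let sigma w := ereal_sup (range (fun n => sigma_ n w)) in
    {ae P x, forall w, (sigma w < +oo)%E ->
      (fun n => at_time (sigma_ n w) w) @ \oo --> at_time (sigma w) w}
}.

(* Functions on E are extended by 0 at the cemetery. *)
Definition ext0 (f : E -> R) (y : cemetery_ext E) : R :=
  if y is Some x then f x else 0.

Definition semigroup (t : R) (f : E -> R) (x : E) : \bar R :=
  (\int[P (Some x)]_w (ext0 f (X t w))%:E)%E.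

Definition resolvent (beta : R) (f : E -> R) (x : E) : \bar R :=
  (\int[lebesgue_measure]_(t in `[0%R, +oo[)
     ((expR (- (beta * t)))%:E * semigroup t f x))%E.

Definition associated_with (mu : {measure set (borel E) -> \bar R})
    (F : set (E -> R)) (Ef : (E -> R) -> (E -> R) -> R) (beta0 : R) : Prop :=
  forall beta : R, beta0 < beta ->
  forall f : borel E -> R, f \in Lfun mu 2%:E ->
  exists u : E -> R,
    [/\ F u,
        {ae mu, forall x, (u x)%:E = resolvent beta f x} &
        forall h, F h -> form_beta mu Ef beta u h = scalar2 mu f h].

Definition exit_time (Om : set E) (w : W) : \bar R :=
  ereal_inf [set t%:E%E | t in [set t : R | 0 <= t /\
    ~ exists2 x, Om x & X t w = Some x]].

(* Functionals of exit times are measurable only with respect to the completed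
   sigma-algebras; the library integral of a nonnegative function is the
   supremum of the integrals of the simple functions below it, which agrees
   with the integral with respect to the completed measure. *)
Definition expect (x : E) (Y : W -> \bar R) : \bar R :=
  (\int[P (Some x)]_w Y w)%E.

Definition expect_mu (mu : {measure set (borel E) -> \bar R})
    (Y : W -> \bar R) : \bar R := (\int[mu]_x expect x Y)%E.

Definition part_resolvent (Om : set E) (beta : R) (f : E -> R) (x : E)
    : \bar R :=
  expect x (fun w =>
    (\int[lebesgue_measure]_(t in [set t : R | (0 <= t)%R /\
                                     t%:E < exit_time Om w])
       (expR (- (beta * t)) * ext0 f (X t w))%:E)%E).

Definition part_transient (mu : {measure set (borel E) -> \bar R})
    (Om : set E) : Prop :=
  exists f : borel E -> R,
    [/\ measurable_fun (Om : set (borel E)) f,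
        exists M : R, forall x, Om x -> 0 < f x <= M &
        {ae mu, forall x, Om x ->
          (limn (fun n => part_resolvent Om n.+1%:R^-1 f x) < +oo)%E}].

End Processes.

(* Main.v *)
(* Let [V n] exhaust Om by relatively compact open sets, let S_n increase to E with
   mu(S_n) finite, and let u_n be the beta-potential of 1_{S_n} for X killed on
   leaving closure (V n).  It satisfies E_beta(u_n, h) = int_{S_n} h for every h in
   the domain vanishing off closure (V n).  Cauchy-Schwarz then gives
   (int_{S_n} h)^2 <= (int u_n) E_beta(h, h), while u_n itself satisfies
   E_beta(u_n, u_n) <= int u_n; as n grows the infimum is the limit of
   1 / int u_n, and int u_n increases to E_mu[1 - exp(-beta tau)] / beta.  The last
   limit follows from quasi-left continuity.

   That the probabilistic potential solves the variational problem is shown by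
   penalization: killing X at rate k on the complement U of closure (V n) gives v_k
   with E_beta(v_k, h) + k <1_U v_k, h> = <1_{S_n}, h>, which follows from the
   resolvent equation alone.  As k grows, v_k converges in the form norm, and by the
   strong Markov property its limit lies between the potentials killed on leaving
   closure (V n) and closure (V n.+1).

   The part of the domain on Om is defined by quasi-continuous versions; functions
   with support in some closure (V n) approximate its elements first in L^2 with
   bounded energy, and then in the form norm because midpoints of a minimizing
   sequence do not increase the energy.  Finally, for beta0 = 0 let beta tend to 0. *)
Require Import Defs.
From HB Require Import structures.
From mathcomp Require Import all_boot all_order all_algebra.
From mathcomp Require Import all_classical all_reals all_analysis.
From mathcomp Require Import measurable_realfun ring lra.

Set Implicit Arguments.
Unset Strict Implicit.
Unset Printing Implicit Defensive.

Import Order.TTheory GRing.Theory Num.Theory.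
Import numFieldNormedType.Exports.

Local Open Scope classical_set_scope.
Local Open Scope ring_scope.

(** * Topology of the state space and of its compactification *)

(** Process and form are linked only through the resolvents on the whole space, and only almost
    everywhere. A penalty at a finite rate is a bounded perturbation of such a resolvent, which is
    why it carries the link over to killed potentials. Two consecutive closures appear because a
    path hitting an open set is, at that moment, only known to lie in its closure. On hitting the
    complement of closure (V n.+1) it lies well inside the open complement of closure (V n), where a
    growing penalty kills at once. No regularity of boundary points is involved, and the gap between
    the two potentials closes as n grows. Exit times and their expectations may fail to be
    measurable. They are replaced by almost surely equal suprema of hitting times, and under mu by
    almost everywhere equal Borel functions. *)

Section exhaustion.
Context {R : realType} {E : pointedMetricType R}.

Lemma compact_sub_nondecreasing_cover (K : set E) (A : (set E)^nat) :
  compact K -> (forall n, open (A n)) ->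
  (forall n m, (n <= m)%N -> A n `<=` A m) ->
  K `<=` \bigcup_n A n -> exists n, K `<=` A n.
Proof.
move=> cK oA ndA KA.
have := cK; rewrite compact_cover => /(_ nat setT A (fun i _ => oA i) KA)[D' _ KD].
exists (\max_(i <- finmap.enum_fset D') i)%N => x /KD[i /= iD Aix].
by apply: (ndA i) => //; exact: leq_bigmax_seq.
Qed.

(** Small balls about the points of a countable dense set, kept when their closure is compact and
    inside [Om], cover [Om]. Their finite unions have compact closure in [Om], and compactness puts
    each closure inside a later union. *)
Lemma open_exhaustion (Om : set E) :
  locally_compact [set: E] -> separable_space E -> open Om ->
  exists O : (set E)^nat, [/\ forall n, open (O n),
    forall n, compact (closure (O n)),
    forall n, closure (O n) `<=` O n.+1 & \bigcup_n O n = Om].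
Proof.
move=> lc [D [cD dD]] oOm.
have hE : hausdorff_space E := @metric_hausdorff R E.
have /countable_injP[f finj] := cD.
pose good (x : E) (e : R) :=
  compact (closure (ball x e)) /\ closure (ball x e) `<=` Om.
(* The pair codes a ball: the value of the injection [f] at its centre and the index of its radius.
   At most one centre has a given code, so this is the interior of a single ball or empty. *)
pose C0 (nj : nat * nat) := [set x : E | exists a, [/\ D a, f a = nj.1,
  good a nj.2.+1%:R^-1 & (ball a nj.2.+1%:R^-1)° x]].
pose C i := if unpickle i is Some nj then C0 nj else set0.
have oC0 nj : open (C0 nj).
  rewrite openE => x [a [Da fa ga ax]].
  apply: filterS (open_nbhs_nbhs (conj (@open_interior _ _) ax)) => z az.
  by exists a.
have clC0 nj : compact (closure (C0 nj)) /\ closure (C0 nj) `<=` Om.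
  have [[a [Da fa ga]]|nx] := pselect (exists a, [/\ D a, f a = nj.1 &
      good a nj.2.+1%:R^-1]).
    have sub : C0 nj `<=` ball a nj.2.+1%:R^-1.
      move=> y [b [Db fb gb by_]].
      have -> : a = b by apply: finj; rewrite ?inE// fa fb.
      exact: interior_subset by_.
    split; last by apply: subset_trans ga.2; exact: closure_subset.
    apply: subclosed_compact ga.1 _; first exact: closed_closure.
    exact: closure_subset.
  have -> : C0 nj = set0.
    by apply/seteqP; split => // y [b [Db fb gb _]]; apply: nx; exists b.
  by rewrite closure0; split => //; exact: compact0.
have oC i : open (C i).
  by rewrite /C; case: unpickle => [nj|]; [exact: oC0|exact: open0].
have clC i : compact (closure (C i)) /\ closure (C i) `<=` Om.
  rewrite /C; case: unpickle => [nj|]; first exact: clC0.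
  by rewrite closure0; split => //; exact: compact0.
have covC : Om `<=` \bigcup_i C i.
  move=> x Omx.
  have [U nU [cU clU]] := lc x I.
  have nUx : nbhs x (U `&` Om).
    apply: filterI; last exact: open_nbhs_nbhs.
    by move: nU; rewrite /within /=; apply: filterS => t; apply.
  have /nbhs_ballP[r /= r0 rU] := nUx.
  (* Three radii are needed: a point of the closure of [ball a e] is reached from [x] through [a]
     and then through a nearby point of that ball. *)
  have [j _ jr] : exists2 j, True & (j.+1%:R^-1 * 3 < r :> R).
    have [j jr] := ltr_add_invr (ltac:(exact: divr_gt0 r0 (ltr0Sn R 2)) : 0 < r / 3).
    by exists j => //; rewrite add0r ltr_pdivlMr// in jr.
  set e : R := j.+1%:R^-1 in jr *.
  have e0 : 0 < e by rewrite invr_gt0.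
  have [a [xa Da]] : (ball x e)° `&` D !=set0.
    by apply: dD; [exists x; exact: nbhsx_ballx|exact: open_interior].
  have xa' : ball x e a := interior_subset xa.
  have sub : closure (ball a e) `<=` U `&` Om.
    move=> y /(_ (ball y e) (nbhsx_ballx _ _ e0))[z [az yz]].
    apply: rU.
    have : ball x (e + e + e) y.
      by apply: ball_triangle (ball_sym yz); exact: ball_triangle az.
    by apply: le_ball; rewrite (le_trans _ (ltW jr))// mulr_natr !mulrS mulr0n addr0 addrA.
  exists (pickle (f a, j)) => //.
  rewrite /C pickleK; exists a; split => //=.
    split; last by move=> y /sub[].
    by apply: subclosed_compact cU _; [exact: closed_closure|move=> y /sub[]].
  rewrite /interior; apply/nbhs_ballP.
  have := xa'; rewrite /= ballEmdist/= => xae.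
  exists (e - mdist x a); first by rewrite /= subr_gt0.
  move=> y; rewrite !ballEmdist/= => xy.
  by rewrite (le_lt_trans (metric_triangle a x y))// metric_sym -ltrBrDl.
pose A n := \bigcup_(i < n) C i.
have oA n : open (A n) by exact: bigcup_open.
have ndA n m : (n <= m)%N -> A n `<=` A m.
  by move=> nm x [i /= il Cx]; exists i => //=; exact: leq_trans nm.
have clA n : compact (closure (A n)) /\ closure (A n) `<=` Om.
  elim: n => [|n [ih1 ih2]].
    by rewrite /A bigcup_mkord big_ord0 closure0; split => //; exact: compact0.
  have -> : A n.+1 = A n `|` C n by rewrite /A !bigcup_mkord big_ord_recr.
  have [c1 c2] := clC n.
  by rewrite closureU; split; [exact: compactU|rewrite subUset; split].
have covA : Om `<=` \bigcup_n A n.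
  by move=> x /covC[i _ Cx]; exists i.+1 => //; exists i => /=.
have next n : exists m, closure (A n) `<=` A m.
  have [c1 c2] := clA n.
  by apply: compact_sub_nondecreasing_cover => //; exact: subset_trans c2 covA.
have {}next n : exists m, (n < m)%N /\ closure (A n) `<=` A m.
  have [m mA] := next n; exists (maxn n.+1 m); split; first exact: leq_maxl.
  by apply: subset_trans mA _; apply: ndA; exact: leq_maxr.
have [m hm] := choice next.
exists (fun n => A (iter n m 0%N)); split => //.
- by move=> n; have [] := clA (iter n m 0%N).
- by move=> n /=; have [_] := hm (iter n m 0%N).
- apply/seteqP; split.
    by move=> x [n _ Ax]; have [_] := clA (iter n m 0%N); apply; exact: subset_closure.
  move=> x /covA[n _ Ax]; exists n => //.
  apply: ndA Ax; elim: n => // n ih; rewrite iterS.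
  by have [+ _] := hm (iter n m 0%N); apply: leq_ltn_trans.
Qed.

End exhaustion.

Lemma continuous_borel_measurable {R : realType} {T : ptopologicalType}
    (f : T -> R) : continuous f -> measurable_fun setT (f : borel T -> R).
Proof.
move=> cf.
apply: (@measurability _ _ _ _ setT (f : borel T -> R) _ (RGenOpens.measurableE R)) => //.
move=> _ [_ [a [b ->]] <-]; rewrite setTI; apply: sub_sigma_algebra.
by apply: open_comp => // x _; exact: cf.
Qed.

Section cemetery.
Context {R : realType} {E : pointedMetricType R}.
Hypothesis hlc : locally_compact [set: E].
Hypothesis hsep : separable_space E.
Notation ED := (cemetery_ext E).

Lemma cemetery_hausdorff : hausdorff_space ED.
Proof.
by apply: one_point_compactification_hausdorff => //; exact: metric_hausdorff.
Qed.

Lemma open_preimage_Some (O : set ED) : open O -> open (Some @^-1` O : set E).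
Proof.
by move=> oO; apply: open_comp oO => x _;
  exact: one_point_compactification_some_continuous.
Qed.

Lemma open_setC_image_compact (K : set E) :
  compact K -> open (~` (Some @` K) : set ED).
Proof.
move=> cK.
have clK : closed K by exact: compact_closed (@metric_hausdorff R E) cK.
rewrite openE => -[x|] xK; rewrite /interior; last first.
  by exists K => // -[y|] //= [[z Kz [<-]]|//] [y' Ky' [yy']]; rewrite yy' in Ky'.
have : open (~` K) by exact: closed_openC.
rewrite openE => /(_ x) /(_ (ltac:(by move=> Kx; apply: xK; exists x))).
by rewrite /interior => /filterS; apply => y /= Ky [z Kz [zy]]; rewrite zy in Kz.
Qed.

(** Complements of closed compact sets are neighbourhoods of the cemetery, so the extension vanishes
    near it. *)
Lemma continuous_ext0 (f : E -> R) (K : set E) : continuous f -> compact K ->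
  (forall x, ~ K x -> f x = 0) -> continuous (ext0 f : ED -> R).
Proof.
move=> cf cK f0 [x|].
  by move=> A /= nA; exact: (cf x A nA).
move=> A /= /nbhs_singleton A0; exists K.
  by split => //; exact: compact_closed (@metric_hausdorff R E) cK.
by move=> [y|] [[z Kz]|//]; [move=> [<-]; rewrite /= f0|].
Qed.

Lemma measurable_Some :
  measurable_fun [set: borel E] (Some : borel E -> borel ED).
Proof.
apply: (@measurability _ _ _ _ setT (Some : borel E -> borel ED) (@open ED)) => //.
move=> _ [G oG <-]; rewrite setTI; apply: sub_sigma_algebra.
exact: open_preimage_Some.
Qed.

Lemma measurable_image_Some (V : set (borel E)) :
  measurable V -> measurable (Some @` V : set (borel ED)).
Proof.
move: V; apply: smallest_sub; last first.
  move=> V oV; apply: sub_sigma_algebra.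
  exact: one_point_compactification_open_some.
have mT : measurable (Some @` setT : set (borel ED)).
  apply: sub_sigma_algebra.
  by apply: one_point_compactification_open_some; exact: openT.
split.
- by rewrite image_set0; exact: measurable0.
- move=> A mA; rewrite setTD.
  have -> : Some @` (~` A) = Some @` setT `\` Some @` A :> set ED.
    apply/seteqP; split => [_ [y Ay <-]|_ [[y _ <-] yA]].
      by split; [exists y|move=> [z Az [zy]]; rewrite zy in Az].
    by exists y => // Ay; apply: yA; exists y.
  exact: measurableD.
- by move=> F mF; rewrite image_bigcup; exact: bigcup_measurable.
Qed.

Lemma measurable_ext0 (f : borel E -> R) : measurable_fun setT f ->
  measurable_fun setT (ext0 f : borel ED -> R).
Proof.
move=> mf _ B mB; rewrite setTI.
have mfB : measurable (f @^-1` B) by rewrite -[X in measurable X]setTI; exact: mf.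
have mN : measurable ([set None] : set (borel ED)).
  have -> : [set None] = ~` (Some @` setT) :> set ED.
    apply/seteqP; split => -[y|] //=; first by move=> _ [].
    by case; exists y.
  by apply: measurableC; exact: measurable_image_Some.
have [B0|B0] := pselect (B 0).
  have -> : ext0 f @^-1` B = Some @` (f @^-1` B) `|` [set None] :> set ED.
    apply/seteqP; split => -[y|] /=.
    - by move=> By; left; exists y.
    - by right.
    - by move=> [[z Bz [<-]]//|//].
    - by [].
  by apply: measurableU => //; exact: measurable_image_Some.
have -> : ext0 f @^-1` B = Some @` (f @^-1` B) :> set ED.
  apply/seteqP; split => -[y|] //=.
  - by move=> By; exists y.
  - by move=> [z Bz [<-]].
  - by move=> [z _].
exact: measurable_image_Some.
Qed.

Lemma compact_cutoff (K V : set E) : compact K -> open V -> K `<=` V ->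
  exists f : E -> R, [/\ continuous f, forall x, 0 <= f x <= 1,
    forall x, K x -> f x = 1 & forall x, ~ V x -> f x = 0].
Proof.
move=> cK oV KV.
have clK : closed K by exact: compact_closed (@metric_hausdorff R E) cK.
have dis : ~` V `&` K = set0.
  by apply/seteqP; split => // x [Vx /KV].
have [f [cf f0 f1 f01]] := urysohn_ext_itv (@pseudometric_normal R E)
  (open_closedC oV) clK dis (@ltr01 R).
exists f; split => //.
- by move=> x; have := f01 (f x) (imageT f x); rewrite /= in_itv.
- by move=> x Kx; apply: f1; exists x.
- by move=> x Vx; apply: f0; exists x.
Qed.

(** Right continuity of paths passes only through continuous functionals. Here the indicator of an
    open set of [E] becomes a pointwise limit of functions continuous on the whole
    compactification. *)
Lemma open_cutoff_sequence (V : set E) : open V ->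
  exists phi : (E -> R)^nat, [/\ forall n, continuous (ext0 (phi n) : ED -> R),
    forall n x, 0 <= phi n x <= 1 &
    forall y : ED, ext0 (phi n) y @[n --> \oo] --> (\1_(Some @` V) y : R)].
Proof.
move=> oV; have [V_ [oO cO clO OV]] := open_exhaustion hlc hsep oV.
have /choice[phi hphi] n : exists f : E -> R, [/\ continuous f,
    forall x, 0 <= f x <= 1, forall x, closure (V_ n) x -> f x = 1 &
    forall x, ~ V_ n.+1 x -> f x = 0].
  by apply: compact_cutoff.
have ndO n m : (n <= m)%N -> V_ n `<=` V_ m.
  elim: m => [|m ih]; first by rewrite leqn0 => /eqP ->.
  rewrite leq_eqVlt => /orP[/eqP -> //|]; rewrite ltnS => /ih OO.
  by apply: subset_trans OO _; apply: subset_trans (clO m); exact: subset_closure.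
exists phi; split.
- move=> n; have [cf _ _ f0] := hphi n.
  apply: (continuous_ext0 cf (cO n.+1)) => x Kx.
  by apply: f0 => Ox; apply: Kx; exact: subset_closure.
- by move=> n; have [] := hphi n.
- move=> y; have [Vy|Vy] := pselect ((Some @` V) y).
    rewrite indicE mem_set//; case: Vy => x Vx <- /=.
    move: Vx; rewrite -OV => -[N _ ONx].
    apply: cvg_near_cst; exists N => // n /= Nn.
    have [_ _ -> //] := hphi n; apply: subset_closure.
    exact: ndO ONx.
  rewrite indicE memNset//; case: y Vy => [x|] Vy /=; last exact: cvg_cst.
  apply: cvg_near_cst; exists 0%N => // n _.
  have [_ _ _ -> //] := hphi n => Ox; apply: Vy; exists x => //.
  by rewrite -OV; exists n.+1.
Qed.

End cemetery.

(** * Measurability of the process and of its semigroup *)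

Section right_grid.
Context {R : realType}.

(* A right-continuous path is the limit of its values at the first grid point
   strictly after t, which makes it jointly measurable. *)
Definition right_grid (m : nat) (t : R) : R :=
  (Num.truncn (Num.max t 0 * m.+1%:R)).+1%:R / m.+1%:R.

Lemma right_grid_ge0 m t : 0 <= right_grid m t.
Proof. by rewrite /right_grid divr_ge0. Qed.

Lemma right_grid_gt m t : 0 <= t -> t < right_grid m t.
Proof.
move=> t0; rewrite /right_grid ltr_pdivlMr//.
by rewrite (max_l t0); exact: truncnS_gt.
Qed.

Lemma right_grid_le m t : 0 <= t -> right_grid m t <= t + m.+1%:R^-1.
Proof.
move=> t0; rewrite /right_grid ler_pdivrMr// mulrDl mulVf// -natr1 lerD2r.
by rewrite (max_l t0) truncn_le mulr_ge0.
Qed.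

Lemma cvg_right_grid t : 0 <= t -> right_grid ^~ t @ \oo --> t^'+.
Proof.
move=> t0 A [e /= e0 eA].
have [N _ NP] : \forall m \near \oo, m.+1%:R^-1 < e.
  exact: (near_infty_natSinv_lt (PosNum e0)).
exists N => // m /= Nm; apply: eA; last exact: right_grid_gt.
rewrite /= distrC ger0_norm ?subr_ge0 ?(ltW (right_grid_gt _ _))//.
rewrite ltrBlDl (le_lt_trans (right_grid_le m t0))// ltrD2l.
exact: NP.
Qed.

Lemma measurable_right_grid_index (m i : nat) :
  measurable [set t : R | Num.truncn (Num.max t 0 * m.+1%:R) = i].
Proof.
have mS (j : nat) : measurable [set t : R | Num.max t 0 * m.+1%:R < j%:R].
  rewrite [X in measurable X](_ : _ =
    setT `&` (fun t : R => Num.max t 0 * m.+1%:R) @^-1` [set x | x < j%:R]).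
    apply: measurable_funM => //; first exact: measurable_maxr.
    rewrite (_ : [set _ | _] = `]-oo, j%:R[%classic); first exact: measurable_itv.
    by apply/seteqP; split => x /=; rewrite in_itv.
  by rewrite setTI.
rewrite [X in measurable X](_ : _ =
    [set t : R | Num.max t 0 * m.+1%:R < i.+1%:R] `\`
    [set t : R | Num.max t 0 * m.+1%:R < i%:R]).
  exact: measurableD.
apply/seteqP; split => t /=.
  move=> <-; split; first exact: truncnS_gt.
  by apply/negP; rewrite -leNgt truncn_le mulr_ge0// le_max lexx orbT.
move=> [ti /negP]; rewrite -leNgt => it.
by apply: truncn_def; rewrite it ti.
Qed.

Lemma measurable_right_grid d (Y : measurableType d) d' (Z : measurableType d')
    (h : R -> Y -> Z) (m : nat) :
  (forall t, 0 <= t -> measurable_fun setT (h t)) ->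
  measurable_fun setT (fun p : R * Y => h (right_grid m p.1) p.2).
Proof.
move=> mh _ B mB; rewrite setTI.
rewrite [X in measurable X](_ : _ = \bigcup_i
  ([set t : R | Num.truncn (Num.max t 0 * m.+1%:R) = i] `*`
   (h (i.+1%:R / m.+1%:R) @^-1` B))).
  apply: bigcup_measurable => i _; apply: measurableX.
    exact: measurable_right_grid_index.
  by rewrite -[X in measurable X]setTI; apply: mh => //; rewrite divr_ge0.
apply/seteqP; split => -[t y] /=.
  by move=> Bh; exists (Num.truncn (Num.max t 0 * m.+1%:R)).
by move=> [i _ [/= <-]].
Qed.

Lemma measurable_fun_right_limit d (Y : measurableType d) (h : R -> Y -> R) :
  (forall t, 0 <= t -> measurable_fun setT (h t)) ->
  (forall t y, 0 <= t -> h (right_grid m t) y @[m --> \oo] --> h t y) ->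
  measurable_fun setT (fun p : R * Y => h (Num.max p.1 0) p.2).
Proof.
move=> mh ch.
apply: (@measurable_fun_cvg _ _ _ _ (fun m p => h (right_grid m p.1) p.2)).
  by move=> m; exact: measurable_right_grid.
move=> [t y] _ /=.
have -> : (fun m => h (right_grid m t) y) =
          (fun m => h (right_grid m (Num.max t 0)) y).
  by apply/funext => m; rewrite /right_grid -maxA maxxx.
by apply: ch; rewrite le_max lexx orbT.
Qed.

End right_grid.

Section process.
Context {R : realType} {E : pointedMetricType R}.
Hypothesis hlc : locally_compact [set: E].
Hypothesis hsep : separable_space E.
Notation ED := (cemetery_ext E).
Context {d : measure_display} {W : measurableType d}.
Variables (X : R -> W -> ED) (P : ED -> probability W R).
Hypothesis hX : hunt_process X P.

(* [X] is unconstrained at negative times. *)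
Definition Xpos (t : R) (w : W) : borel ED := X (Num.max t 0) w.

Lemma XposE t : 0 <= t -> Xpos t = X t.
Proof. by move=> t0; rewrite /Xpos max_l. Qed.

Lemma measurable_Xpos t : measurable_fun setT (Xpos t).
Proof. by apply: (hunt_measurable hX); rewrite le_max lexx orbT. Qed.

Lemma cvg_process_right_grid (f : ED -> R) t w : continuous f -> 0 <= t ->
  f (X (right_grid m t) w) @[m --> \oo] --> f (X t w).
Proof.
move=> cf t0; apply: continuous_cvg; first exact: cf.
exact: (cvg_comp (right_grid ^~ t) (X ^~ w) (cvg_right_grid t0)
  (hunt_right_continuous hX t0)).
Qed.

(** The cutoffs only reach images of open sets of [E]; the cemetery is added as the complement of
    the image of [E]. *)
Lemma open_cemetery_decomposition (G : set ED) :
  G = Some @` (Some @^-1` G) `|` (if `[< G None >] then ~` (Some @` [set: E]) else set0).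
Proof.
apply/seteqP; split => [[x|] Gx|].
- by left; exists x.
- by right; rewrite asboolT// => -[].
- move=> y [[x Gx <-] //|]; case: asboolP => // GN.
  by case: y => // x [] ; exists x.
Qed.

Lemma measurable_process : measurable_fun setT (fun p : R * W => Xpos p.1 p.2).
Proof.
have mV (V : set E) : open V ->
    measurable [set p : R * W | (Some @` V) (Xpos p.1 p.2)].
  move=> oV; have [phi [cphi _ phiV]] := open_cutoff_sequence hlc hsep oV.
  have m1 : measurable_fun setT
      (fun p : R * W => \1_(Some @` V) (Xpos p.1 p.2) : R).
    apply: (@measurable_fun_cvg _ _ _ _ (fun n p => ext0 (phi n) (Xpos p.1 p.2))).
      move=> n; apply: (@measurable_fun_right_limit _ _ _
        (fun t w => ext0 (phi n) (X t w))).
        move=> t t0; rewrite -(XposE t0).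
        apply: (@measurableT_comp _ _ _ _ _ _ (ext0 (phi n) : borel ED -> R)).
          exact: continuous_borel_measurable.
        exact: measurable_Xpos.
      by move=> t w t0; exact: cvg_process_right_grid.
    by move=> p _; exact: phiV.
  rewrite (_ : [set _ | _] =
    setT `&` (fun p : R * W => \1_(Some @` V) (Xpos p.1 p.2) : R) @^-1` [set 1]).
    exact: m1.
  rewrite setTI; apply/seteqP; split => p /=.
    by move=> Vp; rewrite indicE mem_set.
  have [//|nV] := pselect ((Some @` V) (Xpos p.1 p.2)).
  by rewrite indicE memNset// => /eqP; rewrite eq_sym oner_eq0.
apply: (@measurability _ _ _ _ setT (fun p : R * W => Xpos p.1 p.2) (@open ED)) => //.
move=> _ [G oG <-]; rewrite setTI (open_cemetery_decomposition G) preimage_setU.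
apply: measurableU; first by apply: mV; exact: open_preimage_Some.
case: ifP => _; last by rewrite preimage_set0.
by rewrite preimage_setC; apply: measurableC; apply: mV; exact: openT.
Qed.

End process.

Lemma ge0_bounded_convergence {R : realType} d (W : measurableType d)
    (P : probability W R) (u : nat -> W -> \bar R) (v : W -> \bar R) (M : R) :
  (forall n, measurable_fun setT (u n)) ->
  (forall n w, (0 <= u n w <= M%:E)%E) ->
  (forall w, u n w @[n --> \oo] --> v w) ->
  (\int[P]_w u n w @[n --> \oo] --> \int[P]_w v w)%E.
Proof.
move=> mu bu cu.
have mv : measurable_fun setT v.
  by apply: (@emeasurable_fun_cvg _ _ _ _ u) => // w _; exact: cu.
have [|||_ _] := @dominated_convergence _ _ _ P setT measurableT u v (cst M%:E) mu mv.
- exact/aeW.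
- exact: finite_measure_integrable_cst.
- apply/aeW => w n _; have /andP[u0 uM] := bu n w.
  by rewrite gee0_abs.
exact.
Qed.

Section laws.
Context {R : realType} {E : pointedMetricType R}.
Hypothesis hlc : locally_compact [set: E].
Hypothesis hsep : separable_space E.
Notation ED := (cemetery_ext E).
Context {d : measure_display} {W : measurableType d}.
Variables (X : R -> W -> ED) (P : ED -> probability W R).
Hypothesis hX : hunt_process X P.
Notation Xpos := (Xpos X).

Let law (z : R * borel ED) : {measure set (borel ED) -> \bar R} :=
  measure_function_pushforward__canonical__measure_function_Measure
    (P z.2) (measurable_Xpos hX z.1).

Let integral_law z (g : borel ED -> \bar R) : measurable_fun setT g ->
  (forall y, (0 <= g y)%E) ->
  (\int[law z]_y g y = \int[P z.2]_w g (Xpos z.1 w))%E.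
Proof.
move=> mg g0; rewrite ge0_integral_pushforward//; last exact: measurable_Xpos hX _.
Qed.

Let measurable_law_continuous (f : ED -> R) : continuous f ->
  (forall y, 0 <= f y <= 1) ->
  measurable_fun setT (fun z : R * borel ED => \int[P z.2]_w (f (Xpos z.1 w))%:E)%E.
Proof.
move=> cf f01.
have mfX t : measurable_fun setT (fun w => (f (Xpos t w))%:E).
  apply/measurable_EFinP.
  apply: (@measurableT_comp _ _ _ _ _ _ (f : borel ED -> R)).
    exact: continuous_borel_measurable.
  exact: measurable_Xpos hX _.
have fin t (y : ED) : (\int[P y]_w (f (Xpos t w))%:E)%E \is a fin_num.
  rewrite ge0_fin_numE; last first.
    by apply: integral_ge0 => w _; rewrite lee_fin; have /andP[] := f01 (Xpos t w).
  apply: (@le_lt_trans _ _ (\int[P y]_w (cst 1%:E w))%E).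
    apply: ge0_le_integral => //.
    - by move=> w _; rewrite lee_fin; have /andP[] := f01 (Xpos t w).
    - by move=> w _; rewrite lee_fin; have /andP[] := f01 (Xpos t w).
  by rewrite integral_cst// mul1e ltey_eq fin_num_measure.
pose h t (y : borel ED) := fine (\int[P y]_w (f (Xpos t w))%:E)%E.
suff mh : measurable_fun setT (fun z : R * borel ED => h (Num.max z.1 0) z.2).
  rewrite (_ : (fun z => _) =
      EFin \o (fun z : R * borel ED => h (Num.max z.1 0) z.2)).
    exact/measurable_EFinP.
  apply/funext => -[t y] /=; rewrite fineK// ?fin//.
  by apply: eq_integral => w _; rewrite /Xpos -maxA maxxx.
apply: measurable_fun_right_limit.
- move=> t t0; apply: measurableT_comp => //.
  have -> : (fun y : borel ED => \int[P y]_w (f (Xpos t w))%:E)%E =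
            (fun y => \int[law (t, y)]_x (f x)%:E)%E.
    apply/funext => y; rewrite integral_law//.
    + by apply/measurable_EFinP; exact: continuous_borel_measurable.
    + by move=> x; rewrite lee_fin; have /andP[] := f01 x.
  apply: measurable_fun_integral_kernel.
  + move=> B mB; apply: eq_measurable_fun (hunt_law_measurable hX t0 mB).
    by move=> y _; rewrite /law/= /pushforward/= XposE.
  + by move=> x; rewrite lee_fin; have /andP[] := f01 x.
  + by apply/measurable_EFinP; exact: continuous_borel_measurable.
- move=> t y t0; apply: fine_cvg; rewrite fineK ?fin//.
  apply: ge0_bounded_convergence => //.
    by move=> n w; rewrite !lee_fin; exact: f01.
  move=> w; apply: cvg_EFin; first by near=> n.
  have := @cvg_process_right_grid _ _ _ _ _ _ hX _ _ w cf t0; rewrite XposE//.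
  by under eq_fun => m do rewrite -(XposE _ (right_grid_ge0 m t)).
Unshelve. all: by end_near. Qed.

(** Open sets are stable under intersection and generate the Borel sets, and measurability of the
    law passes to complements and disjoint unions: a Dynkin class argument based on the cutoffs. *)
Let measurable_law (B : set (borel ED)) : measurable B ->
  measurable_fun setT (fun z => law z B).
Proof.
move=> mB.
have mV (V : set E) : open V -> measurable_fun setT (fun z => law z (Some @` V)).
  move=> oV; have [phi [cphi phi01 phiV]] := open_cutoff_sequence hlc hsep oV.
  have e01 n y : 0 <= ext0 (phi n) y <= 1.
    by case: y => [x|] /=; [exact: phi01|rewrite lexx ler01].
  have moV : measurable (Some @` V : set (borel ED)).
    by apply: measurable_image_Some; apply: sub_sigma_algebra.
  apply: (@emeasurable_fun_cvg _ (R * borel ED)%type _ setT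
    (fun n z => \int[P z.2]_w (ext0 (phi n) (Xpos z.1 w))%:E)%E
    (fun z => law z (Some @` V))).
    by move=> n; exact: measurable_law_continuous.
  move=> z _.
  have -> : law z (Some @` V) = (\int[P z.2]_w (\1_(Some @` V) (Xpos z.1 w))%:E)%E.
    rewrite -(integral_law z (g := EFin \o \1_(Some @` V))); last 2 first.
    - by apply/measurable_EFinP; exact: measurable_indic.
    - by move=> y; rewrite lee_fin.
    by rewrite integral_indic// setIT.
  apply: (ge0_bounded_convergence (M := 1)).
  - move=> n; apply/measurable_EFinP.
    apply: (@measurableT_comp _ _ _ _ _ _ (ext0 (phi n) : borel ED -> R)).
      exact: continuous_borel_measurable.
    exact: measurable_Xpos hX _.
  - by move=> n w; rewrite !lee_fin.
  - by move=> w; apply: cvg_EFin; [near=> n|exact: phiV].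
have lawC z (A : set (borel ED)) : measurable A ->
    law z (~` A) = (1 - law z A)%E.
  move=> mA; rewrite /law/= /pushforward preimage_setC.
  apply: probability_setC.
  by rewrite -[X in measurable X]setTI; exact: (measurable_Xpos hX z.1).
have : <<s @open ED >> B by [].
apply: (@dynkin_induction _ (borel ED) (@open ED)
  (fun B => measurable_fun setT (fun z => law z B))) => //.
- by move=> A1 A2; exact: openI.
- rewrite (_ : (fun z => _) = cst 1%E)//; apply/funext => z.
  exact: (probability_setT (P z.2)).
- move=> G oG.
  pose V : set E := Some @^-1` G.
  have mo (U : set E) : open U -> measurable (Some @` U : set (borel ED)).
    by move=> oU; apply: measurable_image_Some; apply: sub_sigma_algebra.
  have oV : open V by exact: open_preimage_Some.
  rewrite (open_cemetery_decomposition G); case: asboolP => GN; last first.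
    by rewrite setU0; exact: mV.
  rewrite (_ : (fun z => _) =
      (fun z => law z (Some @` V) + (1 - law z (Some @` setT)))%E); last first.
    apply/funext => z; rewrite -lawC; last by apply: mo; exact: openT.
    apply: measureU.
    - exact: mo.
    - by apply: measurableC; apply: mo; exact: openT.
    - by apply/seteqP; split => // y [[x _ <-]] []; exists x.
  apply: emeasurable_funD; first exact: mV.
  by apply: emeasurable_funB => //; apply: mV; exact: openT.
- move=> S mS IH.
  rewrite (_ : (fun z => _) = (fun z => 1 - law z S)%E).
    exact: emeasurable_funB.
  by apply/funext => z; exact: lawC.
- move=> F mF tF IH.
  rewrite (_ : (fun z => _) = (fun z => \sum_(0 <= i <oo) law z (F i))%E).
    by apply: (@ge0_emeasurable_sum _ _ _ setT (fun i z => law z (F i)) predT).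
  apply/funext => z; apply: measure_semi_bigcup => //.
  exact: bigcup_measurable.
Unshelve. all: by end_near. Qed.

Lemma measurable_semigroup (g : borel ED -> \bar R) : measurable_fun setT g ->
  (forall y, (0 <= g y)%E) ->
  measurable_fun setT (fun z : R * borel ED => \int[P z.2]_w g (Xpos z.1 w))%E.
Proof.
move=> mg g0.
apply: eq_measurable_fun (measurable_fun_integral_kernel measurable_law g0 mg).
by move=> z _; rewrite integral_law.
Qed.

End laws.

(** * Exponential weights *)

Lemma measurable_expeR {R : realType} : measurable_fun setT (@expeR R).
Proof.
apply: (measurability _ (ErealGenOInfty.measurableE R)) => //.
move=> _ [_ [r ->] <-]; rewrite setTI.
have [r0|r0] := leP 0 r.
  have rE : expeR (lne r%:E) = r%:E by apply: lneK; rewrite in_itv/= leey lee_fin r0.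
  rewrite (_ : _ @^-1` _ = setT `&` [set x | (lne r%:E < x)%E]).
    by apply: emeasurable_fun_o_infty => //; exact: measurable_id.
  rewrite setTI; apply/seteqP.
  by split => x /=; rewrite in_itv/= andbT -{1}rE lte_expeR.
rewrite (_ : _ @^-1` _ = setT)//; apply/seteqP; split => // x _ /=.
by rewrite in_itv/= andbT (lt_le_trans _ (expeR_ge0 x))// lte_fin.
Qed.

Section exponential_weight.
Context {R : realType}.
Notation leb := (@lebesgue_measure R).

(* The weight vanishes for t < 0, so that all time integrals run over R. *)
Definition expw (l t : R) : R := expR (- (l * t)) * (0 <= t)%R%:R.

Lemma le_expw l l' t : l' <= l -> expw l t <= expw l' t.
Proof.
move=> ll; rewrite /expw; case: (leP 0 t) => t0; last by rewrite !mulr0.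
by rewrite !mulr1 ler_expR lerN2 ler_wpM2r.
Qed.

Lemma expw_ge0 l t : 0 <= expw l t.
Proof. by rewrite mulr_ge0// expR_ge0. Qed.

Lemma expw_neg l t : t < 0 -> expw l t = 0.
Proof. by move=> t0; rewrite /expw leNgt t0 mulr0. Qed.

Lemma expw_pos l t : 0 <= t -> expw l t = expR (- (l * t)).
Proof. by move=> t0; rewrite /expw t0 mulr1. Qed.

Lemma measurable_indic_bool d (T : measurableType d) (b : T -> bool) :
  measurable [set x | b x] -> measurable_fun setT (fun x => (b x)%:R : R).
Proof.
move=> mb; rewrite (_ : (fun x => _) = \1_[set x | b x]).
  exact: measurable_indic.
by apply/funext => x; rewrite indicE; congr (nat_of_bool _)%:R; apply/idP/idP;
  rewrite inE.
Qed.

Lemma measurable_expw l : measurable_fun setT (expw l).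
Proof.
apply: measurable_funM.
  apply: continuous_measurable_fun => x.
  apply: continuous_comp; last exact: continuous_expR.
  by apply: continuousN; apply: mulrl_continuous.
apply: measurable_indic_bool.
rewrite (_ : [set _ | _] = `[0, +oo[%classic); first exact: measurable_itv.
by apply/seteqP; split => x /=; rewrite in_itv/= andbT.
Qed.

Lemma integral_expw_itv l (f : R -> \bar R) :
  (\int[leb]_(t in `[0%R, +oo[) ((expR (- (l * t)))%:E * f t) =
   \int[leb]_t ((expw l t)%:E * f t))%E.
Proof.
rewrite integral_mkcond; apply: eq_integral => t _; rewrite patchE /expw.
have [t0|t0] := leP 0 t; first by rewrite mem_set ?mulr1// /= in_itv/= t0.
by rewrite memNset ?mulr0 ?mul0e// /= in_itv/= andbT leNgt t0.
Qed.

Lemma integral_expw l : 0 < l -> (\int[leb]_t (expw l t)%:E = (l^-1)%:E)%E.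
Proof.
move=> l0; have := integral_exponential_pdf l0.
have -> : (fun t => (exponential_pdf l t)%:E) = (fun t => l%:E * (expw l t)%:E)%E.
  apply/funext => t; rewrite -EFinM; congr EFin.
  have [t0|t0] := leP 0 t; first by rewrite exponential_pdfE// expw_pos// mulNr.
  by rewrite lt0_exponential_pdf// expw_neg// mulr0.
rewrite ge0_integralZl//; last 3 first.
- by apply/measurable_EFinP; exact: measurable_expw.
- by move=> t _; rewrite lee_fin expw_ge0.
- by rewrite lee_fin ltW.
move=> h; rewrite -[LHS]mul1e -(@mulVf _ l) ?gt_eqF// EFinM -muleA h mule1//.
Qed.

(** The image of Lebesgue measure under a translation agrees with it on half-open intervals, which
    determine it. *)
Lemma integral_translation (s : R) (f : R -> \bar R) :
  measurable_fun setT f -> (forall t, 0 <= f t)%E ->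
  (\int[leb]_t f (s + t)%R = \int[leb]_t f t)%E.
Proof.
move=> mf f0.
have ms : measurable_fun [set: measurableTypeR R]
    (fun t : measurableTypeR R => (s + t : measurableTypeR R)).
  by apply: (@measurable_funD _ _ _ _ (cst s) id).
have := @ge0_integral_pushforward _ _ _ _ _ _ ms leb setT f measurableT mf
  (fun x _ => f0 x).
rewrite preimage_setT => <-.
apply: eq_measure_integral => //= A mA _.
apply/esym/(lebesgue_measure_unique
  (mu := measure_function_pushforward__canonical__measure_function_Measure leb ms)) => //.
move=> _ [[a b]] _ <-; rewrite /= /pushforward.
have -> : (fun t => s + t) @^-1` `]a, b] = `]a - s, b - s]%classic.
  by apply/seteqP; split => t /=; rewrite !in_itv/= ltrBlDl lerBrDl.
by rewrite !lebesgue_measure_itv/= !lte_fin ltrD2r -!EFinB opprB addrA subrK.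
Qed.

Lemma integral_expw_ge l (s : \bar R) : 0 < l -> (0 <= s)%E ->
  (\int[leb]_t ((expw l t)%:E * ((s <= t%:E)%E%:R)%:E) =
   (l^-1)%:E * expeR (- (l%:E * s)))%E.
Proof.
move=> l0; case: s => [s|_|//]; last first.
  rewrite gt0_muley ?lte_fin//= mule0; apply: integral0_eq => t _.
  by rewrite mule0.
rewrite lee_fin => s0.
rewrite -(integral_translation s); last 2 first.
- apply: emeasurable_funM; first by apply/measurable_EFinP; exact: measurable_expw.
  apply/measurable_EFinP; apply: measurable_indic_bool.
  rewrite (_ : [set _ | _] = `[s, +oo[%classic); first exact: measurable_itv.
  by apply/seteqP; split => x /=; rewrite in_itv/= andbT lee_fin.
- by move=> t; rewrite mule_ge0// lee_fin ?expw_ge0.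
rewrite -(integral_expw l0) [RHS]muleC -EFinM -EFinN/=.
rewrite -ge0_integralZl//; last 2 first.
- by apply/measurable_EFinP; exact: measurable_expw.
- by move=> t _; rewrite lee_fin expw_ge0.
apply: eq_integral => t _; rewrite -!EFinM lee_fin lerDl; congr EFin.
have [t0|t0] := leP 0 t; last by rewrite (expw_neg _ t0) /= !mulr0.
by rewrite !expw_pos ?addr_ge0// mulr1 mulrDr opprD expRD.
Qed.

(** This turns Laplace functionals of exit times into potentials: the right-hand side is [l] times
    the discounted time spent before [s]. *)
Lemma integral_expw_lt l (s : \bar R) : 0 < l -> (0 <= s)%E ->
  (l%:E * \int[leb]_t ((expw l t)%:E * ((t%:E < s)%E%:R)%:E) =
   1 - expeR (- (l%:E * s)))%E.
Proof.
move=> l0 s0.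
have mS (T : set R) : measurable T -> True by [].
have := integral_expw_ge l0 s0; have := integral_expw l0.
have -> : (fun t => (expw l t)%:E) = (fun t => (expw l t)%:E * ((t%:E < s)%E%:R)%:E
    + (expw l t)%:E * ((s <= t%:E)%E%:R)%:E)%E.
  apply/funext => t; rewrite -!EFinM -EFinD; congr EFin.
  by rewrite ltNge; case: (s <= t%:E)%E => /=; rewrite !(mulr1, mulr0, addr0, add0r).
have ms : measurable_fun setT (fun t : R => ((s <= t%:E)%E%:R : R)).
  by apply: measurable_indic_bool; rewrite -[X in measurable X]setTI;
    exact: measurable_lee.
have ms' : measurable_fun setT (fun t : R => ((t%:E < s)%E%:R : R)).
  have -> : (fun t : R => ((t%:E < s)%E%:R : R)) = (fun t => 1 - (s <= t%:E)%E%:R).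
    by apply/funext => t; rewrite ltNge; case: (s <= t%:E)%E; rewrite /= ?subrr ?subr0.
  exact: measurable_funB.
have mw := measurable_expw l.
rewrite ge0_integralD//; last 4 first.
- by move=> t _; rewrite mule_ge0// lee_fin expw_ge0.
- by apply: emeasurable_funM; exact/measurable_EFinP.
- by move=> t _; rewrite mule_ge0// lee_fin expw_ge0.
- by apply: emeasurable_funM; exact/measurable_EFinP.
set I := (\int[_]_t _)%E => + hJ; rewrite hJ => hI.
have e0 : (0 <= expeR (- (l%:E * s)) <= 1)%E.
  rewrite expeR_ge0/= -expeR0 lee_expeR// oppe_le0 mule_ge0// lee_fin ltW//.
have : (l%:E * (I + (l^-1)%:E * expeR (- (l%:E * s))) = 1)%E.
  by rewrite hI -EFinM mulfV// gt_eqF.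
clearbody I; clear hI.
have /fineK <- : expeR (- (l%:E * s)) \is a fin_num.
  by rewrite ge0_fin_numE ?(le_lt_trans (proj2 (andP e0))) ?ltry//; case/andP: e0.
move: (fine _) => e; rewrite -EFinM; case: I => [i| |].
- rewrite -EFinD -!EFinM mulrDr mulrA mulfV ?gt_eqF// mul1r => -[h].
  by rewrite -h -EFinB addrK.
- by rewrite addye// gt0_muley ?lte_fin.
- by rewrite addNye// gt0_muleNy ?lte_fin.
Qed.

End exponential_weight.

Lemma ge0_nondecreasing_cvg_integral {R : realType} d (T : measurableType d)
    (m : {measure set T -> \bar R}) (D : set T) (u : nat -> T -> \bar R)
    (v : T -> \bar R) : measurable D ->
  (forall n, measurable_fun D (u n)) ->
  (forall n x, D x -> (0 <= u n x)%E) ->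
  (forall x, D x -> {homo u^~ x : a b / (a <= b)%N >-> (a <= b)%E}) ->
  (forall x, D x -> u n x @[n --> \oo] --> v x) ->
  (\int[m]_(x in D) u n x @[n --> \oo] --> \int[m]_(x in D) v x)%E.
Proof.
move=> mD mu u0 ndu cu.
have -> : (\int[m]_(x in D) v x = \int[m]_(x in D) limn (u ^~ x))%E.
  by apply: eq_integral => x /set_mem Dx; apply/esym/cvg_lim => //; exact: cu.
exact: cvg_monotone_convergence.
Qed.

Section kernel_identity.
Context {R : realType} d (W : measurableType d) d' (Z : measurableType d').
Variables (m : {measure set W -> \bar R}) (T : W -> Z)
  (k : W -> {measure set Z -> \bar R}) (A : set W).
Hypotheses (mT : measurable_fun setT T) (mA : measurable A)
  (mk : forall B, measurable B -> measurable_fun setT (fun w => k w B))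
  (hk : forall B, measurable B -> (m (A `&` T @^-1` B) = \int[m]_(w in A) k w B)%E).
Import HBNNSimple.

Let kernel_identity_nnsfun (h : {nnsfun Z >-> R}) :
  (\int[m]_(w in A) (h (T w))%:E = \int[m]_(w in A) (\int[k w]_z (h z)%:E))%E.
Proof.
have mh (r : R) : measurable (h @^-1` [set r]) by exact: measurable_sfunP.
under [RHS]eq_integral => w _ do rewrite integralT_nnsfun sintegralE.
rewrite ge0_integral_fsum//; last 2 first.
- by move=> r; apply: emeasurable_funM => //; apply: measurable_funTS; exact: mk.
- move=> r w _; have [r0|r0] := leP 0 r; first by rewrite mule_ge0.
  by rewrite preimage_nnfun0// measure0 mule0.
transitivity (\int[m]_(w in A) \sum_(r \in range h) (r * \1_(h @^-1` [set r]) (T w))%:E)%E.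
  by apply: eq_integral => w _; rewrite fimfunE -fsumEFin.
rewrite ge0_integral_fsum//; last 2 first.
- move=> r; apply/measurable_EFinP/measurable_funM => //.
  apply: measurable_funTS; apply: (@measurableT_comp _ _ _ _ _ _ (\1_(h @^-1` [set r]) : Z -> R)) => //.
- move=> r w _; rewrite lee_fin; have [r0|r0] := leP 0 r; first by rewrite mulr_ge0.
  by rewrite preimage_nnfun0// indicE in_set0 mulr0.
apply: eq_fsbigr => r _.
have [r0|r0] := leP 0 r; last first.
  rewrite [LHS]integral0_eq ?[RHS]integral0_eq// => w _.
    by rewrite preimage_nnfun0// measure0 mule0.
  by rewrite preimage_nnfun0// indicE in_set0 mulr0.
rewrite [RHS]ge0_integralZl//; last first.
  by apply: measurable_funTS; exact: mk.
under eq_integral => w _ do rewrite EFinM.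
rewrite [LHS]ge0_integralZl//; last first.
  by apply/measurable_EFinP; apply: measurable_funTS;
    apply: (@measurableT_comp _ _ _ _ _ _ (\1_(h @^-1` [set r]) : Z -> R)).
congr (_ * _)%E; rewrite -hk//.
rewrite setIC -integral_indic//; last first.
  by rewrite -[X in measurable X]setTI; exact: mT.
Qed.

(** The strong Markov property is stated for events; simple functions and monotone limits extend
    such an identity to nonnegative integrands. *)
Lemma integral_kernel_identity (g : Z -> \bar R) :
  measurable_fun setT g -> (forall z, 0 <= g z)%E ->
  (\int[m]_(w in A) g (T w) = \int[m]_(w in A) (\int[k w]_z g z))%E.
Proof.
move=> mg g0.
pose g_ := nnsfun_approx measurableT mg.
have cg z : (g_ n z)%:E @[n --> \oo] --> g z by exact: cvg_nnsfun_approx.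
have ndg z : {homo (fun n => (g_ n z)%:E) : a b / (a <= b)%N >-> (a <= b)%E}.
  by move=> a b ab; rewrite lee_fin; exact/lefP/nd_nnsfun_approx.
have lhs : (\int[m]_(w in A) (g_ n (T w))%:E @[n --> \oo] -->
            \int[m]_(w in A) g (T w))%E.
  apply: ge0_nondecreasing_cvg_integral => //.
  - move=> n; apply/measurable_EFinP/measurable_funTS.
    by apply: (@measurableT_comp _ _ _ _ _ _ (g_ n)).
  - by move=> n w _; rewrite lee_fin.
have inner w : (\int[k w]_z (g_ n z)%:E @[n --> \oo] --> \int[k w]_z g z)%E.
  apply: ge0_nondecreasing_cvg_integral => //.
  - by move=> n; exact/measurable_EFinP.
  - by move=> n z _; rewrite lee_fin.
have rhs : (\int[m]_(w in A) (\int[k w]_z (g_ n z)%:E) @[n --> \oo] -->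
            \int[m]_(w in A) \int[k w]_z g z)%E.
  apply: ge0_nondecreasing_cvg_integral => //.
  - move=> n; apply: measurable_funTS; apply: measurable_fun_integral_kernel => //.
    + by move=> z; rewrite lee_fin.
    + exact/measurable_EFinP.
  - by move=> n w _; apply: integral_ge0 => z _; rewrite lee_fin.
  - move=> w _ a b ab; apply: ge0_le_integral => //.
    + by move=> z _; rewrite lee_fin.
    + exact/measurable_EFinP.
    + exact/measurable_EFinP.
    + by move=> z _; exact: ndg.
rewrite -(cvg_lim (@ereal_hausdorff R) lhs) -(cvg_lim (@ereal_hausdorff R) rhs).
by congr (limn _); apply/funext => n; exact: kernel_identity_nnsfun.
Qed.

End kernel_identity.

(** * The strong Markov property and Dynkin's formula *)

Section strong_markov.
Context {R : realType} {E : pointedMetricType R}.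
Hypothesis hlc : locally_compact [set: E].
Hypothesis hsep : separable_space E.
Notation ED := (cemetery_ext E).
Context {d : measure_display} {W : measurableType d}.
Variables (X : R -> W -> ED) (P : ED -> probability W R).
Hypothesis hX : hunt_process X P.
Notation Xpos := (Xpos X).
Notation leb := (@lebesgue_measure R).

Lemma measurable_cylinders (I : set R) (A : set W) :
  (forall s, I s -> 0 <= s) -> <<s cylinders X I >> A -> measurable A.
Proof.
move=> I0; move: A; apply: smallest_sub; first exact: sigma_algebra_measurable.
move=> _ [s [Is [B [mB ->]]]]; rewrite -[X in measurable X]setTI.
by apply: (hunt_measurable hX) => //; exact: I0.
Qed.

Lemma measurable_history_right (t : R) (A : set W) :
  history_right X t A -> measurable A.
Proof.
move=> /(_ (t + 1)); rewrite ltrDl ltr01 => /(_ isT).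
by apply: measurable_cylinders => s /=; rewrite in_itv/= => /andP[].
Qed.

Lemma history_right_sub (s t : R) : s <= t -> history_right X s `<=` history_right X t.
Proof. by move=> st A hA r tr; apply: hA; exact: le_lt_trans tr. Qed.

Lemma history_right_all (t : R) : history_right X t `<=` history_all X.
Proof.
move=> A /(_ (t + 1)); rewrite ltrDl ltr01 => /(_ isT).
apply: sub_sigma_algebra2 => _ [s [st [B [mB ->]]]]; exists s; split.
  by move: st => /=; rewrite !in_itv/= => /andP[->].
by exists B.
Qed.

Variable sigma : W -> \bar R.
Hypothesis hs : stopping_time X sigma.

Lemma stopping_time_ge0 w : (0 <= sigma w)%E.
Proof. by have [] := hs. Qed.

Lemma measurable_stopping_time : measurable_fun setT sigma.
Proof.
have mle (r : R) : measurable [set w | (sigma w <= r%:E)%E].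
  have [r0|r0] := leP 0 r.
    by have [_ /(_ r r0)] := hs; exact: measurable_history_right.
  rewrite (_ : [set _ | _] = set0)//; apply/seteqP; split => // w /= sr.
  by have := le_trans (stopping_time_ge0 w) sr; rewrite lee_fin leNgt r0.
apply: (measurability _ (ErealGenOInfty.measurableE R)) => //.
move=> _ [_ [r ->] <-]; rewrite setTI.
rewrite (_ : _ @^-1` _ = ~` [set w | (sigma w <= r%:E)%E]).
  exact: measurableC.
apply/seteqP; split => w /=; rewrite in_itv/= andbT ltNge; first by move/negP.
by move=> /negP.
Qed.

Lemma measurable_at_time : measurable_fun setT (fun p : R * W =>
  at_time X (sigma p.2 + (Num.max p.1 0)%:E)%E p.2 : borel ED).
Proof.
have -> : (fun p : R * W => at_time X (sigma p.2 + (Num.max p.1 0)%:E)%E p.2 : borel ED) =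
  (fun p : R * W => if sigma p.2 == +oo%E then None
                    else Xpos (fine (sigma p.2) + Num.max p.1 0) p.2).
  apply/funext => -[t w] /=; have := stopping_time_ge0 w.
  case: (sigma w) => [s| |]//=; rewrite lee_fin => s0.
  by rewrite XposE// addr_ge0// le_max lexx orbT.
have ms : measurable_fun setT (fun p : R * W => sigma p.2).
  by apply: measurableT_comp => //; exact: measurable_stopping_time.
apply: measurable_fun_if => //.
- apply: (measurable_fun_bool true).
  rewrite setTI (_ : _ @^-1` _ = (fun p : R * W => sigma p.2) @^-1` [set +oo%E]).
    by rewrite -[X in measurable X]setTI; apply: ms => //; exact: emeasurable_set1.
  by apply/seteqP; split => p /= /eqP.
- apply: measurable_funTS.
  apply: (@measurableT_comp _ _ _ _ _ _ (fun q : R * W => Xpos q.1 q.2) _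
    (fun p : R * W => (fine (sigma p.2) + Num.max p.1 0, p.2))).
    exact: (measurable_process hlc hsep hX).
  apply: measurable_fun_pair => //; apply: measurable_funD.
    by apply: measurableT_comp.
  by apply: measurable_maxr.
Qed.

Lemma measurable_at_time_fixed (s : R) : 0 <= s ->
  measurable_fun setT (fun w => at_time X (sigma w + s%:E)%E w : borel ED).
Proof.
move=> s0.
have m2 : measurable_fun setT (fun w : W => (s, w)) by apply: measurable_fun_pair; [exact: measurable_cst|exact: measurable_id].
have := measurableT_comp measurable_at_time m2.
by apply: eq_measurable_fun => w _ /=; rewrite max_l.
Qed.

Lemma measurable_at_stopping_time :
  measurable_fun setT (fun w => at_time X (sigma w) w : borel ED).
Proof.
apply: eq_measurable_fun (measurable_at_time_fixed (lexx 0)).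
by move=> w _; rewrite adde0.
Qed.

Lemma stopped_history_le (r : R) : 0 <= r ->
  stopped_history X sigma [set w | (sigma w <= r%:E)%E].
Proof.
move=> r0; have [_ hsr] := hs; split; first by apply: (@history_right_all r); exact: hsr.
move=> t t0; have [rt|tr] := leP r t.
  rewrite (_ : _ `&` _ = [set w | (sigma w <= r%:E)%E]).
    by apply: (history_right_sub rt); exact: hsr.
  by apply/seteqP; split => w /= => [[]//|sr]; split => //;
    apply: le_trans sr _; rewrite lee_fin.
rewrite (_ : _ `&` _ = [set w | (sigma w <= t%:E)%E]); first exact: hsr.
apply/seteqP; split => w /= => [[]//|st]; split => //.
by apply: le_trans st _; rewrite lee_fin ltW.
Qed.

Lemma strong_markov_integral x (s r : R) (g : borel ED -> \bar R) :
  0 <= s -> 0 <= r -> measurable_fun setT g -> (forall y, 0 <= g y)%E ->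
  (\int[P x]_(w in [set w | sigma w <= r%:E])
      g (at_time X (sigma w + s%:E) w) =
   \int[P x]_(w in [set w | sigma w <= r%:E])
      \int[P (at_time X (sigma w) w)]_v g (Xpos s v))%E.
Proof.
move=> s0 r0 mg g0.
pose k w : {measure set (borel ED) -> \bar R} :=
  measure_function_pushforward__canonical__measure_function_Measure
    (P (at_time X (sigma w) w)) (measurable_Xpos hX s).
rewrite (@integral_kernel_identity _ _ _ _ _ (P x)
  (fun w => at_time X (sigma w + s%:E) w : borel ED) k)//.
- apply: eq_integral => w _.
  by rewrite /k ge0_integral_pushforward//; exact: (measurable_Xpos hX).
- exact: measurable_at_time_fixed.
- by have [_ /(_ _ r0)] := hs; exact: measurable_history_right.
- move=> B mB.
  apply: eq_measurable_fun (measurableT_comp (hunt_law_measurable hX s0 mB) measurable_at_stopping_time).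
  by move=> w _; rewrite /k /= /pushforward XposE.
- move=> B mB.
  apply: (eq_trans (hunt_strong_markov hX x hs s0 mB (stopped_history_le r0))).
  by apply: eq_integral => w _; rewrite /k /= /pushforward XposE.
Qed.

(** The factor [expeR (- (l%:E * sigma w))] is [l] times the discount integrated over times after
    [sigma w]. The weighted integral is thus an average over [r] of integrals over the events
    [sigma <= r], which belong to the history stopped at [sigma], where the strong Markov property
    applies. *)
Lemma integral_expeR_stopping x (l : R) (Y : W -> \bar R) : 0 < l ->
  measurable_fun setT Y -> (forall w, 0 <= Y w)%E ->
  (\int[P x]_w (expeR (- (l%:E * sigma w)) * Y w) =
   l%:E * \int[leb]_r ((expw l r)%:E *
      \int[P x]_(w in [set w | sigma w <= r%:E]) Y w))%E.
Proof.
move=> l0 mY Y0.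
pose f (p : R * W) := ((expw l p.1)%:E * (((sigma p.2 <= p.1%:E)%E%:R)%:E * Y p.2))%E.
have ms2 : measurable_fun setT (fun p : R * W => sigma p.2).
  by apply: measurableT_comp => //; exact: measurable_stopping_time.
have mle : measurable_fun setT (fun p : R * W => ((sigma p.2 <= p.1%:E)%E%:R : R)).
  apply: measurable_indic_bool; rewrite -[X in measurable X]setTI.
  by apply: measurable_lee => //; apply/measurable_EFinP.
have mf : measurable_fun setT f.
  apply: emeasurable_funM.
    by apply/measurable_EFinP; apply: measurableT_comp => //; exact: measurable_expw.
  apply: emeasurable_funM; first exact/measurable_EFinP.
  exact: measurableT_comp.
have f0 p : (0 <= f p)%E.
  by rewrite /f mule_ge0 ?lee_fin ?expw_ge0// mule_ge0.
have fub := @fubini_tonelli _ _ _ _ _ leb (P x) f mf f0.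
transitivity (l%:E * \int[P x]_w \int[leb]_r f (r, w))%E.
  rewrite -ge0_integralZl//; last 3 first.
  - exact: measurable_fun_fubini_tonelli_G.
  - by move=> w _; exact: integral_ge0.
  - by rewrite lee_fin ltW.
  apply: eq_integral => w _.
  have -> : (\int[leb]_r f (r, w) =
      \int[leb]_r ((expw l r)%:E * ((sigma w <= r%:E)%E%:R)%:E) * Y w)%E.
    rewrite -ge0_integralZr//; last 2 first.
    - apply: emeasurable_funM; first by apply/measurable_EFinP; exact: measurable_expw.
      apply/measurable_EFinP; apply: measurable_indic_bool.
      by rewrite -[X in measurable X]setTI; apply: measurable_lee.
    - by move=> t _; rewrite mule_ge0// lee_fin ?expw_ge0.
    by apply: eq_integral => r _; rewrite /f/= muleA.
  rewrite integral_expw_ge ?stopping_time_ge0// !muleA -EFinM mulfV ?gt_eqF//.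
  by rewrite mul1e.
rewrite -fub; congr (_ * _)%E; apply: eq_integral => r _.
rewrite /f/= ge0_integralZl//; last 3 first.
- apply: emeasurable_funM => //; apply/measurable_EFinP; apply: measurable_indic_bool.
  rewrite -[X in measurable X]setTI; apply: measurable_lee => //.
  exact: measurable_stopping_time.
- by move=> w _; rewrite mule_ge0.
- by rewrite lee_fin expw_ge0.
congr (_ * _)%E; rewrite [RHS]integral_mkcond; apply: eq_integral => w _.
rewrite patchE; have [sr|sr] := boolP (sigma w <= r%:E)%E.
  by rewrite mem_set ?mul1e.
by rewrite memNset ?mul0e//; exact/negP.
Qed.

End strong_markov.

Section resolvents.
Context {R : realType} {E : pointedMetricType R}.
Hypothesis hlc : locally_compact [set: E].
Hypothesis hsep : separable_space E.
Notation ED := (cemetery_ext E).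
Context {d : measure_display} {W : measurableType d}.
Variables (X : R -> W -> ED) (P : ED -> probability W R).
Hypothesis hX : hunt_process X P.
Notation Xpos := (Xpos X).
Notation leb := (@lebesgue_measure R).

Definition green (l : R) (g : ED -> \bar R) (y : ED) : \bar R :=
  (\int[leb]_t ((expw l t)%:E * \int[P y]_w g (Xpos t w)))%E.

Definition killed_green (sigma : W -> \bar R) (l : R) (g : ED -> \bar R) (y : ED)
    : \bar R :=
  (\int[P y]_w \int[leb]_t
     ((expw l t)%:E * (((t%:E < sigma w)%E%:R)%:E * g (Xpos t w))))%E.

Section ge0.
Variable g : borel ED -> \bar R.
Hypotheses (mg : measurable_fun setT g) (g0 : forall y, (0 <= g y)%E).

Lemma res_ge0 l y : (0 <= green l g y)%E.
Proof.
apply: integral_ge0 => t _; rewrite mule_ge0// ?lee_fin ?expw_ge0//.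
exact: integral_ge0.
Qed.

Let measurable_expw_comp d' (Y : measurableType d') l (f : R * Y -> \bar R) :
  measurable_fun setT f ->
  measurable_fun setT (fun p : R * Y => (expw l p.1)%:E * f p)%E.
Proof.
move=> mf; apply: emeasurable_funM => //.
by apply/measurable_EFinP; apply: measurableT_comp => //; exact: measurable_expw.
Qed.

Lemma measurable_comp_process : measurable_fun setT (fun p : R * W => g (Xpos p.1 p.2)).
Proof.
exact: (measurableT_comp mg (measurable_process hlc hsep hX)).
Qed.

Lemma measurable_semigroup_time y :
  measurable_fun setT (fun t : R => \int[P y]_w g (Xpos t w))%E.
Proof.
have m2 : measurable_fun setT (fun t : R => (t, y : borel ED)).
  by apply: measurable_fun_pair; [exact: measurable_id|exact: measurable_cst].
exact: (measurableT_comp (measurable_semigroup hlc hsep hX mg g0) m2).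
Qed.

Lemma measurable_res l : measurable_fun setT (green l g : borel ED -> \bar R).
Proof.
pose f (p : R * borel ED) := ((expw l p.1)%:E * \int[P p.2]_w g (Xpos p.1 w))%E.
apply: (@measurable_fun_fubini_tonelli_G _ _ _ _ _ leb f).
  by apply: measurable_expw_comp; exact: measurable_semigroup.
move=> p; rewrite /f mule_ge0// ?lee_fin ?expw_ge0//.
exact: integral_ge0.
Qed.

Lemma res_path l y :
  (green l g y = \int[P y]_w \int[leb]_t ((expw l t)%:E * g (Xpos t w)))%E.
Proof.
pose f (p : R * W) := ((expw l p.1)%:E * g (Xpos p.1 p.2))%E.
have mf : measurable_fun setT f.
  by apply: measurable_expw_comp; exact: measurable_comp_process.
have f0 p : (0 <= f p)%E by rewrite /f mule_ge0 ?lee_fin ?expw_ge0.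
rewrite -(@fubini_tonelli _ _ _ _ _ leb (P y) f mf f0).
apply: eq_integral => t _; rewrite /f/= ge0_integralZl//.
- exact: (measurableT_comp mg (measurable_Xpos hX t)).
- by rewrite lee_fin expw_ge0.
Qed.

Section dynkin.
Variable sigma : W -> \bar R.
Hypothesis hs : stopping_time X sigma.

Lemma measurable_before_stopping :
  measurable_fun setT (fun p : R * W => ((p.1%:E < sigma p.2)%E%:R : R)).
Proof.
have ms2 : measurable_fun setT (fun p : R * W => sigma p.2).
  by apply: measurableT_comp => //; exact: (measurable_stopping_time hX hs).
have -> : (fun p : R * W => ((p.1%:E < sigma p.2)%E%:R : R)) =
    (fun p => 1 - (sigma p.2 <= p.1%:E)%E%:R).
  by apply/funext => p; rewrite ltNge; case: (sigma p.2 <= p.1%:E)%E;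
    rewrite /= ?subrr ?subr0.
apply: measurable_funB => //; apply: measurable_indic_bool.
rewrite -[X in measurable X]setTI; apply: measurable_lee => //.
exact/measurable_EFinP.
Qed.

Lemma killed_res_ge0 l y : (0 <= killed_green sigma l g y)%E.
Proof.
apply: integral_ge0 => w _; apply: integral_ge0 => t _.
by rewrite !mule_ge0// lee_fin ?expw_ge0.
Qed.

Lemma measurable_killed_integrand l : measurable_fun setT (fun p : R * W =>
  (expw l p.1)%:E * (((p.1%:E < sigma p.2)%E%:R)%:E * g (Xpos p.1 p.2)))%E.
Proof.
apply: measurable_expw_comp; apply: emeasurable_funM.
  by apply/measurable_EFinP; exact: measurable_before_stopping.
exact: measurable_comp_process.
Qed.

Lemma measurable_killed_path l : measurable_fun setT (fun w => \int[leb]_t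
  ((expw l t)%:E * (((t%:E < sigma w)%E%:R)%:E * g (Xpos t w))))%E.
Proof.
apply: (@measurable_fun_fubini_tonelli_G _ _ _ _ _ leb (fun p : R * W =>
  ((expw l p.1)%:E * (((p.1%:E < sigma p.2)%E%:R)%:E * g (Xpos p.1 p.2)))%E)).
  exact: measurable_killed_integrand.
by move=> p; rewrite !mule_ge0// lee_fin ?expw_ge0.
Qed.

Let after_stopping l w : 0 < l ->
  (\int[leb]_t ((expw l t)%:E * (expeR (- (l%:E * sigma w)) *
      g (at_time X (sigma w + (Num.max t 0)%:E) w))) =
   \int[leb]_t ((expw l t)%:E * (((sigma w <= t%:E)%E%:R)%:E * g (Xpos t w))))%E.
Proof.
move=> l0; have := stopping_time_ge0 hs w; case: (sigma w) => [s| |]//=; last first.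
  move=> _; rewrite gt0_muley ?lte_fin//=.
  rewrite !integral0_eq// => t _; first by rewrite !(mul0e, mule0).
  by rewrite !(mul0e, mule0).
rewrite lee_fin => s0.
rewrite -[RHS](integral_translation s); last 2 first.
- apply: emeasurable_funM; first by apply/measurable_EFinP; exact: measurable_expw.
  apply: emeasurable_funM.
    apply/measurable_EFinP; apply: measurable_indic_bool.
    by rewrite -[X in measurable X]setTI; apply: measurable_lee => //; exact/measurable_EFinP.
  have m2 : measurable_fun setT (fun t : R => (t, w)).
    by apply: measurable_fun_pair; [exact: measurable_id|exact: measurable_cst].
  exact: (measurableT_comp measurable_comp_process m2).
- by move=> t; rewrite !mule_ge0// lee_fin ?expw_ge0.
apply: eq_integral => t _; rewrite lee_fin lerDl.
have [t0|t0] := leP 0 t; last by rewrite expw_neg// mul0e/= mul0e mule0.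
rewrite !expw_pos ?addr_ge0//= mul1e muleA -EFinM XposE ?addr_ge0//.
by congr (_%:E * _)%E; rewrite mulrDr opprD expRD; exact: mulrC.
Qed.

(** The time integral splits at [sigma]. The later piece is shifted back by [sigma], and the strong
    Markov property turns it into the discounted potential at the position reached. Written as a
    sum, the identity makes sense for infinite potentials as well. *)
Lemma dynkin_formula l x : 0 < l ->
  (green l g x = killed_green sigma l g x +
   \int[P x]_w (expeR (- (l%:E * sigma w)) * green l g (at_time X (sigma w) w)))%E.
Proof.
move=> l0.
have mst := measurable_stopping_time hX hs.
have me : measurable_fun setT (fun w => expeR (- (l%:E * sigma w)))%E.
  apply: measurableT_comp; first exact: measurable_expeR.
  by apply: measurableT_comp => //; apply: emeasurable_funM.
have mgat : measurable_fun setT (fun p : R * W =>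
    g (at_time X (sigma p.2 + (Num.max p.1 0)%:E)%E p.2)).
  exact: (measurableT_comp mg (measurable_at_time hlc hsep hX hs)).
have mat0 : measurable_fun setT (fun p : R * W =>
    (p.1, at_time X (sigma p.2) p.2 : borel ED)).
  apply: measurable_fun_pair => //.
  apply: (@measurableT_comp _ _ _ _ _ _ (fun w => at_time X (sigma w) w : borel ED)).
    exact: (measurable_at_stopping_time hlc hsep hX hs).
  exact: measurable_snd.
have msg := measurableT_comp (measurable_semigroup hlc hsep hX mg g0) mat0.
have -> : (\int[P x]_w (expeR (- (l%:E * sigma w)) * green l g (at_time X (sigma w) w)) =
   \int[P x]_w \int[leb]_t ((expw l t)%:E * (expeR (- (l%:E * sigma w)) *
      g (at_time X (sigma w + (Num.max t 0)%:E) w))))%E.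
  transitivity (\int[P x]_w \int[leb]_t ((expw l t)%:E *
      (expeR (- (l%:E * sigma w)) * \int[P (at_time X (sigma w) w)]_v g (Xpos t v))))%E.
    apply: eq_integral => w _; rewrite /green -ge0_integralZl//; last 3 first.
    - apply: emeasurable_funM; first by apply/measurable_EFinP; exact: measurable_expw.
      exact: measurable_semigroup_time.
    - by move=> t _; rewrite mule_ge0// ?lee_fin ?expw_ge0//; exact: integral_ge0.
    - exact: expeR_ge0.
    by apply: eq_integral => t _; rewrite muleCA.
  rewrite -(@fubini_tonelli _ _ _ _ _ leb (P x) (fun p : R * W => (expw l p.1)%:E *
      (expeR (- (l%:E * sigma p.2)) *
        \int[P (at_time X (sigma p.2) p.2)]_v g (Xpos p.1 v)))%E); last 2 first.
  - apply: measurable_expw_comp; apply: emeasurable_funM => //.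
    by apply: (measurableT_comp me).
  - move=> p; rewrite !mule_ge0// ?lee_fin ?expw_ge0// ?expeR_ge0//.
    exact: integral_ge0.
  rewrite -(@fubini_tonelli _ _ _ _ _ leb (P x) (fun p : R * W => (expw l p.1)%:E *
      (expeR (- (l%:E * sigma p.2)) *
        g (at_time X (sigma p.2 + (Num.max p.1 0)%:E) p.2)))%E); last 2 first.
  - apply: measurable_expw_comp; apply: emeasurable_funM => //.
    by apply: (measurableT_comp me).
  - by move=> p; rewrite !mule_ge0// ?lee_fin ?expw_ge0// expeR_ge0.
  apply: eq_integral => t _ /=.
  have [t0|t0] := leP 0 t; last first.
    by rewrite expw_neg// !integral0_eq// => w _; rewrite mul0e.
  have mg1 : measurable_fun setT (fun w => g (at_time X (sigma w + t%:E)%E w)).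
    exact: (measurableT_comp mg (measurable_at_time_fixed hlc hsep hX hs t0)).
  have mg2 : measurable_fun setT (fun w =>
      \int[P (at_time X (sigma w) w)]_v g (Xpos t v))%E.
    have m2 : measurable_fun setT (fun w : W => (t, w)).
      by apply: measurable_fun_pair; [exact: measurable_cst|exact: measurable_id].
    exact: (measurableT_comp msg m2).
  rewrite !ge0_integralZl// ?lee_fin ?expw_ge0//; last 4 first.
  - exact: emeasurable_funM.
  - by move=> w _; rewrite mule_ge0 ?expeR_ge0 ?integral_ge0.
  - exact: emeasurable_funM.
  - by move=> w _; rewrite mule_ge0 ?expeR_ge0 ?integral_ge0.
  congr (_ * _)%E.
  rewrite !(integral_expeR_stopping hX hs)//; last by move=> w; exact: integral_ge0.
  congr (_ * _)%E; apply: eq_integral => r _.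
  have [r0|r0] := leP 0 r; last by rewrite expw_neg// !mul0e.
  by rewrite (strong_markov_integral hlc hsep hX hs).
rewrite res_path /killed_green -ge0_integralD//; last 4 first.
- by move=> w _; apply: integral_ge0 => t _; rewrite !mule_ge0// lee_fin ?expw_ge0.
- exact: measurable_killed_path.
- move=> w _; apply: integral_ge0 => t _; rewrite !mule_ge0// ?lee_fin ?expw_ge0//.
  exact: expeR_ge0.
- apply: (@measurable_fun_fubini_tonelli_G _ _ _ _ _ leb (fun p : R * W => (expw l p.1)%:E *
      (expeR (- (l%:E * sigma p.2)) *
        g (at_time X (sigma p.2 + (Num.max p.1 0)%:E) p.2)))%E).
    apply: measurable_expw_comp; apply: emeasurable_funM => //.
    by apply: (measurableT_comp me).
  by move=> p; rewrite !mule_ge0// ?lee_fin ?expw_ge0// expeR_ge0.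
apply: eq_integral => w _; rewrite after_stopping// -ge0_integralD//.
- apply: eq_integral => t _; rewrite ltNge.
  by case: (sigma w <= t%:E)%E; rewrite !(mul1e, mul0e, mule0, adde0, add0e).
- by move=> t _; rewrite !mule_ge0// lee_fin ?expw_ge0.
- have m2 : measurable_fun setT (fun t : R => (t, w)).
    by apply: measurable_fun_pair; [exact: measurable_id|exact: measurable_cst].
  exact: (measurableT_comp (measurable_killed_integrand l) m2).
- by move=> t _; rewrite !mule_ge0// lee_fin ?expw_ge0.
- apply: emeasurable_funM; first by apply/measurable_EFinP; exact: measurable_expw.
  apply: emeasurable_funM.
    apply/measurable_EFinP; apply: measurable_indic_bool.
    by rewrite -[X in measurable X]setTI; apply: measurable_lee => //; exact/measurable_EFinP.
  have m2 : measurable_fun setT (fun t : R => (t, w)).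
    by apply: measurable_fun_pair; [exact: measurable_id|exact: measurable_cst].
  exact: (measurableT_comp measurable_comp_process m2).
Qed.

End dynkin.
End ge0.
End resolvents.

(** * The semigroup law and the resolvent identity *)

Section resolvent_identity.
Context {R : realType} {E : pointedMetricType R}.
Hypothesis hlc : locally_compact [set: E].
Hypothesis hsep : separable_space E.
Notation ED := (cemetery_ext E).
Context {d : measure_display} {W : measurableType d}.
Variables (X : R -> W -> ED) (P : ED -> probability W R).
Hypothesis hX : hunt_process X P.
Notation Xpos := (Xpos X).
Notation res := (green X P).
Notation leb := (@lebesgue_measure R).

Lemma stopping_time_cst (s : R) : 0 <= s -> stopping_time X (cst s%:E).
Proof.
move=> s0; split; first by move=> w; rewrite lee_fin.
move=> t t0 r tr.
have [st|st] := leP s t.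
  rewrite (_ : [set _ | _] = ~` set0); last first.
    by rewrite setC0; apply/seteqP; split => w //= _; rewrite lee_fin.
  by rewrite -setTD; apply: sigma_algebraCD; exact: sigma_algebra0.
rewrite (_ : [set _ | _] = set0); first exact: sigma_algebra0.
by apply/seteqP; split => w //=; rewrite lee_fin leNgt st.
Qed.

Section ge0.
Variable g : borel ED -> \bar R.
Hypotheses (mg : measurable_fun setT g) (g0 : forall y, (0 <= g y)%E).

Lemma semigroup_law y (s t : R) : 0 <= s -> 0 <= t ->
  (\int[P y]_w g (Xpos (s + t) w) =
   \int[P y]_w \int[P (Xpos s w)]_v g (Xpos t v))%E.
Proof.
move=> s0 t0.
have := strong_markov_integral hlc hsep hX (stopping_time_cst s0) y t0 s0 mg g0.
have -> : [set w : W | (cst s%:E w <= s%:E)%E] = setT.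
  by apply/seteqP; split => w //= _; rewrite lee_fin.
rewrite /= => h; rewrite /Xpos; under eq_integral do rewrite max_l ?addr_ge0//.
by rewrite h; apply: eq_integral => w _; rewrite max_l.
Qed.

Let phi y (t : R) : \bar R := (\int[P y]_w g (Xpos t w))%E.

Let phi0 y t : (0 <= phi y t)%E. Proof. exact: integral_ge0. Qed.

Let mphi y : measurable_fun setT (phi y).
Proof. exact: (measurable_semigroup_time hlc hsep hX mg g0). Qed.

Let mphiD y (f : R * R -> R) : measurable_fun setT f ->
  measurable_fun setT (fun p : R * R => phi y (f p)).
Proof. exact: measurableT_comp. Qed.

Lemma res_res l b y : (res l (res b g) y =
  \int[leb]_s \int[leb]_t ((expw l s)%:E * ((expw b t)%:E * phi y (s + t))))%E.
Proof.
apply: eq_integral => s _.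
rewrite ge0_integralZl//; last 3 first.
- apply: emeasurable_funM; first by apply/measurable_EFinP; exact: measurable_expw.
  by apply: (measurableT_comp (mphi y)); exact: measurable_funD.
- by move=> t _; rewrite mule_ge0// lee_fin expw_ge0.
- by rewrite lee_fin expw_ge0.
have [s0|s0] := leP 0 s; last by rewrite expw_neg// !mul0e.
congr (_ * _)%E.
pose f (p : R * W) := ((expw b p.1)%:E * \int[P (Xpos s p.2)]_v g (Xpos p.1 v))%E.
have m2 : measurable_fun setT (fun p : R * W => (p.1, Xpos s p.2)).
  apply: measurable_fun_pair => //.
  exact: (measurableT_comp (measurable_Xpos hX s) measurable_snd).
have mf : measurable_fun setT f.
  apply: emeasurable_funM.
    by apply/measurable_EFinP; apply: measurableT_comp => //; exact: measurable_expw.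
  exact: (measurableT_comp (measurable_semigroup hlc hsep hX mg g0) m2).
have f0 p : (0 <= f p)%E by rewrite /f mule_ge0 ?lee_fin ?expw_ge0// integral_ge0.
rewrite -[LHS](@fubini_tonelli _ _ _ _ _ leb (P y) f mf f0).
apply: eq_integral => t _.
have [t0|t0] := leP 0 t; last first.
  rewrite expw_neg// mul0e; apply: integral0_eq => w _.
  by rewrite /f /= expw_neg// mul0e.
rewrite /f/= ge0_integralZl//; last 3 first.
- have m3 : measurable_fun setT (fun w : W => (t, w)).
    by apply: measurable_fun_pair; [exact: measurable_cst|exact: measurable_id].
  exact: (measurableT_comp (measurableT_comp (measurable_semigroup hlc hsep hX mg g0) m2) m3).
- by move=> w _; exact: integral_ge0.
- by rewrite lee_fin expw_ge0.
by congr (_ * _)%E; rewrite /phi semigroup_law.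
Qed.

Let mres2 l b y : measurable_fun setT (fun p : R * R =>
  ((expw l p.1)%:E * ((expw b p.2)%:E * phi y (p.1 + p.2)%R)))%E.
Proof.
apply: emeasurable_funM.
  by apply/measurable_EFinP; apply: measurableT_comp => //; exact: measurable_expw.
apply: emeasurable_funM.
  by apply/measurable_EFinP; apply: measurableT_comp => //; exact: measurable_expw.
by apply: mphiD; exact: measurable_funD.
Qed.

Lemma res_commute l b y : res l (res b g) y = res b (res l g) y.
Proof.
rewrite !res_res.
apply: (eq_trans (@fubini_tonelli _ _ _ _ _ leb leb (fun p : R * R =>
  ((expw l p.1)%:E * ((expw b p.2)%:E * phi y (p.1 + p.2)%R))%E) (mres2 l b y) _)).
  by move=> p; rewrite !mule_ge0// lee_fin expw_ge0.
by apply: eq_integral => t _; apply: eq_integral => s _ /=; rewrite muleCA addrC.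
Qed.

Lemma integral_expw_le (l s : R) : 0 < l -> 0 <= s ->
  (l%:E * \int[leb]_t ((expw l t)%:E * ((t <= s)%R%:R)%:E) =
   (1 - expR (- (l * s)))%:E)%E.
Proof.
move=> l0 s0; rewrite EFinB.
rewrite -[RHS](@integral_expw_lt _ l s%:E)// ?lee_fin//; congr (_ * _)%E.
apply: ae_eq_integral => //.
- apply: emeasurable_funM; first by apply/measurable_EFinP; exact: measurable_expw.
  apply/measurable_EFinP; apply: measurable_indic_bool.
  rewrite (_ : [set _ | _] = `]-oo, s]%classic); first exact: measurable_itv.
  by apply/seteqP; split => x /=; rewrite in_itv.
- apply: emeasurable_funM; first by apply/measurable_EFinP; exact: measurable_expw.
  apply/measurable_EFinP; apply: measurable_indic_bool.
  rewrite (_ : [set _ | _] = `]-oo, s[%classic); first exact: measurable_itv.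
  by apply/seteqP; split => x /=; rewrite in_itv/= lte_fin.
- exists [set s]; split; [exact: measurable_set1|exact: lebesgue_measure_set1|].
  move=> t /= ht; apply: contrapT => ts; apply: ht => _.
  by rewrite lte_fin lt_neqAle; move/eqP: ts => ->.
Qed.

(** With [u = s + t], the iterated resolvent integrates [phi y u] against the integral over [s] in
    [[0, u]] of [exp(-(b + k) s) exp(-b (u - s))], which equals [exp(-b u) (1 - exp(-k u)) / k].
    Keeping all terms positive avoids differences of possibly infinite potentials. *)
Lemma resolvent_identity b k y : 0 < k ->
  res b g y = (res (b + k) g y + k%:E * res (b + k) (res b g) y)%E.
Proof.
move=> k0; rewrite res_res.
have me : measurable_fun setT (fun p : R * R =>
    ((expw (b + k) p.1)%:E * ((expw b (p.2 - p.1))%:E * phi y p.2))%E).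
  apply: emeasurable_funM.
    by apply/measurable_EFinP; apply: measurableT_comp => //; exact: measurable_expw.
  apply: emeasurable_funM; last exact: mphiD.
  apply/measurable_EFinP; apply: (measurableT_comp (measurable_expw b)).
  exact: measurable_funB.
have e0 p : (0 <= (expw (b + k) p.1)%:E * ((expw b (p.2 - p.1))%:E * phi y p.2))%E.
  by rewrite !mule_ge0// lee_fin expw_ge0.
have -> : (\int[leb]_s \int[leb]_t ((expw (b + k) s)%:E * ((expw b t)%:E * phi y (s + t))) =
   \int[leb]_s \int[leb]_u ((expw (b + k) s)%:E * ((expw b (u - s))%:E * phi y u)))%E.
  apply: eq_integral => s _.
  rewrite -[RHS](integral_translation s); last 2 first.
  - have m2 : measurable_fun setT (fun u : R => (s, u)).
      by apply: measurable_fun_pair; [exact: measurable_cst|exact: measurable_id].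
    exact: (measurableT_comp me m2).
  - by move=> u; exact: (e0 (s, u)).
  by apply: eq_integral => t _; rewrite (addrC s t) addrK.
rewrite (@fubini_tonelli _ _ _ _ _ leb leb _ me e0)/=.
rewrite /green -ge0_integralZl//; last 3 first.
- exact: (@measurable_fun_fubini_tonelli_G _ _ _ _ _ leb _ me e0).
- by move=> u _; apply: integral_ge0 => s _; exact: (e0 (s, u)).
- by rewrite lee_fin ltW.
rewrite -ge0_integralD//; last 4 first.
- by move=> u _; rewrite mule_ge0 ?lee_fin ?expw_ge0 ?phi0.
- apply: emeasurable_funM; last exact: mphi.
  by apply/measurable_EFinP; exact: measurable_expw.
- move=> u _; apply: mule_ge0; first by rewrite lee_fin ltW.
  by apply: integral_ge0 => s _; exact: (e0 (s, u)).
- apply: emeasurable_funM; first exact: measurable_cst.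
  exact: (@measurable_fun_fubini_tonelli_G _ _ _ _ _ leb _ me e0).
apply: eq_integral => u _; rewrite -/(phi y u).
have [u0|u0] := leP 0 u; last first.
  rewrite !expw_neg// !mul0e add0e; rewrite integral0_eq ?mule0// => s _.
  have [s0|s0] := leP 0 s; last by rewrite expw_neg// mul0e.
  by rewrite [expw b _]expw_neg ?mul0e ?mule0// subr_lt0 (lt_le_trans u0).
have -> : (\int[leb]_s ((expw (b + k) s)%:E * ((expw b (u - s))%:E * phi y u)) =
   \int[leb]_s ((expw k s)%:E * ((s <= u)%R%:R)%:E) * ((expw b u)%:E * phi y u))%E.
  rewrite -ge0_integralZr//; last 3 first.
  - apply: emeasurable_funM; first by apply/measurable_EFinP; exact: measurable_expw.
    apply/measurable_EFinP; apply: measurable_indic_bool.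
    rewrite (_ : [set _ | _] = `]-oo, u]%classic); first exact: measurable_itv.
    by apply/seteqP; split => x /=; rewrite in_itv.
  - by move=> s _; rewrite mule_ge0// lee_fin expw_ge0.
  - by rewrite mule_ge0// lee_fin expw_ge0.
  apply: eq_integral => s _; rewrite !muleA -!EFinM; congr (_%:E * _)%E.
  have [s0|s0] := leP 0 s; last by rewrite !(expw_neg _ s0) !mul0r.
  have [su|su] := leP s u; last first.
    by rewrite mulr0 mul0r [expw b (u - s)]expw_neg ?mulr0 ?subr_lt0.
  rewrite mulr1 !expw_pos// ?subr_ge0// -!expRD; congr expR; ring.
rewrite muleA integral_expw_le// !muleA -EFinM -ge0_muleDl ?lee_fin ?expw_ge0//; last first.
  rewrite mulr_ge0 ?expw_ge0// subr_ge0 -expR0 ler_expR oppr_le0 mulr_ge0//.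
  exact: ltW.
congr (_ * _)%E; rewrite -EFinD; congr EFin.
rewrite !expw_pos// mulrBl mul1r -expRD.
rewrite (_ : - (k * u) + - (b * u) = - ((b + k) * u)); last by ring.
by rewrite addrC subrK.
Qed.

End ge0.
End resolvent_identity.

(** * Exit times *)

(* Exit times and expectations of their functionals need not be Borel measurable,
   so these comparisons of integrals assume no measurability. *)
Section integral_nonmeasurable.
Import HBNNSimple.

(** A simple function below [f], multiplied by the indicator of the complement of [N], lies below
    [g] and keeps its integral; the integral is the supremum over such simple functions. *)
Lemma ge0_le_integral_off_null {R : realType} d (T : measurableType d)
    (m : {measure set T -> \bar R}) (N : set T) (f g : T -> \bar R) :
  measurable N -> m N = 0%E -> (forall x, 0 <= f x)%E -> (forall x, 0 <= g x)%E ->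
  (forall x, ~ N x -> (f x <= g x)%E) ->
  (\int[m]_x f x <= \int[m]_x g x)%E.
Proof.
move=> mN N0 f0 g0 fg; rewrite !ge0_integralTE//.
apply: ge_ereal_sup => _ [h hf <-]; apply: ereal_sup_ubound.
pose h' := mul_nnsfun h (indic_nnsfun R (measurableC mN)).
have h'E x : h' x = h x * \1_(~` N) x by [].
exists h' => [x|].
  rewrite h'E indicE; have [Nx|Nx] := pselect (N x).
    by rewrite memNset ?mulr0//; apply; exact: Nx.
  by rewrite mem_set// mulr1 (le_trans (hf x))// fg.
rewrite -!integralT_nnsfun; apply: ae_eq_integral => //.
- exact/measurable_EFinP.
- exact/measurable_EFinP.
- exists N; split => // x /= hx; apply: contrapT => Nx; apply: hx => _.
  rewrite (_ : mindic _ _ x = \1_(~` N) x)//.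
  by rewrite indicE mem_set// mulr1.
Qed.

Lemma ge0_integral_ae_eq {R : realType} d (T : measurableType d)
    (m : {measure set T -> \bar R}) (f g : T -> \bar R) :
  (forall x, 0 <= f x)%E -> (forall x, 0 <= g x)%E ->
  {ae m, forall x, f x = g x} -> (\int[m]_x f x = \int[m]_x g x)%E.
Proof.
move=> f0 g0 [N [mN N0 fgN]].
have fg x : ~ N x -> f x = g x by move=> Nx; apply: contrapT => h; exact/Nx/fgN.
by apply/le_anti/andP; split; apply: (ge0_le_integral_off_null mN N0) => // x /fg ->.
Qed.

End integral_nonmeasurable.

Section hitting_times.
Context {R : realType} {E : pointedMetricType R}.
Hypothesis hlc : locally_compact [set: E].
Hypothesis hsep : separable_space E.
Notation ED := (cemetery_ext E).
Context {d : measure_display} {W : measurableType d}.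
Variables (X : R -> W -> ED) (P : ED -> probability W R).
Hypothesis hX : hunt_process X P.

Definition hit (U : set ED) (w : W) : \bar R :=
  ereal_inf [set t%:E%E | t in [set t : R | 0 <= t /\ U (X t w)]].

Lemma hit_ge0 U w : (0 <= hit U w)%E.
Proof. by apply: le_ereal_inf_tmp => _ [t [t0 _] <-]; rewrite lee_fin. Qed.

Lemma hit_le U w t : 0 <= t -> U (X t w) -> (hit U w <= t%:E)%E.
Proof. by move=> t0 Ut; apply: ereal_inf_lbound; exists t. Qed.

Lemma before_hit U w t : 0 <= t -> (t%:E < hit U w)%E -> ~ U (X t w).
Proof. by move=> t0 + Ut; rewrite ltNge hit_le. Qed.

Lemma hit_lt U w r : (hit U w < r%:E)%E ->
  exists t, [/\ 0 <= t, t < r & U (X t w)].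
Proof.
by move=> /ereal_inf_lt[_ [t [t0 Ut] <-]]; rewrite lte_fin => tr; exists t.
Qed.

Lemma hit_lt_grid U w r : open U -> (hit U w < r%:E)%E ->
  exists im : nat * nat, im.1%:R / im.2.+1%:R < r /\ U (X (im.1%:R / im.2.+1%:R) w).
Proof.
move=> oU /hit_lt[t [t0 tr Ut]].
have : X (right_grid m t) w @[m --> \oo] --> X t w.
  exact: (cvg_comp (right_grid ^~ t) (X ^~ w) (cvg_right_grid t0)
    (hunt_right_continuous hX t0)).
move=> /(_ U (open_nbhs_nbhs (conj oU Ut)))[N1 _ N1P].
have [N2 _ N2P] := cvg_right_grid t0 (nbhs_right_lt tr).
pose m := maxn N1 N2.
exists ((Num.truncn (Num.max t 0 * m.+1%:R)).+1, m); split => /=.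
  exact: (N2P m (leq_maxr _ _)).
exact: (N1P m (leq_maxl _ _)).
Qed.

(** By right continuity a visit to an open set before [r] can be moved to a rational time before
    [r]. So [hit U w <= t] amounts to visits at rational times before [t + 1/(n+1)] for every [n].
    Capping these times at [s] puts the event in the history of every [s > t], that is, in the
    right-continuous filtration. *)
Lemma hit_stopping_time U : open U -> stopping_time X (hit U).
Proof.
move=> oU; split; first by move=> w; exact: hit_ge0.
move=> t t0 s ts.
pose A n := \bigcup_(im in [set im : nat * nat |
    im.1%:R / im.2.+1%:R < Num.min s (t + n.+1%:R^-1)])
  [set w | U (X (im.1%:R / im.2.+1%:R) w)].
have -> : [set w | (hit U w <= t%:E)%E] = \bigcap_n A n.
  apply/seteqP; split => [w hw n _|w hw].
    have [|im [imr Uim]] := @hit_lt_grid U w (Num.min s (t + n.+1%:R^-1)) oU.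
      by rewrite (le_lt_trans hw)// lte_fin lt_min ts/= ltrDl invr_gt0 ltr0n.
    by exists im.
  apply/lee_addgt0Pr => e e0.
  have [n _ ne] : \forall n \near \oo, n.+1%:R^-1 < e.
    exact: (near_infty_natSinv_lt (PosNum e0)).
  have [im /= + Uim] := hw n I; rewrite lt_min => /andP[_ imt].
  apply: (@le_trans _ _ (im.1%:R / im.2.+1%:R)%:E).
    by apply: hit_le => //; rewrite divr_ge0.
  rewrite -EFinD lee_fin (le_trans (ltW imt))// lerD2l ltW//.
  exact: (ne n (leqnn n)).
rewrite -[\bigcap_n _]setCK setC_bigcap -setTD.
apply: sigma_algebraCD; apply: sigma_algebra_bigcup => n.
rewrite -setTD; apply: sigma_algebraCD.
rewrite /A bigcup_mkcond.
rewrite (_ : \bigcup_i _ = \bigcup_j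
  (if unpickle j is Some im then if im \in [set im : nat * nat |
    im.1%:R / im.2.+1%:R < Num.min s (t + n.+1%:R^-1)] then
    [set w | U (X (im.1%:R / im.2.+1%:R) w)] else set0 else set0)); last first.
  apply/seteqP; split => w [i _ iw]; first by exists (pickle i) => //; rewrite pickleK.
  by move: iw; case: (unpickle i) => // im iw; exists im.
apply: sigma_algebra_bigcup => j; case: unpickle => [im|]; last exact: sigma_algebra0.
case: ifPn => [|_]; last exact: sigma_algebra0.
rewrite inE/= lt_min => /andP[ims _]; apply: sub_sigma_algebra.
exists (im.1%:R / im.2.+1%:R); split.
  by rewrite /= in_itv/= divr_ge0//= ltW.
by exists U; split => //; exact: sub_sigma_algebra.
Qed.

(** Were the position outside [C], right continuity would keep the path outside for a while,
    although [U] is visited arbitrarily soon after its hitting time. The position may lie on the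
    boundary of [U], hence the closed set [C]. *)
Lemma at_hit_closed U C w : closed C -> U `<=` C -> (hit U w < +oo)%E ->
  C (at_time X (hit U w) w).
Proof.
move=> cC UC; have := hit_ge0 U w; have := @hit_lt U w; have := @hit_le U w.
case: (hit U w) => [s| |]//; rewrite lee_fin => hle hl s0 _ /=.
apply: contrapT => nC.
have : nbhs (X s w) (~` C) by apply: open_nbhs_nbhs; split => //; exact: closed_openC.
move=> /(hunt_right_continuous hX s0)[e /= e0 eC].
have [t [t0 ts Ut]] := hl (s + e) (ltac:(by rewrite lte_fin ltrDl)).
have st : s <= t by rewrite -lee_fin; exact: hle.
move: st; rewrite le_eqVlt => /orP[/eqP st|st]; first by apply: nC; rewrite st; exact: UC.
apply: (eC t) => //; last exact: UC.
by rewrite /= distrC ger0_norm ?subr_ge0 1?ltW// ltrBlDl.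
Qed.

Lemma hit_subset (U V : set ED) w : U `<=` V -> (hit V w <= hit U w)%E.
Proof.
move=> UV; apply: ereal_inf_le_tmp => _ [t [t0 Ut] <-]; exists t => //; split => //.
exact: UV.
Qed.

End hitting_times.

Section exhausting_exit_times.
Context {R : realType} {E : pointedMetricType R}.
Hypothesis hlc : locally_compact [set: E].
Hypothesis hsep : separable_space E.
Notation ED := (cemetery_ext E).
Context {d : measure_display} {W : measurableType d}.
Variables (X : R -> W -> ED) (P : ED -> probability W R).
Hypothesis hX : hunt_process X P.
Notation leb := (@lebesgue_measure R).
Variables (Om : set E) (V : (set E)^nat).
Hypotheses (oV : forall n, open (V n)) (cV : forall n, compact (closure (V n)))
  (clV : forall n, closure (V n) `<=` V n.+1) (VOm : \bigcup_n V n = Om).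

(** The complement is taken in the compactification, so that death counts as leaving. *)
Definition outside (n : nat) : set ED := ~` (Some @` closure (V n)).

Lemma open_outside n : open (outside n).
Proof. exact: open_setC_image_compact. Qed.

Lemma outside_anti n m : (n <= m)%N -> outside m `<=` outside n.
Proof.
elim: m => [|m ih]; first by rewrite leqn0 => /eqP ->.
rewrite leq_eqVlt => /orP[/eqP -> //|]; rewrite ltnS => /ih; apply: subset_trans.
move=> y hy [x Vx xy]; apply: hy; exists x => //.
by apply: subset_closure; exact: clV.
Qed.

Lemma closed_setC_image_open (G : set E) : open G -> closed (~` (Some @` G) : set ED).
Proof.
by move=> oG; apply: open_closedC; exact: one_point_compactification_open_some.
Qed.

Let T n := hit X (outside n).

Lemma outside_stopping_time n : stopping_time X (T n).
Proof. exact: (hit_stopping_time hX (@open_outside n)). Qed.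

Lemma outside_hit_nd n m w : (n <= m)%N -> (T n w <= T m w)%E.
Proof. by move=> nm; apply: hit_subset; exact: outside_anti. Qed.

Lemma at_outside_hit n w : (T n w < +oo)%E ->
  (~` (Some @` V n) : set ED) (at_time X (T n w) w).
Proof.
apply: (at_hit_closed hX (closed_setC_image_open (oV n))).
by move=> y hy [x Vx xy]; apply: hy; exists x => //; exact: subset_closure.
Qed.

(** The gap between consecutive closures serves here: the position is off [V n.+1], which contains
    [closure (V n)], and so lies in an open set again. *)
Lemma at_outside_hitS n w : (T n.+1 w < +oo)%E ->
  outside n (at_time X (T n.+1 w) w).
Proof. by move=> /at_outside_hit hn [x Vx xy]; apply: hn; exists x => //; exact: clV. Qed.

Lemma outside_hit_le_exit n w : (T n w <= exit_time X Om w)%E.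
Proof.
apply: le_ereal_inf_tmp => _ [t [t0 nOm] <-]; apply: hit_le => // -[x Vx xy].
by apply: nOm; exists x => //; rewrite -VOm; exists n.+1 => //; exact: clV.
Qed.

(** A measurable stand-in for the exit time, to which it is almost surely equal. *)
Definition sup_hit w : \bar R := ereal_sup (range (fun n => T n w)).

Lemma sup_hit_le_exit w : (sup_hit w <= exit_time X Om w)%E.
Proof. by apply: ge_ereal_sup => _ [n _ <-]; exact: outside_hit_le_exit. Qed.

Lemma hit_le_sup n w : (T n w <= sup_hit w)%E.
Proof. by apply: ereal_sup_ubound; exists n. Qed.

Lemma sup_hit_ge0 w : (0 <= sup_hit w)%E.
Proof. exact: le_trans (hit_ge0 _ _ _) (hit_le_sup 0 w). Qed.

Lemma exit_time_ge0 w : (0 <= exit_time X Om w)%E.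
Proof. exact: le_trans (sup_hit_ge0 w) (sup_hit_le_exit w). Qed.

Lemma measurable_sup_hit : measurable_fun setT sup_hit.
Proof.
apply: (@emeasurable_fun_cvg _ _ _ _ (fun n w => T n w)) => [n|w _].
  exact: (measurable_stopping_time hX (outside_stopping_time n)).
by apply: ereal_nondecreasing_cvgn => n m; exact: outside_hit_nd.
Qed.

Lemma nested_nondecreasing n m : (n <= m)%N -> V n `<=` V m.
Proof.
elim: m => [|m ih]; first by rewrite leqn0 => /eqP ->.
rewrite leq_eqVlt => /orP[/eqP -> //|]; rewrite ltnS => /ih VV.
by move=> x /VV Vx; apply: clV; exact: subset_closure.
Qed.

(* By quasi-left continuity X converges to its value at the supremum of the
   hitting times, which lies in no closure (V n). *)
Lemma sup_hit_ae y : {ae P y, forall w, sup_hit w = exit_time X Om w}.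
Proof.
have := hunt_quasi_left_continuous hX y outside_stopping_time
  (fun n w => outside_hit_nd w (leqnSn n)).
apply: filterS => w /= hw; apply/le_anti; rewrite sup_hit_le_exit/=.
have [sy|] := leP +oo%E (sup_hit w); first by rewrite (le_trans (leey _)).
move=> /[dup] sy /hw {}hw.
have := sup_hit_ge0 w; move: hw sy.
rewrite -/(sup_hit w); case E0 : (sup_hit w) => [s| |]// hw _; rewrite lee_fin => s0.
apply: ereal_inf_lbound; exists s => //; split => //.
move=> [x Omx xs]; move: Omx; rewrite -VOm => -[n _ Vnx].
have : nbhs (X s w) (Some @` V n : set ED).
  rewrite xs; apply: open_nbhs_nbhs; split; last by exists x.
  exact: one_point_compactification_open_some.
move=> /hw[N _ NP].
have := NP (maxn n N) (leq_maxr _ _); rewrite /= => -[z Vz zT].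
have Tm : (T (maxn n N) w < +oo)%E.
  by rewrite (le_lt_trans (hit_le_sup _ _))// E0 ltry.
have := at_outside_hit Tm; rewrite -zT; apply; exists z => //.
by apply: nested_nondecreasing Vz; exact: leq_maxl.
Qed.

Section exit_formula.
Variable f_ : nat -> borel ED -> \bar R.
Hypotheses (mf_ : forall n, measurable_fun setT (f_ n))
  (f0 : forall n y, (0 <= f_ n y)%E)
  (ndf : forall y, {homo f_ ^~ y : n m / (n <= m)%N >-> (n <= m)%E})
  (cf : forall x : E, f_ n (Some x) @[n --> \oo] --> 1%E).

(** Killing times and sources increase together, so monotone convergence applies in time and then in
    expectation. Sources that are square integrable at each stage thereby yield the potential of
    1. *)
Lemma integral_sup_hit b y : 0 < b ->
  (\int[P y]_w \int[leb]_t ((expw b t)%:E * ((t%:E < sup_hit w)%E%:R)%:E) =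
   limn (fun n => killed_green X P (T n) b (f_ n) y))%E.
Proof.
move=> b0; apply/esym/cvg_lim => //; apply: ge0_nondecreasing_cvg_integral => //.
- by move=> n; exact: (measurable_killed_path hlc hsep hX (mf_ n) (f0 n) (outside_stopping_time n)).
- by move=> n w _; apply: integral_ge0 => t _; rewrite !mule_ge0// lee_fin expw_ge0.
- have ms n : measurable_fun setT (fun p : R * W => (expw b p.1)%:E *
      (((p.1%:E < T n p.2)%E%:R)%:E * f_ n (Xpos X p.1 p.2)))%E.
    exact: (measurable_killed_integrand hlc hsep hX (mf_ n) (outside_stopping_time n)).
  move=> w _ n m nm; apply: ge0_le_integral => //.
  + by move=> t _; rewrite !mule_ge0// lee_fin expw_ge0.
  + have m2 : measurable_fun setT (fun t : R => (t, w)).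
      by apply: measurable_fun_pair; [exact: measurable_id|exact: measurable_cst].
    exact: (measurableT_comp (ms n) m2).
  + have m2 : measurable_fun setT (fun t : R => (t, w)).
      by apply: measurable_fun_pair; [exact: measurable_id|exact: measurable_cst].
    exact: (measurableT_comp (ms m) m2).
  + move=> t _; rewrite lee_wpmul2l// ?lee_fin ?expw_ge0//.
    apply: lee_pmul => //; last exact: ndf.
    rewrite lee_fin ler_nat; have [tn|] := boolP (t%:E < T n w)%E => //.
    by rewrite (lt_le_trans tn)//; exact: outside_hit_nd.
- move=> w _; apply: ge0_nondecreasing_cvg_integral => //.
  + move=> n.
    have m2 : measurable_fun setT (fun t : R => (t, w)).
      by apply: measurable_fun_pair; [exact: measurable_id|exact: measurable_cst].
    exact: (measurableT_comp (measurable_killed_integrand hlc hsep hX (mf_ n)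
      (outside_stopping_time n) b) m2).
  + by move=> n t _; rewrite !mule_ge0// lee_fin expw_ge0.
  + move=> t _ n m nm; rewrite lee_wpmul2l// ?lee_fin ?expw_ge0//.
    apply: lee_pmul => //; last exact: ndf.
    rewrite lee_fin ler_nat; have [tn|] := boolP (t%:E < T n w)%E => //.
    by rewrite (lt_le_trans tn)//; exact: outside_hit_nd.
  + move=> t _; have [t0|t0] := leP 0 t; last first.
      by rewrite expw_neg// mul0e; apply: cvg_near_cst; apply: nearW => n; rewrite mul0e.
    apply: cvgeZl => //.
    have [/ereal_sup_gt[_ [n _ <-] tn]|ts] := ltP t%:E (sup_hit w); last first.
      apply: cvg_near_cst; apply: nearW => n.
      by rewrite ltNge (le_trans (hit_le_sup n w) ts) mul0e.
    (* Before [T n] the path is in [closure (V n)], hence in [E], where the sources are known to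
       tend to 1. *)
    have [x Vx xt] : (Some @` closure (V n)) (X t w).
      by apply: contrapT; exact: before_hit tn.
    rewrite XposE// -xt.
    apply: cvg_trans (cf x); apply: near_eq_cvg.
    exists n => // m /= nm; rewrite (lt_le_trans tn) ?mul1e//.
    exact: outside_hit_nd.
Qed.

Lemma expect_exp_exit_time b x : 0 < b ->
  (expect P x (fun w => 1 - expeR (- (b%:E * exit_time X Om w))) =
   b%:E * limn (fun n => killed_green X P (T n) b (f_ n) (Some x)))%E.
Proof.
move=> b0; rewrite -integral_sup_hit// /expect.
have le1 (s : \bar R) : (0 <= s)%E -> (0 <= 1 - expeR (- (b%:E * s)))%E.
  move=> s0; rewrite sube_ge0 ?orbT// -expeR0 lee_expeR oppe_le0.
  by rewrite mule_ge0// lee_fin ltW.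
rewrite (@ge0_integral_ae_eq _ _ _ _ _ (fun w => 1 - expeR (- (b%:E * sup_hit w)))%E).
- rewrite -ge0_integralZl//.
  + by apply: eq_integral => w _; rewrite integral_expw_lt// sup_hit_ge0.
  + apply: (@measurable_fun_fubini_tonelli_G _ _ _ _ _ leb (fun p : R * W =>
      ((expw b p.1)%:E * (((p.1%:E < sup_hit p.2)%E%:R)%:E))%E)).
    * apply: emeasurable_funM.
        by apply/measurable_EFinP; apply: measurableT_comp => //; exact: measurable_expw.
      have ms2 : measurable_fun setT (fun p : R * W => sup_hit p.2).
        by apply: measurableT_comp => //; exact: measurable_sup_hit.
      apply/measurable_EFinP.
      have -> : (fun p : R * W => ((p.1%:E < sup_hit p.2)%E%:R : R)) =
          (fun p => 1 - (sup_hit p.2 <= p.1%:E)%E%:R).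
        by apply/funext => p; rewrite ltNge; case: (sup_hit p.2 <= p.1%:E)%E;
          rewrite /= ?subrr ?subr0.
      apply: measurable_funB => //; apply: measurable_indic_bool.
      rewrite -[X in measurable X]setTI; apply: measurable_lee => //.
      exact/measurable_EFinP.
    * by move=> p; rewrite !mule_ge0// lee_fin expw_ge0.
  + by move=> w _; apply: integral_ge0 => t _; rewrite !mule_ge0// lee_fin expw_ge0.
  + by rewrite lee_fin ltW.
- by move=> w; apply: le1; exact: exit_time_ge0.
- by move=> w; apply: le1; exact: sup_hit_ge0.
- by apply: filterS (sup_hit_ae (Some x)) => w ->.
Qed.

End exit_formula.
End exhausting_exit_times.

(** * Nonnegative symmetric forms *)

Section nonnegative_bilinear_form.
Context {R : realType} {T : Type}.
Variables (S : set (T -> R)) (B : (T -> R) -> (T -> R) -> R).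

(** One interface for three forms: the scalar product, the form of index beta and the penalty term.
    The last one is degenerate, so definiteness is not part of it. *)
Record nonneg_form : Prop := {
  nf_lin : forall (a : R) f g, S f -> S g -> S (fun x => a * f x + g x);
  nf_zero : S (fun=> 0);
  nf_linl : forall (a : R) f g h, S f -> S g -> S h ->
    B (fun x => a * f x + g x) h = a * B f h + B g h;
  nf_sym : forall f g, S f -> S g -> B f g = B g f;
  nf_ge0 : forall f, S f -> 0 <= B f f }.

Hypothesis nf : nonneg_form.

Lemma nf_scale a f : S f -> S (fun x => a * f x).
Proof.
move=> Sf; have := nf_lin nf a Sf (nf_zero nf).
by congr S; apply/funext => x; rewrite addr0.
Qed.

Lemma nf_comb a b f g : S f -> S g -> S (fun x => a * f x + b * g x).
Proof. by move=> Sf Sg; apply: (nf_lin nf) => //; exact: nf_scale. Qed.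

Lemma nf_sub f g : S f -> S g -> S (fun x => f x - g x).
Proof.
move=> Sf Sg; have := nf_comb 1 (-1) Sf Sg.
by congr S; apply/funext => x; rewrite mul1r mulN1r.
Qed.

Lemma nf_form0l h : S h -> B (fun=> 0) h = 0.
Proof.
move=> Sh; have := nf_linl nf 1 (nf_zero nf) (nf_zero nf) Sh.
rewrite (_ : (fun x => 1 * 0 + 0) = (fun=> 0)); last by apply/funext => x; rewrite mulr0 addr0.
by rewrite mul1r => /eqP; rewrite -subr_eq0 opprD addrA subrr sub0r oppr_eq0 => /eqP.
Qed.

Lemma nf_scalel a f h : S f -> S h -> B (fun x => a * f x) h = a * B f h.
Proof.
move=> Sf Sh; have := nf_linl nf a Sf (nf_zero nf) Sh.
rewrite nf_form0l// addr0 => <-; congr B.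
by apply/funext => x; rewrite addr0.
Qed.

Lemma nf_combl a b f g h : S f -> S g -> S h ->
  B (fun x => a * f x + b * g x) h = a * B f h + b * B g h.
Proof.
move=> Sf Sg Sh; rewrite (nf_linl nf)//; last exact: nf_scale.
by rewrite nf_scalel.
Qed.

Lemma nf_subl f g h : S f -> S g -> S h ->
  B (fun x => f x - g x) h = B f h - B g h.
Proof.
move=> Sf Sg Sh; have := nf_combl 1 (-1) Sf Sg Sh.
rewrite mul1r mulN1r => <-; congr B.
by apply/funext => x; rewrite mul1r mulN1r.
Qed.

Lemma nf_comb2 a b f g : S f -> S g ->
  B (fun x => a * f x + b * g x) (fun x => a * f x + b * g x) =
  a ^+ 2 * B f f + 2 * a * b * B f g + b ^+ 2 * B g g.
Proof.
move=> Sf Sg; have Sc := nf_comb a b Sf Sg.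
rewrite nf_combl// (nf_sym nf Sf Sc) (nf_sym nf Sg Sc) !nf_combl// (nf_sym nf Sg Sf).
ring.
Qed.

Lemma nf_sub2 f g : S f -> S g ->
  B (fun x => f x - g x) (fun x => f x - g x) = B f f - 2 * B f g + B g g.
Proof.
move=> Sf Sg; have := nf_comb2 1 (-1) Sf Sg.
rewrite (_ : (fun x => 1 * f x + -1 * g x) = (fun x => f x - g x)).
  by move=> ->; ring.
by apply/funext => x; rewrite mul1r mulN1r.
Qed.

Lemma nf_le_mean f g : S f -> S g -> 2 * B f g <= B f f + B g g.
Proof.
move=> Sf Sg; have := nf_ge0 nf (nf_sub Sf Sg).
by rewrite nf_sub2//; lra.
Qed.

(** Expand the energies of [c f + g] and [c f - g] and divide by [c]. *)
Lemma nf_weighted_mean c f g : 0 < c -> S f -> S g ->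
  2 * `|B f g| <= c * B f f + c^-1 * B g g.
Proof.
move=> c0 Sf Sg.
have h b : b ^+ 2 = 1 -> 0 <= c * B f f + 2 * b * B f g + c^-1 * B g g.
  move=> b1; have := nf_ge0 nf (nf_comb c b Sf Sg); rewrite nf_comb2// b1.
  move=> h; have : 0 <= c^-1 * (c ^+ 2 * B f f + 2 * c * b * B f g + 1 * B g g).
    by rewrite mulr_ge0// invr_ge0 ltW.
  by congr (0 <= _); field; rewrite gt_eqF.
have h1 := h 1 (expr1n _ _); have h2 := h (-1) (ltac:(by rewrite sqrrN expr1n)).
by case: (lerP 0 (B f g)) => h0; [rewrite (ger0_norm h0)|rewrite (ltr0_norm h0)]; lra.
Qed.

(** The energy of [B g g * f - B f g * g] gives the inequality multiplied by [B g g]. If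
    [B g g = 0], which does not force [g] to vanish, the weighted mean with arbitrarily small weight
    gives [B f g = 0]. *)
Lemma nf_cauchy_schwarz f g : S f -> S g -> (B f g) ^+ 2 <= B f f * B g g.
Proof.
move=> Sf Sg; have g0 := nf_ge0 nf Sg; have f0 := nf_ge0 nf Sf.
have := nf_ge0 nf (nf_comb (B g g) (- B f g) Sf Sg).
rewrite nf_comb2// => h.
have {}h : 0 <= B g g * (B f f * B g g - (B f g) ^+ 2).
  by move: h; congr (0 <= _); ring.
move: g0; rewrite le_eqVlt => /orP[/eqP g0|g0]; last first.
  by rewrite -subr_ge0 -(pmulr_rge0 _ g0).
have fg0 : B f g = 0.
  apply/eqP; rewrite -normr_eq0 eq_le normr_ge0 andbT.
  apply/ler_addgt0Pl => e e0; rewrite addr0.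
  have c0 : 0 < e / (B f f + 1) by rewrite divr_gt0// ltr_wpDl.
  have := nf_weighted_mean c0 Sf Sg; rewrite -g0 mulr0 addr0 => hh.
  have : e / (B f f + 1) * B f f <= e.
    by rewrite mulrAC ler_pdivrMr ?ltr_wpDl// ler_wpM2l ?(ltW e0)// lerDl.
  by have := normr_ge0 (B f g); lra.
by rewrite fg0 -g0 mulr0 expr0n.
Qed.

Lemma nf_sub_le f g : S f -> S g ->
  B (fun x => f x - g x) (fun x => f x - g x) <= 2 * B f f + 2 * B g g.
Proof.
move=> Sf Sg; rewrite nf_sub2//.
have := nf_weighted_mean (@ltr01 R) Sf Sg; rewrite invr1 !mul1r.
by have := ler_norm (- B f g); rewrite normrN; lra.
Qed.

Lemma nf_parallelogram f g : S f -> S g ->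
  B (fun x => f x - g x) (fun x => f x - g x) =
  2 * B f f + 2 * B g g -
  4 * B (fun x => 2^-1 * f x + 2^-1 * g x) (fun x => 2^-1 * f x + 2^-1 * g x).
Proof. by move=> Sf Sg; rewrite nf_sub2// nf_comb2//; field. Qed.

Lemma nf_limit_le f b : S f -> (forall e, 0 < e -> exists v, [/\ S v, B v v <= b &
    B (fun x => v x - f x) (fun x => v x - f x) < e]) -> B f f <= b.
Proof.
move=> Sf h.
have b0 : 0 <= b.
  by have [v [Sv vb _]] := h 1 ltr01; exact: le_trans (nf_ge0 nf Sv) vb.
apply/ler_addgt0Pr => e e0.
(* Writing [f = v - (v - f)] and using weight [c], the energy of [f] is at most
   [(1 + c) b + (1 + c^-1) w], where [w] is the energy of [v - f]. The closeness asked of [v] makes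
   the last term at most [c], and the total error is [c (b + 1) = e]. *)
pose c := e / (b + 1).
have c0 : 0 < c by rewrite divr_gt0// ltr_wpDl.
have c1 : 0 < 1 + c^-1 by rewrite addr_gt0// invr_gt0.
have [v [Sv vb vf]] := h (c / (1 + c^-1)) (divr_gt0 c0 c1).
have Svf := nf_sub Sv Sf.
have := nf_sub2 Sv Svf.
rewrite (_ : (fun x => v x - (v x - f x)) = f); last by apply/funext => x; ring.
move=> ->; have := nf_weighted_mean c0 Sv Svf.
have := ler_norm (- B v (fun x => v x - f x)); rewrite normrN.
set w := B (fun x => v x - f x) _ in vf *.
move=> h1 h2.
have h3 : (1 + c^-1) * w <= c by rewrite mulrC -ler_pdivlMr// ltW.
have h4 : c * B v v <= c * b by rewrite ler_wpM2l// ltW.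
have h5 : c * (b + 1) = e by rewrite /c divfK// gt_eqF// ltr_wpDl.
lra.
Qed.

End nonnegative_bilinear_form.

Section almost_everywhere.
Context {R : realType} d (T : measurableType d) (m : {measure set T -> \bar R}).

Lemma ae_mono (A B : T -> Prop) : (forall x, A x -> B x) ->
  {ae m, forall x, A x} -> {ae m, forall x, B x}.
Proof. exact: (@filterS _ _ (ae_filter_ringOfSetsType m)). Qed.

Lemma ae_mono2 (A B C : T -> Prop) : (forall x, A x -> B x -> C x) ->
  {ae m, forall x, A x} -> {ae m, forall x, B x} -> {ae m, forall x, C x}.
Proof. exact: (@filterS2 _ _ (ae_filter_ringOfSetsType m)). Qed.

End almost_everywhere.

(** * The space L^2 and its scalar product *)

Section square_integrable.
Context {R : realType} {E : pointedMetricType R}.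
Variable mu : {measure set (borel E) -> \bar R}.
Implicit Types f g h : E -> R.

Definition sqint f : Prop := (f : borel E -> R) \in Lfun mu 2%:E.

Lemma sqint_measurable f : sqint f -> measurable_fun setT (f : borel E -> R).
Proof. by rewrite /sqint inE => /andP[/set_mem]. Qed.

Lemma sqint_integrable f g : sqint f -> sqint g ->
  mu.-integrable setT (EFin \o (fun x => f x * g x)).
Proof. by move=> f2 g2; apply/Lfun1_integrable; exact: Lfun2_mul_Lfun1. Qed.

Lemma sqintP f : measurable_fun setT (f : borel E -> R) ->
  (\int[mu]_x (f x ^+ 2)%:E < +oo)%E -> sqint f.
Proof.
move=> mf fi; rewrite /sqint inE; apply/andP; split; rewrite inE//=.
rewrite /finite_norm unlock; apply: poweR_lty.
under eq_integral => x _ do rewrite /= powR_mulrn ?normr_ge0// -normrX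
  ger0_norm ?sqr_ge0//.
exact: fi.
Qed.

Lemma sqint_sqr f : sqint f -> (\int[mu]_x (f x ^+ 2)%:E = (scalar2 mu f f)%:E)%E.
Proof.
move=> f2; rewrite /scalar2 /Rintegral fineK.
  by apply: eq_integral => x _; rewrite expr2.
exact: (integrable_fin_num measurableT (sqint_integrable f2 f2)).
Qed.

Lemma sqint_le f g : measurable_fun setT (g : borel E -> R) ->
  (forall x, `|g x| <= `|f x|) -> sqint f -> sqint g.
Proof.
move=> mg gf f2; apply: sqintP => //.
apply: (@le_lt_trans _ _ (\int[mu]_x (f x ^+ 2)%:E)%E).
  apply: ge0_le_integral => //.
  - by move=> x _; rewrite lee_fin sqr_ge0.
  - by apply/measurable_EFinP; exact: measurable_funX.
  - by apply/measurable_EFinP; apply: measurable_funX; exact: sqint_measurable.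
  - by move=> x _; rewrite lee_fin -real_normK ?num_real// -[leRHS]real_normK
      ?num_real// lerXn2r ?nnegrE.
by rewrite sqint_sqr// ltry.
Qed.

Lemma sqint_ae f g : measurable_fun setT (g : borel E -> R) ->
  {ae mu, forall x, f x = g x} -> sqint f -> sqint g.
Proof.
move=> mg fg f2; apply: sqintP => //.
rewrite -(@ge0_integral_ae_eq _ _ _ mu (fun x => (f x ^+ 2)%:E)).
- by rewrite sqint_sqr// ltry.
- by move=> x; rewrite lee_fin sqr_ge0.
- by move=> x; rewrite lee_fin sqr_ge0.
- by move: fg; apply: ae_mono => x ->.
Qed.

Lemma sqint_nonneg_form : nonneg_form sqint (scalar2 mu).
Proof.
split.
- move=> a f g f2 g2.
  have := Lfun_submod_closed mu (lee1n 2 : (1 <= 2%:E :> \bar R)%E) => -[_ lin].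
  exact: (lin a f g f2 g2).
- have := Lfun_submod_closed mu (lee1n 2 : (1 <= 2%:E :> \bar R)%E) => -[zero _].
  exact: zero.
- move=> a f g h f2 g2 h2; rewrite /scalar2.
  under eq_Rintegral => x _ do rewrite mulrDl -mulrA.
  rewrite RintegralD//; last 2 first.
  + by apply: (@integrableZl _ _ _ mu setT measurableT a (EFin \o (fun x => f x * h x)));
      exact: sqint_integrable.
  + exact: sqint_integrable.
  by rewrite RintegralZl//; exact: sqint_integrable.
- by move=> f g _ _; apply: eq_Rintegral => x _; rewrite mulrC.
- by move=> f _; apply: Rintegral_ge0 => x _; rewrite -expr2 sqr_ge0.
Qed.

Lemma scalar2_ge0 f g : (forall x, 0 <= f x) -> (forall x, 0 <= g x) ->
  0 <= scalar2 mu f g.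
Proof. by move=> f0 g0; apply: Rintegral_ge0 => x _; rewrite mulr_ge0. Qed.

Lemma scalar2_eq0 f : sqint f -> scalar2 mu f f = 0 -> {ae mu, forall x, f x = 0}.
Proof.
move=> f2 f0; have := sqint_sqr f2; rewrite f0 => h.
have mf2 : measurable_fun setT (fun x : borel E => (f x ^+ 2)%:E).
  by apply/measurable_EFinP; apply: measurable_funX; exact: sqint_measurable.
have : (\int[mu]_x `|(f x ^+ 2)%:E| = 0)%E.
  by under eq_integral => x _ do rewrite gee0_abs ?lee_fin ?sqr_ge0//.
move/(ae_eq_integral_abs mu measurableT mf2); apply: ae_mono => x /(_ I)/= [] /eqP.
by rewrite sqrf_eq0 => /eqP.
Qed.

Lemma scalar2_ae f f' g g' : sqint f -> sqint f' -> sqint g -> sqint g' ->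
  {ae mu, forall x, f x = f' x} -> {ae mu, forall x, g x = g' x} ->
  scalar2 mu f g = scalar2 mu f' g'.
Proof.
move=> f2 f2' g2 g2' ff gg; rewrite /scalar2 /Rintegral; congr fine.
apply: ae_eq_integral => //.
- by have /integrableP[] := sqint_integrable f2 g2.
- by have /integrableP[] := sqint_integrable f2' g2'.
- by move: ff gg; apply: ae_mono2 => x -> ->.
Qed.

Lemma sqint_dominated_cvg (u : nat -> E -> R) h : sqint h ->
  (forall n, measurable_fun setT (u n : borel E -> R)) ->
  (forall n x, `|u n x| <= `|h x|) ->
  (forall x, u n x @[n --> \oo] --> 0) ->
  scalar2 mu (u n) (u n) @[n --> \oo] --> 0.
Proof.
move=> h2 mu_ uh u0.
have u2 n : sqint (u n) by exact: sqint_le (uh n) h2.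
have [|||||_ _] := @dominated_convergence _ _ _ mu setT measurableT
  (fun n x => (u n x ^+ 2)%:E) (cst 0%E) (fun x => (h x ^+ 2)%:E).
- by move=> n; apply/measurable_EFinP; exact: measurable_funX.
- exact: measurable_cst.
- apply/aeW => x _; apply: cvg_EFin; first exact: nearW.
  by have := cvgM (u0 x) (u0 x); rewrite mulr0; exact.
- exact: Lfun2_integrable_sqr.
- apply/aeW => x n _; rewrite gee0_abs ?lee_fin ?sqr_ge0//.
  by rewrite -real_normK ?num_real// -[leRHS]real_normK ?num_real// lerXn2r ?nnegrE.
rewrite /= integral0 => /fine_cvg; apply: cvg_trans; apply: near_eq_cvg.
by apply: nearW => n /=; rewrite sqint_sqr.
Qed.

End square_integrable.

(** * Completeness and lower semicontinuity of the form of index beta *)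

Section dirichlet_form.
Context {R : realType} {E : pointedMetricType R}.
Variables (mu : {measure set (borel E) -> \bar R}) (F : set (E -> R))
  (Ef : (E -> R) -> (E -> R) -> R) (beta0 beta : R).
Hypotheses (hform : lower_bounded_semi_dirichlet_form mu F Ef beta0)
  (hsym : form_symmetric F Ef) (hbeta : beta0 < beta).
Notation Q := (form_beta mu Ef beta).
Notation sc := (scalar2 mu).
Implicit Types f g h : E -> R.

Lemma domain_sqint f : F f -> sqint mu f. Proof. exact: (lbsd_L2 hform). Qed.

Lemma beta_gt0 : 0 < beta. Proof. exact: le_lt_trans (lbsd_beta0 hform) hbeta. Qed.

Lemma form_beta_lower f : F f -> (beta - beta0) * sc f f <= Q f f.
Proof.
by move=> Ff; have := lbsd_ge0 hform Ff; rewrite /form_beta; lra.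
Qed.

Lemma form_beta_nonneg_form : nonneg_form F Q.
Proof.
split.
- exact: (lbsd_dom_lin hform).
- exact: (lbsd_dom0 hform).
- move=> a f g h Ff Fg Fh; rewrite /form_beta (lbsd_linl hform)//.
  rewrite (nf_linl (sqint_nonneg_form mu)); [ring|exact: domain_sqint..].
- move=> f g Ff Fg; rewrite /form_beta hsym//.
  by rewrite (nf_sym (sqint_nonneg_form mu)); [|exact: domain_sqint..].
- move=> f Ff; apply: le_trans (form_beta_lower Ff).
  apply: mulr_ge0; first by rewrite subr_ge0 ltW.
  by apply: (nf_ge0 (sqint_nonneg_form mu)); exact: domain_sqint.
Qed.

Let nfQ := form_beta_nonneg_form.
Let nfS := sqint_nonneg_form mu.

Lemma sc_le_form f e : F f -> Q f f < (beta - beta0) * e -> sc f f < e.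
Proof.
move=> Ff Qe; have := le_lt_trans (form_beta_lower Ff) Qe.
by rewrite ltr_pM2l// subr_gt0.
Qed.

Lemma form_beta_ae f f' g g' : F f -> F f' -> F g -> F g' ->
  {ae mu, forall x, f x = f' x} -> {ae mu, forall x, g x = g' x} ->
  Q f g = Q f' g'.
Proof.
move=> Ff Ff' Fg Fg' ff gg; rewrite /form_beta (lbsd_form_ae hform Ff Ff' Fg Fg' ff gg).
by rewrite (scalar2_ae _ _ _ _ ff gg)//; exact: domain_sqint.
Qed.

Lemma form_beta_cauchy_cvg (u : nat -> E -> R) : (forall n, F (u n)) ->
  (forall e : R, 0 < e -> exists N : nat, forall m n : nat, (N <= m)%N -> (N <= n)%N ->
     Q (fun x => u m x - u n x) (fun x => u m x - u n x) < e) ->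
  exists2 v : E -> R, F v & forall e : R, 0 < e -> exists N : nat, forall n : nat,
     (N <= n)%N -> Q (fun x => u n x - v x) (fun x => u n x - v x) < e.
Proof.
move=> Fu cu.
have symE f : F f -> sym_beta mu Ef beta f f = Q f f.
  by move=> Ff; rewrite /sym_beta; lra.
have [e e0|v Fv cv] := lbsd_complete hform hbeta Fu.
  have [N hN] := cu e e0; exists N => m n Nm Nn.
  by rewrite symE ?hN//; exact: (nf_sub nfQ).
exists v => // e e0.
have /cvgrPdist_lt/(_ e e0)[N _ hN] := cv.
exists N => n Nn; have := hN n Nn; rewrite /= sub0r normrN symE; last exact: (nf_sub nfQ).
by apply: le_lt_trans; exact: ler_norm.
Qed.

(* A minimizing sequence for Q among the elements of D of energy at most b
   that are close to f in L^2 is Cauchy by the parallelogram identity. *)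
Lemma bounded_energy_closure (D : set (E -> R)) f (b : R) : D `<=` F ->
  (forall u v, D u -> D v -> D (fun x => 2^-1 * u x + 2^-1 * v x)) ->
  sqint mu f ->
  (forall e, 0 < e -> exists v, [/\ D v, Q v v <= b &
     sc (fun x => v x - f x) (fun x => v x - f x) < e]) ->
  F f /\ forall e, 0 < e -> exists v, [/\ D v, Q v v <= b &
     Q (fun x => v x - f x) (fun x => v x - f x) < e].
Proof.
move=> DF Dmid f2 happ.
pose C n := [set v | [/\ D v, Q v v <= b &
  sc (fun x => v x - f x) (fun x => v x - f x) < n.+1%:R^-1]].
have C0 n : exists v, C n v by apply: happ; rewrite invr_gt0.
have Cmid n u v : C n u -> C n v -> C n (fun x => 2^-1 * u x + 2^-1 * v x).
  move=> [Du ub ue] [Dv vb ve]; split; first exact: Dmid.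
    have := nf_ge0 nfQ (nf_sub nfQ (DF _ Du) (DF _ Dv)).
    by rewrite (nf_parallelogram nfQ (DF _ Du) (DF _ Dv)); lra.
  have su : sqint mu (fun x => u x - f x).
    by apply: (nf_sub nfS) => //; exact/domain_sqint/DF.
  have sv : sqint mu (fun x => v x - f x).
    by apply: (nf_sub nfS) => //; exact/domain_sqint/DF.
  have := nf_ge0 nfS (nf_sub nfS su sv); rewrite (nf_parallelogram nfS su sv).
  rewrite (_ : (fun x => 2^-1 * (u x - f x) + 2^-1 * (v x - f x)) =
               (fun x => 2^-1 * u x + 2^-1 * v x - f x)).
    by move: n.+1%:R^-1 ue ve => c ue ve; lra.
  by apply/funext => x; field.
have Cdec n m : (n <= m)%N -> C m `<=` C n.
  move=> nm v [Dv vb ve]; split => //; apply: (lt_le_trans ve).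
  by rewrite lef_pV2 ?posrE// ler_nat.
pose A n := [set Q v v | v in C n].
have A0 n : A n !=set0 by have [v Cv] := C0 n; exists (Q v v); exists v.
have Alb n : lbound (A n) 0 by move=> _ [v [Dv _ _] <-]; exact: (nf_ge0 nfQ (DF _ Dv)).
have hA n : has_inf (A n) by split => //; exists 0.
(* The least energy at squared L^2 distance below [1/(n+1)] from [f]: nondecreasing in [n] and
   bounded by [b], so it converges. *)
pose dd n := inf (A n).
have dd_le n v : C n v -> dd n <= Q v v.
  by move=> Cv; apply: ge_inf; [exists 0|exists v].
have dd_nd n m : (n <= m)%N -> dd n <= dd m.
  move=> nm; apply: lb_le_inf => // _ [v Cv <-]; apply: dd_le; exact: Cdec Cv.
have dd_b n : dd n <= b.
  by have [v Cv] := C0 n; apply: le_trans (dd_le _ _ Cv) _; case: Cv.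
have /choice[u hu] n : exists v, C n v /\ Q v v < dd n + n.+1%:R^-1.
  have [_ [v Cv <-] hv] := @inf_adherent _ (A n) n.+1%:R^-1 ltac:(by rewrite invr_gt0) (hA n).
  by exists v.
have cdd : cvgn dd.
  apply: nondecreasing_is_cvgn => //; exists b => _ [n _ <-]; exact: dd_b.
have Fu n : F (u n) by have [[Du _ _] _] := hu n; exact: DF.
(* The midpoint of [u n] and [u m] is still in [C n], so its energy is at least [dd n], and the
   parallelogram identity bounds the difference. *)
have uu n m : (n <= m)%N -> Q (fun x => u n x - u m x) (fun x => u n x - u m x) <=
    2 * (dd m - dd n) + 4 * n.+1%:R^-1.
  move=> nm; rewrite (nf_parallelogram nfQ)//.
  have [Cn hn] := hu n; have [Cm hm] := hu m.
  have := dd_le n _ (Cmid n _ _ Cn (Cdec _ _ nm _ Cm)).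
  have : m.+1%:R^-1 <= n.+1%:R^-1 :> R by rewrite lef_pV2 ?posrE// ler_nat.
  by move: n.+1%:R^-1 m.+1%:R^-1 hn hm => c1 c2; lra.
have Qswap f1 f2' : F f1 -> F f2' -> Q (fun x => f1 x - f2' x) (fun x => f1 x - f2' x) =
   Q (fun x => f2' x - f1 x) (fun x => f2' x - f1 x).
  by move=> F1 F2; rewrite !(nf_sub2 nfQ)// (nf_sym nfQ F1 F2); ring.
have [e e0|v Fv cv] := form_beta_cauchy_cvg Fu.
  have e4 : 0 < e / 4 by rewrite divr_gt0.
  have e8 : 0 < e / 8 by rewrite divr_gt0.
  have [N1 _ N1P] : \forall n \near \oo, `|limn dd - dd n| < e / 8.
    by have /cvgrPdist_lt/(_ _ e8) := cdd.
  have [N2 _ N2P] : \forall n \near \oo, n.+1%:R^-1 < e / 8.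
    exact: (near_infty_natSinv_lt (PosNum e8)).
  have key m n : (maxn N1 N2 <= n)%N -> (n <= m)%N ->
      Q (fun x => u n x - u m x) (fun x => u n x - u m x) < e.
    rewrite geq_max => /andP[Nn1 Nn2] nm; apply: (le_lt_trans (uu n m nm)).
    have h1 := N1P n Nn1; have h2 := N1P m (leq_trans Nn1 nm); have h3 := N2P n Nn2.
    have := ler_norm (limn dd - dd n); have := ler_norm (- (limn dd - dd m)).
    rewrite normrN /= in h1 h2 h3 *.
    by move: n.+1%:R^-1 h3 => c1 h3; lra.
  exists (maxn N1 N2) => m n Nm Nn; have [nm|/ltnW mn] := leqP n m.
    by rewrite Qswap// key.
  exact: key.
(* The limit in the form norm is identified with [f] through L^2: the form controls L^2 distances,
   and [u n] was chosen close to [f] there. *)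
have fv : {ae mu, forall x, v x = f x}.
  have v2 := domain_sqint Fv.
  have vf2 : sqint mu (fun x => v x - f x) by exact: (nf_sub nfS).
  have : {ae mu, forall x, v x - f x = 0}.
    apply: scalar2_eq0 => //; apply/le_anti.
    rewrite (nf_ge0 nfS vf2) andbT; apply/ler_addgt0Pr => e e0; rewrite add0r.
    have e4 : 0 < e / 4 by rewrite divr_gt0.
    have [N1 N1P] := cv ((beta - beta0) * (e / 4)) ltac:(by rewrite mulr_gt0// subr_gt0).
    have [N2 _ N2P] : \forall n \near \oo, n.+1%:R^-1 < e / 4.
      exact: (near_infty_natSinv_lt (PosNum e4)).
    pose n := maxn N1 N2.
    have Fuv := nf_sub nfQ (Fu n) Fv.
    have h1 := sc_le_form Fuv (N1P n (leq_maxl _ _)).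
    have [[Du _ h2] _] := hu n.
    have h3 := N2P n (leq_maxr _ _).
    have uf2 : sqint mu (fun x => u n x - f x).
      by apply: (nf_sub nfS) => //; exact: domain_sqint.
    have := nf_sub_le nfS uf2 (domain_sqint Fuv).
    rewrite (_ : (fun x => u n x - f x - (u n x - v x)) = (fun x => v x - f x)).
      by move: n.+1%:R^-1 h2 h3 => c1 h2 /= h3; lra.
    by apply/funext => x; ring.
  by apply: ae_mono => x /eqP; rewrite subr_eq0 => /eqP.
have Ff : F f by exact: (lbsd_dom_ae hform Fv f2 fv).
split => // e e0; have [N NP] := cv e e0.
exists (u N); have [[Du ub _] _] := hu N; split => //.
apply: le_lt_trans (NP N (leqnn N)).
rewrite le_eqVlt; apply/orP; left; apply/eqP.
have Fuv := nf_sub nfQ (Fu N) Fv; have Fuf := nf_sub nfQ (Fu N) Ff.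
by apply: form_beta_ae => //; move: fv; apply: ae_mono => x ->.
Qed.

(** Lower semicontinuity of the energy under L^2 convergence. Membership of [f] in the domain is
    part of the conclusion, which is how positive parts are shown to belong to it. *)
Lemma bounded_energy_limit f b : sqint mu f ->
  (forall e, 0 < e -> exists v, [/\ F v, Q v v <= b &
     sc (fun x => v x - f x) (fun x => v x - f x) < e]) ->
  F f /\ Q f f <= b.
Proof.
move=> f2 h.
have mid u v : F u -> F v -> F (fun x => 2^-1 * u x + 2^-1 * v x).
  by move=> Fu Fv; exact: (nf_comb nfQ).
have [Ff hf] := bounded_energy_closure (@subset_refl _ F) mid f2 h.
split => //; apply: (nf_limit_le nfQ Ff) => e e0.
exact: hf.
Qed.

End dirichlet_form.

(** * Energy bounds for truncations *)

Section contractions.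
Context {R : realType} {E : pointedMetricType R}.
Variables (mu : {measure set (borel E) -> \bar R}) (F : set (E -> R))
  (Ef : (E -> R) -> (E -> R) -> R) (beta0 beta : R).
Hypotheses (hform : lower_bounded_semi_dirichlet_form mu F Ef beta0)
  (hsym : form_symmetric F Ef) (hbeta : beta0 < beta).
Notation Q := (form_beta mu Ef beta).
Notation sc := (scalar2 mu).
Implicit Types f g h : E -> R.

Let nfQ := form_beta_nonneg_form hform hsym hbeta.
Let nfS := sqint_nonneg_form mu.

(** The unit contraction is applied to [M^-1 f]. In [Q g (f - g)] the form part is nonnegative by
    the contraction property and the L^2 part pointwise. Hence [Q g g <= Q g f], and the mean
    inequality gives the bound. *)
Lemma clip_form f M : F f -> 0 < M ->
  let g := fun x => Num.min (Num.max (f x) 0) M in F g /\ Q g g <= Q f f.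
Proof.
move=> Ff M0 g.
have Ff1 : F (fun x => M^-1 * f x) := nf_scale nfQ _ Ff.
have [] := lbsd_contraction hform Ff1; set g1 := (fun x : E => _) => Fg1 hE.
have gE : g = (fun x => M * g1 x).
  apply/funext => x; rewrite /g /g1 minr_pMr ?(ltW M0)// mulr1 maxr_pMr ?(ltW M0)//.
  by rewrite mulr0 mulrA mulfV ?mul1r// gt_eqF.
have Fg : F g by rewrite gE; exact: (nf_scale nfQ).
split => //.
have Ffg := nf_sub nfQ Ff Fg.
have Efg0 : 0 <= Q g (fun x => f x - g x).
  rewrite /form_beta addr_ge0//.
    have -> : (fun x => f x - g x) = (fun x => M * (M^-1 * f x - g1 x) + 0).
      by apply/funext => x; rewrite gE mulrBr mulrA mulfV ?mul1r ?addr0// gt_eqF.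
    have -> : g = (fun x => M * g1 x + 0) by apply/funext => x; rewrite gE addr0.
    have Fd := nf_sub nfQ Ff1 Fg1.
    have F0 := lbsd_dom0 hform.
    have E0 h : F h -> Ef (fun=> 0) h = 0.
      move=> Fh; have := lbsd_linl hform 1 F0 F0 Fh.
      rewrite (_ : (fun x => 1 * 0 + 0) = (fun=> 0)); last first.
        by apply/funext => x; rewrite mulr0 addr0.
      by rewrite mul1r; lra.
    rewrite (lbsd_linl hform)//; last exact: (lbsd_dom_lin hform).
    rewrite E0 ?addr0; last exact: (lbsd_dom_lin hform).
    rewrite (lbsd_linr hform)// (hsym Fg1 F0) E0// addr0.
    by rewrite mulr_ge0 ?(ltW M0)// mulr_ge0 ?(ltW M0).
  rewrite mulr_ge0//; first exact/ltW/(beta_gt0 hform hbeta).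
  apply: Rintegral_ge0 => x _; rewrite /g.
  case: (lerP (f x) 0) => f0; first by rewrite (min_l (ltW M0)) mul0r.
  case: (lerP (f x) M) => fM; first by rewrite subrr mulr0.
  by rewrite mulr_ge0 ?subr_ge0 ?ltW.
have h1 := nf_le_mean nfQ Fg Ff.
have := nf_subl nfQ Ff Fg Fg; rewrite (nf_sym nfQ Ffg Fg) (nf_sym nfQ Ff Fg).
by lra.
Qed.

(** Clips of [f] at growing levels have energy at most [Q f f] and converge in L^2 to the positive
    part. *)
Lemma pos_form f : F f ->
  F (fun x => Num.max (f x) 0) /\
  Q (fun x => Num.max (f x) 0) (fun x => Num.max (f x) 0) <= Q f f.
Proof.
move=> Ff; have f2 := domain_sqint hform Ff.
have mf := sqint_measurable f2.
have mp : measurable_fun setT ((fun x => Num.max (f x) 0) : borel E -> R).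
  exact: measurable_maxr.
have p2 : sqint mu (fun x => Num.max (f x) 0).
  apply: sqint_le f2 => // x; case: (lerP (f x) 0) => f0; first by rewrite normr0.
  by [].
apply: (bounded_energy_limit hform hsym hbeta) => // e e0.
pose g n x := Num.min (Num.max (f x) 0) n.+1%:R.
have hg n : F (g n) /\ Q (g n) (g n) <= Q f f by exact: clip_form.
have cv : sc (fun x => g n x - Num.max (f x) 0) (fun x => g n x - Num.max (f x) 0)
    @[n --> \oo] --> 0.
  apply: (sqint_dominated_cvg p2).
  - move=> n; apply: measurable_funB => //.
    by apply: sqint_measurable; exact: domain_sqint hform _ (hg n).1.
  - move=> n x; rewrite /g; set p := Num.max _ _.
    have p0 : 0 <= p by rewrite le_max lexx orbT.
    have m0 : 0 <= Num.min p n.+1%:R by rewrite le_min p0/=.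
    rewrite (ger0_norm p0) distrC ger0_norm ?subr_ge0 ?ge_min ?lexx//.
    by rewrite gerBl.
  - move=> x; rewrite /g; set p := Num.max _ _.
    apply: cvg_near_cst; exists (Num.truncn p) => // n /= pn.
    rewrite min_l ?subrr// (le_trans (ltW (truncnS_gt p)))// ler_nat//.
have /cvgrPdist_lt/(_ e e0)[N _ hN] := cv.
exists (g N); split; [exact: (hg N).1|exact: (hg N).2|].
have := hN N (leqnn N); rewrite /= sub0r normrN; apply: le_lt_trans.
exact: ler_norm.
Qed.

(* min(f, g) = f - (f - g)^+. *)
Lemma min_form f g : F f -> F g ->
  F (fun x => Num.min (f x) (g x)) /\
  Q (fun x => Num.min (f x) (g x)) (fun x => Num.min (f x) (g x)) <=
    6 * Q f f + 4 * Q g g.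
Proof.
move=> Ff Fg; have Fd := nf_sub nfQ Ff Fg; have [Fp Qp] := pos_form Fd.
have -> : (fun x => Num.min (f x) (g x)) = (fun x => f x - Num.max (f x - g x) 0).
  apply/funext => x; case: (lerP (f x) (g x)) => fg.
    by rewrite max_r ?subr0// subr_le0.
  by rewrite max_l ?subr_ge0 ?(ltW fg)// opprB addrC subrK.
split; first exact: (nf_sub nfQ).
have := nf_sub_le nfQ Ff Fp; have := nf_sub_le nfQ Ff Fg.
by lra.
Qed.

(* (f - M)^+ = f^+ - min(f^+, M). *)
Lemma cut_form f M : F f -> 0 < M ->
  F (fun x => Num.max (f x - M) 0) /\
  Q (fun x => Num.max (f x - M) 0) (fun x => Num.max (f x - M) 0) <= 4 * Q f f.
Proof.
move=> Ff M0; have [Fp Qp] := pos_form Ff; have [Fc Qc] := clip_form Ff M0.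
have -> : (fun x => Num.max (f x - M) 0) =
    (fun x => Num.max (f x) 0 - Num.min (Num.max (f x) 0) M).
  apply/funext => x; case: (lerP (f x) 0) => f0.
    by rewrite (min_l (ltW M0)) subrr max_r// subr_le0 (le_trans f0)// ltW.
  case: (lerP (f x) M) => fM; first by rewrite subrr max_r// subr_le0.
  by rewrite max_l// subr_ge0 ltW.
split; first exact: (nf_sub nfQ).
by have := nf_sub_le nfQ Fp Fc; lra.
Qed.

End contractions.

(** * Penalized potentials *)

Lemma adde_cancel_right {R : realType} (a p u c : \bar R) : c \is a fin_num ->
  (a + c = p + (u + c) -> p + u = a)%E.
Proof. by move=> cfin; rewrite addeA => h; rewrite -[LHS](addeK _ cfin) -h addeK. Qed.

Section penalized_resolvent.
Context {R : realType} {E : pointedMetricType R}.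
Hypothesis hlc : locally_compact [set: E].
Hypothesis hsep : separable_space E.
Notation ED := (cemetery_ext E).
Context {d : measure_display} {W : measurableType d}.
Variables (X : R -> W -> ED) (P : ED -> probability W R).
Hypothesis hX : hunt_process X P.
Notation Xpos := (Xpos X).
Notation res := (green X P).
Notation leb := (@lebesgue_measure R).
Local Open Scope ereal_scope.

Section res_linear.
Variables (g h : borel ED -> \bar R).
Hypotheses (mg : measurable_fun setT g) (g0 : forall y, 0 <= g y).
Hypotheses (mh : measurable_fun setT h) (h0 : forall y, 0 <= h y).

Let mcomp (f : borel ED -> \bar R) t : measurable_fun setT f ->
  measurable_fun setT (fun w => f (Xpos t w)).
Proof. by move=> mf; exact: (measurableT_comp mf (measurable_Xpos hX t)). Qed.

Let mexpw (f : borel ED -> \bar R) l y : measurable_fun setT f ->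
  (forall y, 0 <= f y) ->
  measurable_fun setT (fun t => (expw l t)%:E * \int[P y]_w f (Xpos t w)).
Proof.
move=> mf f0; apply: emeasurable_funM.
  by apply/measurable_EFinP; exact: measurable_expw.
exact: (measurable_semigroup_time hlc hsep hX).
Qed.

Lemma res_le l y : (forall z, g z <= h z) -> res l g y <= res l h y.
Proof.
move=> gh; apply: ge0_le_integral => //.
- by move=> t _; rewrite mule_ge0 ?lee_fin ?expw_ge0 ?integral_ge0.
- exact: mexpw.
- exact: mexpw.
- move=> t _; rewrite lee_wpmul2l ?lee_fin ?expw_ge0//.
  by apply: ge0_le_integral => //; exact: mcomp.
Qed.

Lemma res_add l y : res l (fun z => g z + h z) y = res l g y + res l h y.
Proof.
rewrite /green -ge0_integralD//; last 4 first.
- by move=> t _; rewrite mule_ge0 ?lee_fin ?expw_ge0 ?integral_ge0.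
- exact: mexpw.
- by move=> t _; rewrite mule_ge0 ?lee_fin ?expw_ge0 ?integral_ge0.
- exact: mexpw.
apply: eq_integral => t _; rewrite -ge0_muleDr ?integral_ge0//; congr (_ * _).
by rewrite ge0_integralD//; exact: mcomp.
Qed.

Lemma res_scale l k y : (0 <= k)%R -> res l (fun z => k%:E * g z) y = k%:E * res l g y.
Proof.
move=> k0; rewrite /green -ge0_integralZl//; last 2 first.
- exact: mexpw.
- by move=> t _; rewrite mule_ge0 ?lee_fin ?expw_ge0 ?integral_ge0.
apply: eq_integral => t _; rewrite ge0_integralZl//; last exact: mcomp.
by rewrite muleCA.
Qed.

Lemma res_bound l c y : (0 < l)%R -> (forall z, g z <= c%:E) -> res l g y <= (c / l)%:E.
Proof.
move=> l0 gc.
have c0 : (0 <= c)%R by rewrite -lee_fin (le_trans (g0 None)).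
apply: (@le_trans _ _ (\int[leb]_t (c%:E * (expw l t)%:E))).
  apply: ge0_le_integral => //.
  - by move=> t _; rewrite mule_ge0 ?lee_fin ?expw_ge0 ?integral_ge0.
  - exact: mexpw.
  - apply: emeasurable_funM => //.
    by apply/measurable_EFinP; exact: measurable_expw.
  - move=> t _; rewrite [leRHS]muleC lee_wpmul2l ?lee_fin ?expw_ge0//.
    apply: (@le_trans _ _ (\int[P y]_w (cst c%:E w))).
      by apply: ge0_le_integral => //; exact: mcomp.
    by rewrite integral_cst// -[leRHS]mule1 lee_wpmul2l ?lee_fin//; exact: probability_le1.
rewrite ge0_integralZl//.
- by rewrite integral_expw// -EFinM.
- by apply/measurable_EFinP; exact: measurable_expw.
- by move=> t _; rewrite lee_fin expw_ge0.
Qed.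

Lemma res_monotone_cvg (u : nat -> borel ED -> \bar R) l y :
  (forall n, measurable_fun setT (u n)) -> (forall n z, 0 <= u n z) ->
  (forall z, {homo u ^~ z : a b / (a <= b)%N >-> a <= b}) ->
  (forall z, u n z @[n --> \oo] --> g z) ->
  res l (u n) y @[n --> \oo] --> res l g y.
Proof.
move=> mu u0 ndu cu; apply: ge0_nondecreasing_cvg_integral => //.
- by move=> n; exact: mexpw.
- by move=> n t _; rewrite mule_ge0 ?lee_fin ?expw_ge0 ?integral_ge0.
- move=> t _ a b ab; rewrite lee_wpmul2l ?lee_fin ?expw_ge0//.
  by apply: ge0_le_integral => //; [exact: mcomp|exact: mcomp|move=> w _; exact: ndu].
- move=> t _; apply: cvgeZl => //.
  apply: ge0_nondecreasing_cvg_integral => //.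
  by move=> n; exact: mcomp.
Qed.

End res_linear.

Local Opaque green.

Variables (f : borel ED -> \bar R) (U : set (borel ED)) (b k : R).
Hypotheses (mf : measurable_fun setT f) (f0 : forall y, 0 <= f y)
  (f1 : forall y, f y <= 1) (mU : measurable U) (b0 : (0 < b)%R) (k0 : (0 < k)%R).

Let iU (y : borel ED) : \bar R := (\1_U y)%:E.
Let iC (y : borel ED) : \bar R := (\1_(~` U) y)%:E.

Let miU : measurable_fun setT iU.
Proof. by apply/measurable_EFinP; exact: measurable_indic. Qed.

Let miC : measurable_fun setT iC.
Proof. by apply/measurable_EFinP; apply: measurable_indic; exact: measurableC. Qed.

Let iU0 y : 0 <= iU y. Proof. by rewrite lee_fin. Qed.
Let iC0 y : 0 <= iC y. Proof. by rewrite lee_fin. Qed.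
Let iC1 y : iC y <= 1. Proof. by rewrite lee_fin indicE lern1 leq_b1. Qed.

Let iUC y : iU y + iC y = 1.
Proof.
rewrite /iU /iC -EFinD !indicE; have [Uy|Uy] := pselect (U y).
  by rewrite mem_set// memNset ?addr0//; exact.
by rewrite memNset// mem_set// add0r.
Qed.

(* [pen] is the minimal solution of v = R_{b+k} (f + k 1_{~U} v), the potential of
   f for the process killed at rate k on U. *)
Definition pen_source (v : ED -> \bar R) (y : borel ED) : \bar R :=
  f y + k%:E * (iC y * v y).

Fixpoint pen_seq (n : nat) : ED -> \bar R :=
  if n is m.+1 then res (b + k) (pen_source (pen_seq m)) else cst 0.

Definition pen (y : ED) : \bar R := limn (pen_seq ^~ y).

Let src_ge0 v y : (forall z, 0 <= v z) -> 0 <= pen_source v y.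
Proof. by move=> v0; rewrite /pen_source adde_ge0// !mule_ge0// lee_fin ltW. Qed.

Let msrc (v : borel ED -> \bar R) : measurable_fun setT v ->
  measurable_fun setT (pen_source v).
Proof.
move=> mv; apply: emeasurable_funD => //; apply: emeasurable_funM => //.
exact: emeasurable_funM.
Qed.

Lemma pen_seq_ge0 n y : 0 <= pen_seq n y.
Proof.
elim: n y => [//|n ih] y /=; apply: res_ge0 => z; exact: src_ge0.
Qed.

Lemma measurable_pen_seq n : measurable_fun setT (pen_seq n : borel ED -> \bar R).
Proof.
elim: n => [|n ih] /=; first exact: measurable_cst.
apply: (measurable_res hlc hsep hX); first exact: msrc.
by move=> y; apply: src_ge0; exact: pen_seq_ge0.
Qed.

Let src_le v w : (forall z, v z <= w z) -> forall y, pen_source v y <= pen_source w y.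
Proof.
move=> vw y; rewrite leeD2l// lee_wpmul2l ?lee_fin ?(ltW k0)//.
by rewrite lee_wpmul2l.
Qed.

Lemma pen_seq_nd y : {homo pen_seq ^~ y : n m / (n <= m)%N >-> n <= m}.
Proof.
apply/nondecreasing_seqP => n; elim: n y => [|n ih] y; first exact: pen_seq_ge0.
apply: res_le.
- exact: (msrc (measurable_pen_seq n)).
- by move=> z; apply: src_ge0; exact: pen_seq_ge0.
- exact: (msrc (measurable_pen_seq n.+1)).
- by move=> z; apply: src_ge0; exact: (pen_seq_ge0 n.+1).
- exact: src_le.
Qed.

Let src_bound v : (forall z, v z <= (b^-1)%:E) ->
  forall y, pen_source v y <= ((b + k) / b)%:E.
Proof.
move=> vb y; rewrite mulrDl mulfV ?gt_eqF// EFinD leeD//.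
rewrite EFinM lee_wpmul2l ?lee_fin ?(ltW k0)//.
rewrite -[leRHS]mul1e; apply: (@le_trans _ _ (iC y * (b^-1)%:E)).
  by rewrite lee_wpmul2l.
by rewrite lee_wpmul2r// lee_fin invr_ge0 ltW.
Qed.

Lemma pen_seq_bound n y : pen_seq n y <= (b^-1)%:E.
Proof.
elim: n y => [|n ih] y /=; first by rewrite lee_fin invr_ge0 ltW.
have bk : (0 < b + k)%R by rewrite addr_gt0.
(* A bound [b^-1] on an iterate bounds its source by [1 + k / b = (b + k) / b], and the resolvent of
   index [b + k] brings this back to [b^-1]. *)
rewrite (_ : b^-1 = ((b + k) / b) / (b + k))%R; last by rewrite mulrAC mulfV ?mul1r ?gt_eqF.
apply: res_bound => //.
- exact: (msrc (measurable_pen_seq n)).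
- by move=> z; apply: src_ge0; exact: pen_seq_ge0.
- exact: src_bound.
Qed.

Lemma cvg_pen y : pen_seq n y @[n --> \oo] --> pen y.
Proof. exact/ereal_nondecreasing_is_cvgn/pen_seq_nd. Qed.

Lemma pen_seq_le n y : pen_seq n y <= pen y.
Proof.
rewrite /pen (cvg_lim _ (ereal_nondecreasing_cvgn (@pen_seq_nd y)))//.
by apply: ereal_sup_ubound; exists n.
Qed.

Lemma pen_ge0 y : 0 <= pen y. Proof. exact: le_trans (pen_seq_ge0 0 y) (pen_seq_le 0 y). Qed.

Lemma pen_bound y : pen y <= (b^-1)%:E.
Proof. by apply: lime_le; [exact: cvgP (@cvg_pen y)|apply: nearW => n; exact: pen_seq_bound]. Qed.

Lemma measurable_pen : measurable_fun setT (pen : borel ED -> \bar R).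
Proof.
apply: (@emeasurable_fun_cvg _ (borel ED) _ setT pen_seq pen) => [n|y _].
  exact: measurable_pen_seq.
exact: cvg_pen.
Qed.

Lemma penE y : pen y = res (b + k) (pen_source pen) y.
Proof.
have h : pen_seq n.+1 y @[n --> \oo] --> res (b + k) (pen_source pen) y.
  apply: res_monotone_cvg.
  - by move=> n; exact: (msrc (measurable_pen_seq n)).
  - by move=> n z; apply: src_ge0; exact: pen_seq_ge0.
  - move=> z n m nm; apply: src_le => z'; exact: pen_seq_nd.
  - move=> z; apply: cvgeD.
    + by rewrite ge0_adde_def// ?inE// mule_ge0 ?lee_fin ?(ltW k0)// mule_ge0// pen_ge0.
    + exact: cvg_cst.
    + by apply: cvgeZl => //; apply: cvgeZl => //; exact: cvg_pen.
have h' : pen_seq n.+1 y @[n --> \oo] --> pen y by rewrite (cvg_shiftS (pen_seq ^~ y)); exact: cvg_pen.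
by rewrite -(cvg_lim _ h')// -(cvg_lim _ h).
Qed.

Let mpU : measurable_fun setT (fun y : borel ED => iU y * pen y).
Proof. by apply: emeasurable_funM => //; exact: measurable_pen. Qed.
Let mpC : measurable_fun setT (fun y : borel ED => iC y * pen y).
Proof. by apply: emeasurable_funM => //; exact: measurable_pen. Qed.
Let pU0 (y : borel ED) : 0 <= iU y * pen y. Proof. by rewrite mule_ge0// pen_ge0. Qed.
Let pC0 (y : borel ED) : 0 <= iC y * pen y. Proof. by rewrite mule_ge0// pen_ge0. Qed.

(** This is [pen = R_b (f - k 1_U pen)] without subtraction. The resolvent identity for the source
    of [pen] reads [R_b (f + k 1_{~U} pen) = pen + k R_b pen], and the common term
    [k R_b (1_{~U} pen)] cancels, being finite because [pen <= 1/b]. *)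
Lemma pen_resolvent y : pen y + k%:E * res b (fun z => iU z * pen z) y = res b f y.
Proof.
have ms : measurable_fun setT (pen_source pen) by exact: (msrc measurable_pen).
have s0 z : 0 <= pen_source pen z by apply: src_ge0; exact: pen_ge0.
have k0' : (0 <= k)%R by exact: ltW.
have mkC : measurable_fun setT (fun z : borel ED => k%:E * (iC z * pen z)).
  exact: emeasurable_funM.
have kC0 z : 0 <= k%:E * (iC z * pen z) by rewrite mule_ge0 ?lee_fin.
have := resolvent_identity hlc hsep hX ms s0 b y k0.
rewrite (res_commute hlc hsep hX ms s0) -penE.
have -> : res b (res (b + k) (pen_source pen)) y = res b pen y.
  by congr (res b _ y); apply/funext => z; rewrite -penE.
have -> : res b pen y = res b (fun z => iU z * pen z) y + res b (fun z => iC z * pen z) y.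
  rewrite -(res_add mpU pU0 mpC pC0 b y); congr (res b _ y); apply/funext => z.
  by rewrite -ge0_muleDl// iUC mul1e.
have -> : res b (pen_source pen) y = res b f y + k%:E * res b (fun z => iC z * pen z) y.
  by rewrite -(res_scale mpC pC0 b y k0'); exact: (res_add mf f0 mkC kC0 b y).
have -> : k%:E * (res b (fun z => iU z * pen z) y + res b (fun z => iC z * pen z) y) =
    k%:E * res b (fun z => iU z * pen z) y + k%:E * res b (fun z => iC z * pen z) y.
  by apply: ge0_muleDr; apply: res_ge0.
pose c := k%:E * res b (fun z => iC z * pen z) y.
have cfin : c \is a fin_num.
  apply: fin_numM => //; rewrite ge0_fin_numE; last exact: res_ge0.
  apply: (@le_lt_trans _ _ (b^-1 / b)%:E); last by rewrite ltry.
  apply: (res_bound mpC pC0 y b0) => z; rewrite -[leRHS]mul1e.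
  apply: (@le_trans _ _ (1 * pen z)); first by rewrite lee_wpmul2r ?pen_ge0.
  by rewrite !mul1e pen_bound.
exact: (adde_cancel_right cfin).
Qed.

End penalized_resolvent.

Lemma limn_esup_le_lim {R : realType} (u v : (\bar R)^nat) (l : \bar R) :
  (forall n, (u n <= v n)%E) -> v n @[n --> \oo] --> l -> (limn_esup u <= l)%E.
Proof.
move=> uv vl; rewrite -(cvg_limn_einf_sup vl).2 !limn_esup_lim.
apply: lee_lim; [exact: is_cvg_esups|exact: is_cvg_esups|].
apply: nearW => n; apply: ge_ereal_sup => _ [m nm <-].
by apply: (le_trans (uv m)); apply: ereal_sup_ubound; exists m.
Qed.

Section penalized_killed.
Context {R : realType} {E : pointedMetricType R}.
Hypothesis hlc : locally_compact [set: E].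
Hypothesis hsep : separable_space E.
Notation ED := (cemetery_ext E).
Context {d : measure_display} {W : measurableType d}.
Variables (X : R -> W -> ED) (P : ED -> probability W R).
Hypothesis hX : hunt_process X P.
Notation Xpos := (Xpos X).
Notation res := (green X P).
Notation killed_res := (killed_green X P).
Notation leb := (@lebesgue_measure R).
Local Open Scope ereal_scope.
Local Opaque green killed_green pen.
Variables (f : borel ED -> \bar R) (U : set (borel ED)) (b : R).
Hypotheses (mf : measurable_fun setT f) (f0 : forall y, 0 <= f y)
  (f1 : forall y, f y <= 1) (oU : open (U : set ED)) (b0 : (0 < b)%R).

Let mU : measurable U. Proof. exact: sub_sigma_algebra. Qed.

Let iU (y : borel ED) : \bar R := (\1_U y)%:E.
Let iC (y : borel ED) : \bar R := (\1_(~` U) y)%:E.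

Let miU : measurable_fun setT iU.
Proof. by apply/measurable_EFinP; exact: measurable_indic. Qed.
Let miC : measurable_fun setT iC.
Proof. by apply/measurable_EFinP; apply: measurable_indic; exact: measurableC. Qed.
Let iU0 y : 0 <= iU y. Proof. by rewrite lee_fin. Qed.
Let iC0 y : 0 <= iC y. Proof. by rewrite lee_fin. Qed.

Notation pen := (pen X P f U b).

Section stopping.
Variables (k : R) (sigma : W -> \bar R).
Hypotheses (k0 : (0 < k)%R) (hs : stopping_time X sigma).

Let mpen := measurable_pen hlc hsep hX b mf f0 mU k0.
Let pen0 := pen_ge0 hlc hsep hX b mf f0 mU k0.

Let mpU : measurable_fun setT (fun y : borel ED => iU y * pen k y).
Proof. exact: emeasurable_funM. Qed.
Let pU0 (y : borel ED) : 0 <= iU y * pen k y. Proof. by rewrite mule_ge0. Qed.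

Let mat (g : borel ED -> \bar R) : measurable_fun setT g ->
  measurable_fun setT (fun w => expeR (- (b%:E * sigma w)) * g (at_time X (sigma w) w)).
Proof.
move=> mg; apply: emeasurable_funM.
  apply: measurableT_comp; first exact: measurable_expeR.
  apply: measurableT_comp => //; apply: emeasurable_funM => //.
  exact: (measurable_stopping_time hX hs).
exact: (measurableT_comp mg (measurable_at_stopping_time hlc hsep hX hs)).
Qed.

(** Dynkin's formula for [f] is compared with the one for [1_U pen], multiplied by [k]. The relation
    between [pen] and the resolvent of index [b] is used at [x] and again at the position reached at
    [sigma]; the finite contribution of [1_U pen] after [sigma] cancels. *)
Lemma pen_dynkin x : pen k x + k%:E * killed_res sigma b (fun z => iU z * pen k z) x =
  killed_res sigma b f x +
  \int[P x]_w (expeR (- (b%:E * sigma w)) * pen k (at_time X (sigma w) w)).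
Proof.
have k0' : (0 <= k)%R by exact: ltW.
have hp := pen_resolvent hlc hsep hX mf f0 f1 mU b0 k0.
have := dynkin_formula hlc hsep hX mf f0 hs x b0; rewrite -hp.
have -> : \int[P x]_w (expeR (- (b%:E * sigma w)) * res b f (at_time X (sigma w) w)) =
  \int[P x]_w (expeR (- (b%:E * sigma w)) * pen k (at_time X (sigma w) w)) +
  k%:E * \int[P x]_w (expeR (- (b%:E * sigma w)) *
    res b (fun z => iU z * pen k z) (at_time X (sigma w) w)).
  have mr : measurable_fun setT (res b (fun z => iU z * pen k z) : borel ED -> \bar R).
    exact: (measurable_res hlc hsep hX).
  rewrite -ge0_integralZl//; last 2 first.
  - exact: mat.
  - by move=> w _; rewrite mule_ge0 ?expeR_ge0 ?res_ge0.
  rewrite -ge0_integralD//; last 4 first.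
  - by move=> w _; rewrite mule_ge0 ?expeR_ge0.
  - exact: mat.
  - by move=> w _; rewrite !mule_ge0 ?lee_fin ?expeR_ge0 ?res_ge0.
  - by apply: emeasurable_funM => //; exact: mat.
  apply: eq_integral => w _; rewrite -hp ge0_muleDr ?mule_ge0 ?lee_fin ?res_ge0//.
  by rewrite muleCA.
rewrite (dynkin_formula hlc hsep hX mpU pU0 hs x b0).
pose c := k%:E * \int[P x]_w (expeR (- (b%:E * sigma w)) *
    res b (fun z => iU z * pen k z) (at_time X (sigma w) w)).
have -> : k%:E * (killed_res sigma b (fun z => iU z * pen k z) x +
    \int[P x]_w (expeR (- (b%:E * sigma w)) *
      res b (fun z => iU z * pen k z) (at_time X (sigma w) w))) =
    k%:E * killed_res sigma b (fun z => iU z * pen k z) x + c.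
  apply: ge0_muleDr; first exact: killed_res_ge0.
  by apply: integral_ge0 => w _; apply: mule_ge0; [exact: expeR_ge0|exact: res_ge0].
have cfin : c \is a fin_num.
  apply: fin_numM => //; rewrite ge0_fin_numE; last first.
    by apply: integral_ge0 => w _; rewrite mule_ge0 ?expeR_ge0 ?res_ge0.
  apply: (@le_lt_trans _ _ (\int[P x]_w (cst (b^-1 / b)%:E w))); last first.
    by rewrite integral_cst// ltey_eq fin_numM// fin_num_measure.
  apply: ge0_le_integral => //.
  - by move=> w _; rewrite mule_ge0 ?expeR_ge0 ?res_ge0.
  - apply: mat; exact: (measurable_res hlc hsep hX).
  - move=> w _; rewrite -[leRHS]mul1e; apply: lee_pmul.
    + exact: expeR_ge0.
    + exact: res_ge0.
    + rewrite -expeR0 lee_expeR oppe_le0 mule_ge0 ?lee_fin ?(ltW b0)//.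
      exact: (stopping_time_ge0 hs).
    + apply: (res_bound hlc hsep hX) => // z.
      rewrite -[leRHS]mul1e; apply: lee_pmul => //.
        by rewrite lee_fin indicE lern1 leq_b1.
      exact: (pen_bound hlc hsep hX).
by move=> h; apply: (adde_cancel_right cfin); rewrite -addeA h addeA.
Qed.

Lemma pen_le_killed x : pen k x <= killed_res sigma b f x +
  \int[P x]_w (expeR (- (b%:E * sigma w)) * pen k (at_time X (sigma w) w)).
Proof.
rewrite -pen_dynkin leeDl// mule_ge0 ?lee_fin ?(ltW k0)//.
exact: killed_res_ge0.
Qed.

End stopping.

(** Before hitting [U] the path is off [U], so the penalty term vanishes up to that time, and the
    contribution after it is nonnegative. *)
Lemma killed_le_pen k x : (0 < k)%R -> killed_res (hit X U) b f x <= pen k x.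
Proof.
move=> k0.
have hs := hit_stopping_time hX oU.
have pen0 := pen_ge0 hlc hsep hX b mf f0 mU k0.
have := pen_dynkin k0 hs x.
have -> : killed_res (hit X U) b (fun z => iU z * pen k z) x = 0.
  apply: integral0_eq => w _; apply: integral0_eq => t _.
  have [t0|t0] := leP 0%R t; last by rewrite expw_neg// mul0e.
  have [th|th] := boolP (t%:E < hit X U w); last by rewrite mul0e mule0.
  rewrite /iU indicE memNset ?mul0e ?mule0//.
  by rewrite XposE//; exact: before_hit th.
rewrite mule0 adde0 => ->; rewrite leeDl//.
by apply: integral_ge0 => w _; rewrite mule_ge0 ?expeR_ge0.
Qed.

(** Started in the open set [U], a path stays there up to some positive time by right continuity.
    The penalty has then removed almost all mass before the path can leave. *)
Lemma pen_vanish y : U y -> pen n.+1%:R y @[n --> \oo] --> 0.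
Proof.
move=> Uy.
pose phi n w := n.+1%:R%:E * \int[leb]_t ((expw (b + n.+1%:R) t)%:E * iC (Xpos t w)).
have bn0 n : (0 < b + n.+1%:R)%R by rewrite addr_gt0.
have mphi n : measurable_fun setT (phi n).
  apply: emeasurable_funM => //.
  apply: (@measurable_fun_fubini_tonelli_G _ _ _ _ _ leb (fun p : R * W =>
    (expw (b + n.+1%:R) p.1)%:E * iC (Xpos p.1 p.2))).
    apply: emeasurable_funM.
      by apply/measurable_EFinP; apply: measurableT_comp => //; exact: measurable_expw.
    exact: (measurable_comp_process hlc hsep hX miC).
  by move=> p; rewrite mule_ge0 ?lee_fin ?expw_ge0.
have phi0 n w : 0 <= phi n w.
  rewrite mule_ge0 ?lee_fin//; apply: integral_ge0 => t _.
  by rewrite mule_ge0 ?lee_fin ?expw_ge0.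
have mexp n (g : R -> R) : measurable_fun setT g ->
    measurable_fun setT (fun t : R => (expw (b + n.+1%:R) t)%:E * (g t)%:E).
  by move=> mg; apply: emeasurable_funM; apply/measurable_EFinP => //; exact: measurable_expw.
have miCw w : measurable_fun setT (fun t => iC (Xpos t w)).
  have m2 : measurable_fun setT (fun t : R => (t, w)).
    by apply: measurable_fun_pair; [exact: measurable_id|exact: measurable_cst].
  exact: (measurableT_comp (measurable_comp_process hlc hsep hX miC) m2).
have mexpC n w : measurable_fun setT (fun t : R => (expw (b + n.+1%:R) t)%:E * iC (Xpos t w)).
  by apply: emeasurable_funM => //; apply/measurable_EFinP; exact: measurable_expw.
have ge_part n w s : (0 <= s)%R -> (forall t, (0 <= t)%R -> (t < s)%R -> U (X t w)) ->
    phi n w <= expeR (- ((b + n.+1%:R)%:E * s%:E)).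
  move=> s0 Us.
  apply: (@le_trans _ _ (n.+1%:R%:E * \int[leb]_t ((expw (b + n.+1%:R) t)%:E *
      ((s%:E <= t%:E)%E%:R)%:E))).
    apply: lee_wpmul2l; rewrite ?lee_fin//; apply: ge0_le_integral => //.
    - by move=> t _; rewrite mule_ge0 ?lee_fin ?expw_ge0.
    - exact: mexpC.
    - apply: mexp; apply: measurable_indic_bool.
      rewrite (_ : [set _ | _] = `[s, +oo[%classic); first exact: measurable_itv.
      by apply/seteqP; split => x /=; rewrite in_itv/= andbT lee_fin.
    - move=> t _; have [t0|t0] := leP 0%R t; last by rewrite expw_neg// !mul0e.
      rewrite lee_wpmul2l ?lee_fin ?expw_ge0// /iC indicE.
      have [ts|st] := ltP t s; last by rewrite lern1 leq_b1.
      rewrite memNset//= XposE// => nU; apply: nU; exact: Us.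
  rewrite integral_expw_ge ?lee_fin//.
  rewrite mulrA -[leRHS]mul1r ler_wpM2r ?expR_ge0//.
  by rewrite ler_pdivrMr// mul1r lerDr ltW.
have phi1 n w : phi n w <= 1.
  have := ge_part n w 0%R (lexx _); rewrite mule0 oppe0 expeR0; apply.
  by move=> t t0; rewrite ltNge t0.
have aecvg : {ae P y, forall w, phi n w @[n --> \oo] --> 0}.
  have m0 : measurable [set w | X 0 w = y].
    have := hunt_measurable hX (lexx 0%R) measurableT
      (@sub_sigma_algebra _ _ _ (~` [set y]) _).
    rewrite setTI => h.
    have cy : closed ([set y] : set ED).
      apply: accessible_closed_set1; apply: hausdorff_accessible.
      exact: cemetery_hausdorff.
    have := measurableC (h (closed_openC cy)).
    by rewrite preimage_setC setCK.
  exists (~` [set w | X 0 w = y]); split.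
  - exact: measurableC.
  - by rewrite probability_setC// (hunt_normal hX) subee.
  - move=> w /= hw xy; apply: hw.
    have [s /= s0 sU] : nbhs 0%R^'+ [set t | U (X t w)].
      apply: (hunt_right_continuous hX (lexx 0%R)); rewrite xy.
      exact: open_nbhs_nbhs.
    have Us t : (0 <= t)%R -> (t < s)%R -> U (X t w).
      rewrite le_eqVlt => /orP[/eqP <- _|t0 ts]; first by rewrite xy.
      by apply: (sU t) => //; rewrite /= sub0r normrN gtr0_norm.
    apply: (@squeeze_cvge _ _ _ _ (cst 0) _ (fun n => (s^-1 * n.+1%:R^-1)%R%:E)).
    + apply: nearW => n; rewrite phi0/=.
      apply: (le_trans (ge_part n w s (ltW s0) Us)).
      (* From [exp x >= 1 + x], the bound [exp(-(b + n + 1) s)] is at most [1 / (s (n + 1))]. *)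
      rewrite -EFinM -EFinN/= lee_fin expRN -invfM lef_pV2 ?posrE ?expR_gt0 ?mulr_gt0//.
      apply: (@le_trans _ _ (1 + (b + n.+1%:R) * s)%R); last exact: expR_ge1Dx.
      rewrite mulrDl mulrC addrA lerDr addr_ge0// mulr_ge0// ltW//.
    + exact: cvg_cst.
    + apply: cvg_EFin; first exact: nearW.
      by rewrite -(mulr0 s^-1%R); apply: cvgMr; exact: cvg_harmonic.
have intphi : \int[P y]_w phi n w @[n --> \oo] --> 0.
  have [|||||_ _] := @dominated_convergence _ _ _ (P y) setT measurableT phi (cst 0) (cst 1).
  - exact: mphi.
  - exact: measurable_cst.
  - by move: aecvg; apply: ae_mono.
  - exact: finite_measure_integrable_cst.
  - by apply/aeW => w n _; rewrite gee0_abs.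
  by rewrite integral0.
(* In the fixed point equation of index [b + n.+1], the source is at most [1 + (n.+1 / b) 1_{~U}],
   since [f <= 1] and [pen <= 1/b]. *)
have bound n : 0 <= pen n.+1%:R y <= n.+1%:R^-1%:E + b^-1%:E * \int[P y]_w phi n w.
  have n0 : (0 < n.+1%:R :> R)%R by [].
  have pen0 := pen_ge0 hlc hsep hX b mf f0 mU n0.
  have mpen := measurable_pen hlc hsep hX b mf f0 mU n0.
  rewrite pen0/= penE//.
  have mc : measurable_fun setT (fun z : borel ED => (n.+1%:R / b)%:E * iC z).
    exact: emeasurable_funM.
  have c0 z : 0 <= (n.+1%:R / b)%:E * iC z by apply: mule_ge0 => //; rewrite lee_fin divr_ge0// ltW.
  apply: (@le_trans _ _ (res (b + n.+1%:R) (fun z => cst 1 z + (n.+1%:R / b)%:E * iC z) y)).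
    apply: (res_le hlc hsep hX).
    - apply: emeasurable_funD => //; apply: emeasurable_funM => //.
      exact: emeasurable_funM.
    - by move=> z; rewrite adde_ge0// !mule_ge0// lee_fin.
    - exact: emeasurable_funD.
    - by move=> z; rewrite adde_ge0// c0.
    - move=> z; apply: leeD => //; rewrite EFinM -muleA lee_wpmul2l ?lee_fin//.
      by rewrite muleC lee_wpmul2r// pen_bound.
  rewrite (res_add hlc hsep hX)//; apply: leeD.
    apply: (le_trans (res_bound hlc hsep hX (measurable_cst _) _ y (bn0 n) (c := 1%R) _)) => //.
    by rewrite lee_fin mul1r lef_pV2 ?posrE// lerDr ltW.
  rewrite (res_scale hlc hsep hX)//; last by rewrite divr_ge0// ltW.
  rewrite (res_path hlc hsep hX)// mulrC EFinM -muleA lee_wpmul2l ?lee_fin ?invr_ge0 ?(ltW b0)//.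
  rewrite -ge0_integralZl//.
  - apply: (@measurable_fun_fubini_tonelli_G _ _ _ _ _ leb (fun p : R * W =>
      (expw (b + n.+1%:R) p.1)%:E * iC (Xpos p.1 p.2))).
      apply: emeasurable_funM.
        by apply/measurable_EFinP; apply: measurableT_comp => //; exact: measurable_expw.
      exact: (measurable_comp_process hlc hsep hX miC).
    by move=> p; rewrite mule_ge0 ?lee_fin ?expw_ge0.
  - by move=> w _; apply: integral_ge0 => t _; rewrite mule_ge0 ?lee_fin ?expw_ge0.
apply: (@squeeze_cvge _ _ _ _ (cst 0) _
  (fun n => n.+1%:R^-1%:E + b^-1%:E * \int[P y]_w phi n w)).
- exact: nearW.
- exact: cvg_cst.
- rewrite -[X in _ --> X]add0e; apply: cvgeD => //.
    by apply: cvg_EFin; [exact: nearW|exact: cvg_harmonic].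
  by rewrite -[X in _ --> X](mule0 (b^-1)%:E); apply: cvgeZl.
Qed.

(* As k grows, the penalized process does not survive a time at which X lies in
   the open set U. *)
Lemma limn_esup_pen sigma x : stopping_time X sigma ->
  (forall w, sigma w < +oo -> U (at_time X (sigma w) w)) ->
  limn_esup (fun n => pen n.+1%:R x) <= killed_res sigma b f x.
Proof.
move=> hs hU.
pose e n := \int[P x]_w (expeR (- (b%:E * sigma w)) * pen n.+1%:R (at_time X (sigma w) w)).
have n0 n : (0 < n.+1%:R :> R)%R by [].
have e0 : e n @[n --> \oo] --> 0.
  have -> : 0 = \int[P x]_w (cst 0 w) by rewrite integral0.
  apply: (ge0_bounded_convergence (M := b^-1)).
  - move=> n; apply: emeasurable_funM.
      apply: measurableT_comp; first exact: measurable_expeR.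
      apply: measurableT_comp => //; apply: emeasurable_funM => //.
      exact: (measurable_stopping_time hX hs).
    apply: (measurableT_comp (measurable_pen hlc hsep hX b mf f0 mU (n0 n))).
    exact: (measurable_at_stopping_time hlc hsep hX hs).
  - move=> n w; have pen0 := pen_ge0 hlc hsep hX b mf f0 mU (n0 n).
    rewrite mule_ge0 ?expeR_ge0//= -[leRHS]mul1e; apply: lee_pmul => //.
    + exact: expeR_ge0.
    + rewrite -expeR0 lee_expeR oppe_le0 mule_ge0 ?lee_fin ?(ltW b0)//.
      exact: (stopping_time_ge0 hs).
    + exact: pen_bound.
  - move=> w; have := stopping_time_ge0 hs w; have := hU w.
    case: (sigma w) => [s| |]// hs' s0.
      rewrite /= -[X in _ --> X](mule0 (expeR (- (b%:E * s%:E)))).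
      by apply: cvgeZl => //; apply: pen_vanish; apply: hs'; rewrite ltry.
    rewrite gt0_muley ?lte_fin//=; apply: cvg_near_cst; apply: nearW => n.
    by rewrite mul0e.
apply: (@limn_esup_le_lim _ _ (fun n => killed_res sigma b f x + e n)).
  by move=> n; exact: pen_le_killed.
rewrite -[X in _ --> X]adde0; apply: cvgeD => //; last exact: cvg_cst.
by rewrite fin_num_adde_defl.
Qed.

End penalized_killed.

(** * Penalized potentials as elements of the domain *)

Section penalized_variational.
Context {R : realType} {E : pointedMetricType R}.
Hypothesis hlc : locally_compact [set: E].
Hypothesis hsep : separable_space E.
Notation ED := (cemetery_ext E).
Context {d : measure_display} {W : measurableType d}.
Variables (X : R -> W -> ED) (P : ED -> probability W R).
Hypothesis hX : hunt_process X P.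
Variables (mu : {measure set (borel E) -> \bar R}) (F : set (E -> R))
  (Ef : (E -> R) -> (E -> R) -> R) (beta0 : R).
Hypotheses (hform : lower_bounded_semi_dirichlet_form mu F Ef beta0)
  (hsym : form_symmetric F Ef) (hassoc : associated_with X P mu F Ef beta0).
Notation sc := (scalar2 mu).

Let nfS := sqint_nonneg_form mu.

Lemma resolvent_green l (g : E -> R) x :
  resolvent X P l g x = green X P l (EFin \o ext0 g) (Some x).
Proof.
rewrite /resolvent integral_expw_itv; apply: eq_integral => t _.
have [t0|t0] := leP 0 t; last by rewrite expw_neg// !mul0e.
congr (_ * _)%E; rewrite /semigroup; apply: eq_integral => w _.
by rewrite /= /Xpos max_l.
Qed.

Let ext0_ge0 (g : E -> R) : (forall x, 0 <= g x) ->
  forall y : borel ED, (0 <= (EFin \o ext0 g) y)%E.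
Proof. by move=> g0 [x|]; rewrite /= lee_fin. Qed.

Let ext0_meas (g : E -> R) : measurable_fun setT (g : borel E -> R) ->
  measurable_fun setT (EFin \o ext0 g : borel ED -> \bar R).
Proof. by move=> mg; apply/measurable_EFinP; exact: measurable_ext0. Qed.

(** The association provides the resolvent only up to a null set; the probabilistic potential is a
    Borel representative of it. The norm bound follows from [(l - beta0) <v, v> <= <g, v>] and
    Cauchy-Schwarz. *)
Lemma green_in_domain l (g : E -> R) : beta0 < l -> (forall x, 0 <= g x) ->
  sqint mu g ->
  let v x := fine (green X P l (EFin \o ext0 g) (Some x)) in
  [/\ F v, forall h, F h -> form_beta mu Ef l v h = sc g h &
      (l - beta0) ^+ 2 * sc v v <= sc g g].
Proof.
move=> bl g0 g2 v.
have mg := sqint_measurable g2.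
have [u [Fu uae uh]] := hassoc bl g2.
have uv : {ae mu, forall x, u x = v x}.
  by move: uae; apply: ae_mono => x h; rewrite /v -resolvent_green -h.
have mv : measurable_fun setT (v : borel E -> R).
  apply: measurableT_comp => //.
  apply: (@measurableT_comp _ _ _ _ _ _ (green X P l (EFin \o ext0 g) : borel ED -> \bar R)).
    by apply: (measurable_res hlc hsep hX); [exact: ext0_meas|exact: ext0_ge0].
  exact: measurable_Some.
have v2 : sqint mu v by apply: sqint_ae uv (domain_sqint hform Fu).
have Fv : F v by exact: (lbsd_dom_ae hform Fu v2 uv).
have vh h : F h -> form_beta mu Ef l v h = sc g h.
  move=> Fh; rewrite -uh//; apply: (form_beta_ae _ hform) => //.
    by move: uv; apply: ae_mono => x ->.
  exact: aeW.
split => //.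
have h1 := form_beta_lower l hform Fv; rewrite vh// in h1.
have h2 := nf_cauchy_schwarz nfS g2 v2.
have v0 := nf_ge0 nfS v2; have gg0 := nf_ge0 nfS g2.
move: v0; rewrite le_eqVlt => /orP[/eqP <-|v0]; first by rewrite mulr0.
rewrite -(ler_pM2r v0); apply: le_trans h2.
have h3 : 0 <= (l - beta0) * sc v v by rewrite mulr_ge0 ?(ltW v0)// subr_ge0 ltW.
have -> : (l - beta0) ^+ 2 * sc v v * sc v v = ((l - beta0) * sc v v) ^+ 2 by ring.
by rewrite lerXn2r// nnegrE// (le_trans h3).
Qed.

Local Opaque green pen.

Variables (fr : E -> R) (U : set (borel ED)) (b k : R).
Hypotheses (fr2 : sqint mu fr) (fr01 : forall x, 0 <= fr x <= 1)
  (oU : open (U : set ED)) (UN : U None) (bb : beta0 < b) (k0 : 0 < k).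

Let f : borel ED -> \bar R := EFin \o ext0 fr.
Let uU (x : E) : R := \1_U (Some x : borel ED).
Let uC (x : E) : R := \1_(~` U) (Some x : borel ED).

Let mU : measurable U. Proof. exact: sub_sigma_algebra. Qed.
Let mf : measurable_fun setT f. Proof. exact: ext0_meas (sqint_measurable fr2). Qed.
Let f0 y : (0 <= f y)%E.
Proof. by apply: ext0_ge0 => x; have /andP[] := fr01 x. Qed.
Let f1 y : (f y <= 1)%E.
Proof. by case: y => [x|]; rewrite /f /= lee_fin//; have /andP[] := fr01 x. Qed.
Let b0 : 0 < b. Proof. exact: beta_gt0 hform bb. Qed.
Let bk : beta0 < b + k. Proof. by rewrite (lt_trans bb)// ltrDl. Qed.

Let uC01 x : 0 <= uC x <= 1.
Proof. by rewrite /uC indicE ler0n lern1 leq_b1. Qed.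

Let muC : measurable_fun setT (uC : borel E -> R).
Proof.
apply: (@measurableT_comp _ _ _ _ _ _ (\1_(~` U) : borel ED -> R)).
  by apply: measurable_indic; exact: measurableC.
exact: measurable_Some.
Qed.

Let uUC x : uU x = 1 - uC x.
Proof.
rewrite /uU /uC !indicE; have [Ux|Ux] := pselect (U (Some x)).
  by rewrite mem_set// memNset ?subr0//; exact.
by rewrite memNset// mem_set// subrr.
Qed.

(** As [U] contains the cemetery, the source vanishes there; it is the extension by 0 of a function
    on [E], to which the form can be applied. *)
Let src (v : ED -> \bar R) : (forall y, v y \is a fin_num) ->
  pen_source f U k v = EFin \o ext0 (fun x => fr x + k * (uC x * fine (v (Some x)))).
Proof.
move=> vfin; apply/funext => -[x|]; rewrite /pen_source /f /=.
  by rewrite -[v _]fineK//= -!EFinM -EFinD.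
by rewrite indicE memNset ?mul0e ?mule0 ?adde0//; exact.
Qed.

Let uCv2 (v : E -> R) : sqint mu v -> sqint mu (fun x => uC x * v x).
Proof.
move=> v2; apply: sqint_le (v2).
  by apply: measurable_funM => //; exact: (sqint_measurable v2).
move=> x; have /andP[c0 c1] := uC01 x.
by rewrite normrM (ger0_norm c0) -[leRHS]mul1r ler_wpM2r.
Qed.

Let gv2 (v : E -> R) : sqint mu v -> sqint mu (fun x => fr x + k * (uC x * v x)).
Proof.
move=> v2; have := nf_comb nfS 1 k fr2 (uCv2 v2).
by congr (sqint _ _); apply/funext => x; rewrite mul1r.
Qed.

(** A bound preserved by the iteration. If the squared norm of [v] is at most [B], the source built
    from [v] has norm at most [b + k - beta0] times the square root of [B], and the resolvent of
    index [b + k] divides the norm by this factor. *)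
Let B := sc fr fr / (b - beta0) ^+ 2.

Let bb0 : 0 < b - beta0. Proof. by rewrite subr_gt0. Qed.

Let gv_bound (v : E -> R) : sqint mu v -> (forall x, 0 <= v x) -> sc v v <= B ->
  sc (fun x => fr x + k * (uC x * v x)) (fun x => fr x + k * (uC x * v x)) <=
  (b + k - beta0) ^+ 2 * B.
Proof.
move=> v2 v0 vB.
have c2 := uCv2 v2.
have -> : (fun x => fr x + k * (uC x * v x)) = (fun x => 1 * fr x + k * (uC x * v x)).
  by apply/funext => x; rewrite mul1r.
rewrite (nf_comb2 nfS)//.
have cc : sc (fun x => uC x * v x) (fun x => uC x * v x) <= B.
  apply: le_trans vB; rewrite -lee_fin -!sqint_sqr//; apply: ge0_le_integral => //.
  - by move=> x _; rewrite lee_fin sqr_ge0.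
  - by apply/measurable_EFinP; apply: measurable_funX; exact: (sqint_measurable c2).
  - by apply/measurable_EFinP; apply: measurable_funX; exact: (sqint_measurable v2).
  - move=> x _; have /andP[c0 c1] := uC01 x.
    by rewrite lee_fin lerXn2r ?nnegrE ?mulr_ge0// -[leRHS]mul1r ler_wpM2r.
have ffE : sc fr fr = (b - beta0) ^+ 2 * B.
  by rewrite /B mulrC divfK// expf_neq0// gt_eqF.
have B0 : 0 <= B by rewrite (le_trans (nf_ge0 nfS v2)).
have fc : sc fr (fun x => uC x * v x) <= (b - beta0) * B.
  have := nf_cauchy_schwarz nfS fr2 c2; rewrite ffE => h.
  have : (sc fr (fun x => uC x * v x)) ^+ 2 <= ((b - beta0) * B) ^+ 2.
    apply: (le_trans h); rewrite exprMn -mulrA ler_wpM2l ?sqr_ge0//.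
    by rewrite expr2 ler_wpM2l.
  have s0 : 0 <= sc fr (fun x => uC x * v x).
    apply: scalar2_ge0 => x; first by have /andP[] := fr01 x.
    by rewrite mulr_ge0//; have /andP[] := uC01 x.
  have t0 : 0 <= (b - beta0) * B by rewrite mulr_ge0// ltW.
  by rewrite ler_pXn2r.
have h1 : k * sc fr (fun x => uC x * v x) <= k * ((b - beta0) * B).
  by rewrite ler_wpM2l// ltW.
have h2 : k ^+ 2 * sc (fun x => uC x * v x) (fun x => uC x * v x) <= k ^+ 2 * B.
  by rewrite ler_wpM2l// sqr_ge0.
have -> : (b + k - beta0) ^+ 2 * B =
    (b - beta0) ^+ 2 * B + 2 * (k * ((b - beta0) * B)) + k ^+ 2 * B by ring.
rewrite ffE; lra.
Qed.

Let pj j x := fine (pen_seq X P f U b k j (Some x)).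

Let pj_fin j y : pen_seq X P f U b k j y \is a fin_num.
Proof.
rewrite ge0_fin_numE; last exact: pen_seq_ge0.
by rewrite (le_lt_trans (pen_seq_bound hlc hsep hX mf f0 f1 mU b0 k0 j y))// ltry.
Qed.

Let pj0 j x : 0 <= pj j x. Proof. by rewrite fine_ge0// pen_seq_ge0. Qed.

Let pjS j x : pj j.+1 x = fine (green X P (b + k)
  (EFin \o ext0 (fun x => fr x + k * (uC x * pj j x))) (Some x)).
Proof. by rewrite /pj /= src. Qed.

Let pj_sqint j : sqint mu (pj j) /\ sc (pj j) (pj j) <= B.
Proof.
have B0 : 0 <= B by rewrite divr_ge0 ?sqr_ge0// (nf_ge0 nfS).
elim: j => [|j [ih1 ih2]].
  have -> : pj 0 = (fun=> 0) by apply/funext => x.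
  split; first exact: (nf_zero nfS).
  by rewrite (nf_form0l nfS)//; exact: (nf_zero nfS).
have -> : pj j.+1 = (fun x => fine (green X P (b + k)
  (EFin \o ext0 (fun x => fr x + k * (uC x * pj j x))) (Some x))).
  by apply/funext => x; rewrite pjS.
have g0 x : 0 <= fr x + k * (uC x * pj j x).
  rewrite addr_ge0//; first by have /andP[] := fr01 x.
  by rewrite mulr_ge0 ?(ltW k0)// mulr_ge0//; have /andP[] := uC01 x.
have [Fv _ h] := green_in_domain bk g0 (gv2 ih1).
split; first exact: domain_sqint hform _ Fv.
have := le_trans h (gv_bound ih1 (@pj0 j) ih2).
by rewrite ler_pM2l// exprn_gt0// subr_gt0.
Qed.

Definition penr (x : E) : R := fine (pen X P f U b k (Some x)).

Let pen_fin y : pen X P f U b k y \is a fin_num.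
Proof.
rewrite ge0_fin_numE; last exact: (pen_ge0 hlc hsep hX).
by rewrite (le_lt_trans (pen_bound hlc hsep hX mf f0 f1 mU b0 k0 y))// ltry.
Qed.

Lemma penrE x : (penr x)%:E = pen X P f U b k (Some x).
Proof. by rewrite fineK. Qed.

Lemma penr_bound x : 0 <= penr x <= b^-1.
Proof.
by rewrite -!lee_fin penrE (pen_ge0 hlc hsep hX)//= (pen_bound hlc hsep hX).
Qed.

Lemma measurable_penr : measurable_fun setT (penr : borel E -> R).
Proof.
apply: measurableT_comp => //.
apply: (@measurableT_comp _ _ _ _ _ _ (pen X P f U b k : borel ED -> \bar R)).
  exact: (measurable_pen hlc hsep hX).
exact: measurable_Some.
Qed.

Let penr_sqint : sqint mu penr.
Proof.
apply: sqintP; first exact: measurable_penr.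
have cv : (\int[mu]_x (pj j x ^+ 2)%:E @[j --> \oo] --> \int[mu]_x (penr x ^+ 2)%:E)%E.
  apply: ge0_nondecreasing_cvg_integral => //.
  - move=> j; apply/measurable_EFinP; apply: measurable_funX.
    exact: (sqint_measurable (pj_sqint j).1).
  - by move=> j x _; rewrite lee_fin sqr_ge0.
  - move=> x _ i j ij; rewrite lee_fin lerXn2r ?nnegrE//.
    by rewrite fine_le//; exact: (pen_seq_nd hlc hsep hX).
  - move=> x _; apply: cvg_EFin; first exact: nearW.
    have h : pj j x @[j --> \oo] --> penr x.
      by apply: fine_cvg; rewrite penrE; exact: (cvg_pen hlc hsep hX).
    by have := cvgM h h; exact.
apply: (@le_lt_trans _ _ B%:E); last by rewrite ltry.
rewrite -(cvg_lim _ cv)//; apply: lime_le; first exact: cvgP cv.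
apply: nearW => j; have [j2 jB] := pj_sqint j.
by rewrite sqint_sqr// lee_fin.
Qed.

Let penr_green : penr = (fun x => fine (green X P (b + k)
  (EFin \o ext0 (fun x => fr x + k * (uC x * penr x))) (Some x))).
Proof.
have e : pen_source f U k (pen X P f U b k) =
    EFin \o ext0 (fun x => fr x + k * (uC x * penr x)) := src pen_fin.
apply/funext => x; have h := penE hlc hsep hX b mf f0 mU k0 (Some x).
by rewrite e in h; rewrite -h.
Qed.

Lemma penr_domain : F penr.
Proof.
rewrite penr_green.
have g0 x : 0 <= fr x + k * (uC x * penr x).
  rewrite addr_ge0//; first by have /andP[] := fr01 x.
  apply: mulr_ge0; first exact: ltW.
  by apply: mulr_ge0; [have /andP[] := uC01 x|have /andP[] := penr_bound x].
by have [] := green_in_domain bk g0 (gv2 penr_sqint).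
Qed.

(** The fixed point equation gives [Q penr h = <fr + k 1_{~U} penr, h>] for the form of index
    [b + k]. Moving [k <penr, h>] across leaves the penalty on [U] only. *)
Lemma penr_variational h : F h ->
  form_beta mu Ef b penr h + k * sc (fun x => uU x * penr x) h = sc fr h.
Proof.
move=> Fh.
have g0 x : 0 <= fr x + k * (uC x * penr x).
  rewrite addr_ge0//; first by have /andP[] := fr01 x.
  apply: mulr_ge0; first exact: ltW.
  by apply: mulr_ge0; [have /andP[] := uC01 x|have /andP[] := penr_bound x].
have [_ hv _] := green_in_domain bk g0 (gv2 penr_sqint).
have h2 := domain_sqint hform Fh.
have := hv h Fh; rewrite -penr_green /form_beta.
have -> : sc (fun x => fr x + k * (uC x * penr x)) h =
    sc fr h + k * sc (fun x => uC x * penr x) h.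
  have := nf_combl nfS 1 k fr2 (uCv2 penr_sqint) h2.
  by rewrite mul1r => <-; congr (sc _ h); apply/funext => x; rewrite mul1r.
have -> : (fun x => uU x * penr x) = (fun x => penr x - uC x * penr x).
  by apply/funext => x; rewrite uUC mulrBl mul1r.
rewrite (nf_subl nfS penr_sqint (uCv2 penr_sqint) h2).
lra.
Qed.

End penalized_variational.

Lemma cvg0_of_sqr_le {R : realType} (x y : nat -> R) (C : R) :
  (forall n, x n ^+ 2 <= C * y n) -> y n @[n --> \oo] --> 0 -> x n @[n --> \oo] --> 0.
Proof.
move=> xy y0.
have h : x n ^+ 2 @[n --> \oo] --> 0.
  apply: (@squeeze_cvgr _ _ _ _ (cst 0) (fun n => C * y n)).
  - by apply: nearW => n; rewrite sqr_ge0 xy.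
  - by apply: cvg_near_cst; apply: nearW.
  - by rewrite -(mulr0 C); apply: cvgMr.
apply/cvgrPdist_lt => e e0.
have /cvgrPdist_lt/(_ _ (exprn_gt0 2 e0))[N _ hN] := h.
exists N => // n Nn; have := hN n Nn; rewrite /= !sub0r !normrN normrX.
by rewrite ltr_pXn2r// nnegrE ltW.
Qed.

Section nonneg_form_limits.
Context {R : realType} {T : Type}.
Variables (S : set (T -> R)) (B : (T -> R) -> (T -> R) -> R).
Hypothesis nf : nonneg_form S B.

Lemma nf_cvg_right (g : nat -> T -> R) f h : S f -> S h -> (forall n, S (g n)) ->
  B (fun x => g n x - f x) (fun x => g n x - f x) @[n --> \oo] --> 0 ->
  B h (g n) @[n --> \oo] --> B h f.
Proof.
move=> Sf Sh Sg cg.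
have h0 : B h (fun x => g n x - f x) @[n --> \oo] --> 0.
  apply: (cvg0_of_sqr_le (C := B h h) _ cg) => n.
  by apply: (nf_cauchy_schwarz nf) => //; exact: (nf_sub nf).
have e n : B h (g n) = B h (fun x => g n x - f x) + B h f.
  have := nf_subl nf (Sg n) Sf Sh.
  by rewrite (nf_sym nf (nf_sub nf (Sg n) Sf) Sh) (nf_sym nf (Sg n) Sh)
    (nf_sym nf Sf Sh) => ->; rewrite subrK.
have h1 : B h (fun x => g n x - f x) + B h f @[n --> \oo] --> 0 + B h f.
  by apply: cvgD => //; exact: cvg_cst.
by rewrite add0r in h1; move: h1; under eq_fun do rewrite -e.
Qed.

Lemma nf_cvg_diag (g : nat -> T -> R) f : S f -> (forall n, S (g n)) ->
  B (fun x => g n x - f x) (fun x => g n x - f x) @[n --> \oo] --> 0 ->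
  B (g n) (g n) @[n --> \oo] --> B f f.
Proof.
move=> Sf Sg cg; have h := nf_cvg_right Sf Sf Sg cg.
have e n : B (g n) (g n) = B (fun x => g n x - f x) (fun x => g n x - f x) +
    (2 * B f (g n) - B f f).
  by rewrite (nf_sub2 nf)// (nf_sym nf (Sg n) Sf); ring.
have h1 : B (fun x => g n x - f x) (fun x => g n x - f x) +
    (2 * B f (g n) - B f f) @[n --> \oo] --> 0 + (2 * B f f - B f f).
  by apply: cvgD => //; apply: cvgB; [apply: cvgMr|exact: cvg_cst].
rewrite (_ : 0 + _ = B f f) in h1; last by ring.
by move: h1; under eq_fun do rewrite -e.
Qed.

End nonneg_form_limits.

(** * The limit of growing penalties *)

Section penalization_limit.
Context {R : realType} {E : pointedMetricType R}.
Variables (mu : {measure set (borel E) -> \bar R}) (F : set (E -> R))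
  (Ef : (E -> R) -> (E -> R) -> R) (beta0 beta : R).
Hypotheses (hform : lower_bounded_semi_dirichlet_form mu F Ef beta0)
  (hsym : form_symmetric F Ef) (hbeta : beta0 < beta).
Notation Q := (form_beta mu Ef beta).
Notation sc := (scalar2 mu).

Let nfQ := form_beta_nonneg_form hform hsym hbeta.
Let nfS := sqint_nonneg_form mu.

Lemma form_cvg_sqint (g : nat -> E -> R) f : F f -> (forall n, F (g n)) ->
  Q (fun x => g n x - f x) (fun x => g n x - f x) @[n --> \oo] --> 0 ->
  sc (fun x => g n x - f x) (fun x => g n x - f x) @[n --> \oo] --> 0.
Proof.
move=> Ff Fg cg.
have c0 : 0 < beta - beta0 by rewrite subr_gt0.
apply: (@squeeze_cvgr _ _ _ _ (cst 0)
  (fun n => (beta - beta0)^-1 * Q (fun x => g n x - f x) (fun x => g n x - f x))).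
- apply: nearW => n; have Fd := nf_sub nfQ (Fg n) Ff.
  have d2 := domain_sqint hform Fd; rewrite (nf_ge0 nfS)//=.
  by rewrite mulrC ler_pdivlMr// mulrC; exact: (form_beta_lower _ hform).
- by apply: cvg_near_cst; apply: nearW.
- by rewrite -(mulr0 (beta - beta0)^-1); apply: cvgMr.
Qed.

(** By Fatou's lemma the limit inferior of [(g n x - f x)^2] has integral 0, so almost every [f x]
    is a cluster value of [g n x]. The bounds are quantified inside the almost-everywhere statement
    and may depend on [x]. *)
Lemma sqint_cvg_liminf (g : nat -> E -> R) f : sqint mu f -> (forall n, sqint mu (g n)) ->
  sc (fun x => g n x - f x) (fun x => g n x - f x) @[n --> \oo] --> 0 ->
  {ae mu, forall x, forall a b : R, (forall n, a <= g n x <= b) -> a <= f x <= b}.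
Proof.
move=> f2 g2 cg.
have gf2 n : sqint mu (fun x => g n x - f x) by exact: (nf_sub nfS).
pose L (x : borel E) := limn_einf (fun n => ((g n x - f x) ^+ 2)%:E).
have mgf n : measurable_fun setT (fun x : borel E => ((g n x - f x) ^+ 2)%:E).
  by apply/measurable_EFinP; apply: measurable_funX; exact: (sqint_measurable (gf2 n)).
have mL : measurable_fun setT L.
  rewrite (_ : L = (fun x => - limn_esup (fun n => - ((g n x - f x) ^+ 2)%:E))%E); last first.
    apply/funext => x; rewrite -limn_einfN /L.
    rewrite (_ : -%E \o _ = fun n => ((g n x - f x) ^+ 2)%:E)//.
    by apply/funext => n; rewrite /comp oppeK.
  apply: measurableT_comp => //; apply: measurable_fun_limn_esup => n.
  exact: measurableT_comp.
have L0 x : (0 <= L x)%E.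
  rewrite /L limn_einf_lim; apply: lime_ge; first exact: is_cvg_einfs.
  apply: nearW => n; apply: le_ereal_inf_tmp => _ [m _ <-].
  by rewrite lee_fin sqr_ge0.
have Lint : (\int[mu]_x L x = 0)%E.
  apply/le_anti; rewrite integral_ge0 ?andbT//.
  apply: (le_trans (fatou mu measurableT mgf _)).
    by move=> n x _; rewrite lee_fin sqr_ge0.
  have cv : (\int[mu]_x ((g n x - f x) ^+ 2)%:E @[n --> \oo] --> 0)%E.
    under eq_fun do rewrite (sqint_sqr (gf2 _)).
    by apply: cvg_EFin; [exact: nearW|exact: cg].
  by rewrite (cvg_limn_einf_sup cv).1.
have : (\int[mu]_x `|L x| = 0)%E.
  by under eq_integral => x _ do rewrite gee0_abs//.
move/(ae_eq_integral_abs mu measurableT mL); apply: ae_mono => x /(_ I) Lx a b gab.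
have small (e : R) : 0 < e -> exists n, (g n x - f x) ^+ 2 < e.
  move=> e0; apply: contrapT => hn.
  have : (e%:E <= L x)%E.
    rewrite /L limn_einf_lim; apply: lime_ge; first exact: is_cvg_einfs.
    apply: nearW => n; apply: le_ereal_inf_tmp => _ [m _ <-].
    rewrite lee_fin leNgt; apply/negP => h; apply: hn; by exists m.
  by rewrite Lx lee_fin leNgt e0.
apply/andP; split; rewrite leNgt; apply/negP => h.
- have [n] := small ((a - f x) ^+ 2) ltac:(by rewrite exprn_gt0// subr_gt0).
  rewrite ltNge => /negP; apply; have /andP[ga _] := gab n.
  by rewrite ler_pXn2r// ?nnegrE ?subr_ge0 ?lerB// ltW// (lt_le_trans h).
- have [n] := small ((f x - b) ^+ 2) ltac:(by rewrite exprn_gt0// subr_gt0).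
  rewrite ltNge => /negP; apply; have /andP[_ gb] := gab n.
  rewrite -[leRHS]sqrrN opprB.
  by rewrite ler_pXn2r// ?nnegrE ?subr_ge0 ?lerB// ltW// (le_lt_trans gb).
Qed.

Variables (f chi : E -> R) (v : nat -> E -> R) (kap : nat -> R).
Hypotheses (f2 : sqint mu f) (f0 : forall x, 0 <= f x)
  (mchi : measurable_fun setT (chi : borel E -> R))
  (chi01 : forall x, chi x = 0 \/ chi x = 1)
  (Fv : forall n, F (v n)) (v0 : forall n x, 0 <= v n x)
  (kapE : forall n, kap n = n.+1%:R)
  (hv : forall n h, F h -> Q (v n) h + kap n * sc (fun x => chi x * v n x) h = sc f h).

Let p g h := sc (fun x => chi x * g x) h.

Let chi2 (g : E -> R) : sqint mu g -> sqint mu (fun x => chi x * g x).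
Proof.
move=> g2; apply: sqint_le (g2).
  by apply: measurable_funM => //; exact: (sqint_measurable g2).
by move=> x; case: (chi01 x) => ->; rewrite ?mul0r ?normr0 ?mul1r.
Qed.

Let p_chi g h : p g h = sc (fun x => chi x * g x) (fun x => chi x * h x).
Proof.
apply: eq_Rintegral => x _.
by case: (chi01 x) => ->; rewrite ?mul0r ?mul1r.
Qed.

Let nfp : nonneg_form (sqint mu) p.
Proof.
split.
- exact: (nf_lin nfS).
- exact: (nf_zero nfS).
- move=> a g h l g2 h2 l2; rewrite /p -(nf_linl nfS a (chi2 g2) (chi2 h2) l2).
  by congr (sc _ l); apply/funext => x; ring.
- by move=> g h g2 h2; rewrite !p_chi (nf_sym nfS)//; exact: chi2.
- by move=> g g2; rewrite p_chi (nf_ge0 nfS)//; exact: chi2.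
Qed.

Let p_le_sc g : sqint mu g -> p g g <= sc g g.
Proof.
move=> g2; have g2' := chi2 g2; rewrite p_chi -lee_fin -!sqint_sqr//; apply: ge0_le_integral => //.
- by move=> x _; rewrite lee_fin sqr_ge0.
- by apply/measurable_EFinP; apply: measurable_funX; exact: (sqint_measurable (chi2 g2)).
- by apply/measurable_EFinP; apply: measurable_funX; exact: (sqint_measurable g2).
- move=> x _; rewrite lee_fin.
  by case: (chi01 x) => ->; rewrite ?mul0r ?mul1r// expr0n sqr_ge0.
Qed.

Let s n := sc f (v n).

Let v2 n : sqint mu (v n) := domain_sqint hform (Fv n).

Let s0 n : 0 <= s n. Proof. exact: scalar2_ge0. Qed.

Let kap_le n m : (n <= m)%N -> kap n <= kap m.
Proof. by move=> nm; rewrite !kapE ler_nat. Qed.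

Let kap0 n : 0 < kap n. Proof. by rewrite kapE. Qed.

(* v n minimizes Q v v + kap n <chi v, v> - 2 <f, v>; the increments of the
   minima control the energy of v m - v n. *)
Let vv n m : (n <= m)%N ->
  Q (fun x => v m x - v n x) (fun x => v m x - v n x) <= s n - s m.
Proof.
move=> nm; rewrite (nf_sub2 nfQ)//.
have h1 : Q (v n) (v n) + kap n * p (v n) (v n) = s n by exact: hv.
have h2 : Q (v m) (v m) + kap m * p (v m) (v m) = s m by exact: hv.
have h3 : Q (v n) (v m) + kap n * p (v n) (v m) = s m by exact: hv.
have p0 : 0 <= kap n * p (fun x => v m x - v n x) (fun x => v m x - v n x).
  by rewrite mulr_ge0 ?(ltW (kap0 n))// (nf_ge0 nfp)//; exact: (nf_sub nfS).
rewrite (nf_sub2 nfp)// in p0.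
have pm : kap n * p (v m) (v m) <= kap m * p (v m) (v m).
  by rewrite ler_wpM2r ?kap_le// (nf_ge0 nfp).
have e1 := nf_sym nfQ (Fv m) (Fv n); have e2 := nf_sym nfp (v2 m) (v2 n).
rewrite e1; rewrite e2 in p0.
have : kap n * (p (v m) (v m) - 2 * p (v n) (v m) + p (v n) (v n)) =
  kap n * p (v m) (v m) - 2 * (kap n * p (v n) (v m)) + kap n * p (v n) (v n) by ring.
lra.
Qed.

Let s_dec n m : (n <= m)%N -> s m <= s n.
Proof.
move=> nm; rewrite -subr_ge0; apply: le_trans (vv nm).
by apply: (nf_ge0 nfQ); exact: (nf_sub nfQ).
Qed.

(** The pairings [<f, v n>] decrease and are nonnegative, so they converge and [v] is Cauchy in the
    form norm. The penalty term stays below [<f, v 0>] while its factor grows, so the limit vanishes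
    where [chi] is 1. Tested against [u], the equation of [v n] then loses its penalty. *)
Lemma penalization_limit : exists u, [/\ F u,
  Q (fun x => v n x - u x) (fun x => v n x - u x) @[n --> \oo] --> 0,
  {ae mu, forall x, chi x * u x = 0} & Q u u = sc f u].
Proof.
have cs : cvgn s.
  apply: nonincreasing_is_cvgn => [n m nm|]; first exact: s_dec.
  by exists 0 => _ [n _ <-].
have [e e0|u Fu hu] := form_beta_cauchy_cvg hform hsym hbeta Fv.
  have e2 : 0 < e / 2 by rewrite divr_gt0.
  have /cvgrPdist_lt/(_ _ e2)[N _ hN] := cs.
  have key m n : (N <= n)%N -> (n <= m)%N ->
      Q (fun x => v m x - v n x) (fun x => v m x - v n x) < e.
    move=> Nn nm; apply: (le_lt_trans (vv nm)).
    have := hN n Nn; have := hN m (leq_trans Nn nm) => /=.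
    have := ler_norm (limn s - s m); have := ler_norm (- (limn s - s n)).
    by rewrite normrN; lra.
  exists N => m n Nm Nn; have [nm|/ltnW mn] := leqP n m; first exact: key.
  have := key n m Nm mn; rewrite !(nf_sub2 nfQ)//.
  by rewrite (nf_sym nfQ (Fv n) (Fv m)); lra.
have cu : Q (fun x => v n x - u x) (fun x => v n x - u x) @[n --> \oo] --> 0.
  apply/cvgrPdist_lt => e e0; have [N hN] := hu e e0; exists N => // n Nn /=.
  by rewrite sub0r normrN ger0_norm ?hN//; apply: (nf_ge0 nfQ); exact: (nf_sub nfQ).
have u2 := domain_sqint hform Fu.
have cu2 := form_cvg_sqint Fu Fv cu.
have pu : p u u = 0.
  have cp : p (fun x => v n x - u x) (fun x => v n x - u x) @[n --> \oo] --> 0.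
    apply: (@squeeze_cvgr _ _ _ _ (cst 0) (fun n => sc (fun x => v n x - u x) (fun x => v n x - u x))) => //.
      apply: nearW => n; have d2 := nf_sub nfS (v2 n) u2.
      by rewrite (nf_ge0 nfp)//= p_le_sc.
    by apply: cvg_near_cst; apply: nearW.
  have h1 := nf_cvg_diag nfp u2 v2 cp.
  have h2 : p (v n) (v n) @[n --> \oo] --> 0.
    apply: (@squeeze_cvgr _ _ _ _ (cst 0) (fun n => s 0%N * n.+1%:R^-1)).
    - apply: nearW => n; rewrite (nf_ge0 nfp)//=.
      rewrite ler_pdivlMr// mulrC -kapE.
      have := hv n (Fv n); rewrite -/(p _ _) -/(s n) => h.
      have := nf_ge0 nfQ (Fv n); have := s_dec (leq0n n).
      by lra.
    - by apply: cvg_near_cst; apply: nearW.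
    - by rewrite -(mulr0 (s 0%N)); apply: cvgMr; exact: cvg_harmonic.
  exact: (cvg_unique _ h1 h2).
have chiu : {ae mu, forall x, chi x * u x = 0}.
  by apply: scalar2_eq0; [exact: chi2|rewrite -p_chi].
exists u; split => //.
have h1 := nf_cvg_right nfQ Fu Fu Fv cu.
have h2 : Q u (v n) @[n --> \oo] --> sc f u.
  apply: cvg_near_cst; apply: nearW => n.
  rewrite (nf_sym nfQ Fu (Fv n)) -(hv n Fu) -/(p _ _).
  suff -> : p (v n) u = 0 by rewrite mulr0 addr0.
  rewrite p_chi (scalar2_ae (f' := fun x => chi x * v n x) (g' := fun=> 0) (mu := mu)).
  - by rewrite (nf_sym nfS (chi2 (v2 n)) (nf_zero nfS)) (nf_form0l nfS)//; exact: chi2.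
  - exact: chi2.
  - exact: chi2.
  - exact: chi2.
  - exact: (nf_zero nfS).
  - exact: aeW.
  - exact: chiu.
exact: (cvg_unique _ h1 h2).
Qed.

End penalization_limit.

(** * Functions with compact support in the open set *)

Lemma closed_borel_measurable (T : ptopologicalType) (K : set T) :
  closed K -> measurable (K : set (borel T)).
Proof.
move=> cK; rewrite -(setCK K); apply: measurableC; apply: sub_sigma_algebra.
exact: closed_openC.
Qed.

Section part_approximation.
Context {R : realType} {E : pointedMetricType R}.
Variables (mu : {measure set (borel E) -> \bar R}) (F : set (E -> R))
  (Ef : (E -> R) -> (E -> R) -> R) (beta0 beta : R).
Hypotheses (hform : lower_bounded_semi_dirichlet_form mu F Ef beta0)
  (hsym : form_symmetric F Ef) (hreg : regular_form mu F Ef beta0)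
  (hbeta : beta0 < beta).
Notation Q := (form_beta mu Ef beta).
Notation sc := (scalar2 mu).

Let nfQ := form_beta_nonneg_form hform hsym hbeta.
Let nfS := sqint_nonneg_form mu.

Lemma scalar2_le_ae (f g : E -> R) : sqint mu f -> sqint mu g ->
  {ae mu, forall x, `|f x| <= `|g x|} -> sc f f <= sc g g.
Proof.
move=> f2 g2 fg; rewrite -lee_fin -!sqint_sqr//; apply: ae_ge0_le_integral => //.
- by move=> x _; rewrite lee_fin sqr_ge0.
- by apply/measurable_EFinP; apply: measurable_funX; exact: (sqint_measurable f2).
- by move=> x _; rewrite lee_fin sqr_ge0.
- by apply/measurable_EFinP; apply: measurable_funX; exact: (sqint_measurable g2).
- move: fg; apply: ae_mono => x fg _; rewrite lee_fin.
  by rewrite -(real_normK (num_real (f x))) -(real_normK (num_real (g x))) lerXn2r.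
Qed.

(** Regularity only gives a [g] in the domain within 1 of three times a cutoff, without control of
    its support. As [g >= 2] on [K] and [g <= 1] off [V], the function [(g - 1)^+] has the stated
    properties and stays in the domain. *)
Lemma form_cutoff (K V : set E) : compact K -> open V -> compact (closure V) ->
  K `<=` V -> exists phi : E -> R, [/\ F phi, continuous phi,
    forall x, 0 <= phi x, forall x, K x -> 1 <= phi x & forall x, ~ V x -> phi x = 0].
Proof.
move=> cK oV cV KV.
have [f [cf f01 fK fV]] := @compact_cutoff R E K V cK oV KV.
have Cf : @Cc R E (fun x => 3 * f x).
  split; first by move=> x; apply: cvgMr; exact: cf.
  apply: (subclosed_compact _ cV); first exact: closed_closure.
  apply: closure_subset => x /= fx; apply: contrapT => nV.
  by rewrite (fV _ nV) mulr0 eqxx in fx.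
have [g [Fg [cg _] fg]] := hreg.1 _ Cf 1 ltr01.
have [Fphi _] := cut_form hform hsym hbeta Fg ltr01.
exists (fun x => Num.max (g x - 1) 0); split => //.
- move=> x; apply: (@continuous_max _ _ (fun x => g x - 1) (cst 0)).
    by apply: cvgB; [exact: cg|exact: cvg_cst].
  exact: cvg_cst.
- by move=> x; rewrite le_max lexx orbT.
- move=> x Kx; have := fg x; rewrite (fK _ Kx) ler_distl => /andP[h1 h2].
  by rewrite le_max; apply/orP; left; lra.
- move=> x Vx; have := fg x; rewrite (fV _ Vx) mulr0 ler_distl => /andP[h1 h2].
  by apply/max_idPr; lra.
Qed.

(** Compact sets have finite measure because a cutoff in the domain, hence in L^2, dominates their
    indicator. *)
Lemma sqint_indic_compact (K : set E) : locally_compact [set: E] -> separable_space E ->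
  compact K -> sqint mu (fun x => \1_K x).
Proof.
move=> hlc hsep cK.
have [A [oA cA sA uA]] := open_exhaustion hlc hsep (@openT E).
have [n Kn] : exists n, K `<=` A n.
  by apply: (compact_sub_nondecreasing_cover cK oA (nested_nondecreasing sA)); rewrite uA.
have [phi [Fphi _ phi0 phi1 _]] := form_cutoff cK (oA n) (cA n) Kn.
apply: sqint_le (domain_sqint hform Fphi).
  apply: measurable_indic; apply: closed_borel_measurable.
  exact: compact_closed (@metric_hausdorff R E) cK.
move=> x; rewrite indicE; have [/set_mem Kx|_] := boolP (x \in K).
  by rewrite !ger0_norm ?phi0//; exact: phi1.
by rewrite normr0.
Qed.

Lemma capacity_ge0 b A : beta0 < b -> (0 <= capacity mu F Ef b A)%E.
Proof.
move=> hb; have nfb := form_beta_nonneg_form hform hsym hb.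
apply: le_ereal_inf_tmp => _ [U _ <-]; apply: le_ereal_inf_tmp => _ [f [Ff _] <-].
by rewrite lee_fin (nf_ge0 nfb).
Qed.

Lemma capacity_set0 b : beta0 < b -> capacity mu F Ef b set0 = 0%E.
Proof.
move=> hb; have nfb := form_beta_nonneg_form hform hsym hb.
apply/le_anti; rewrite capacity_ge0// andbT.
apply: (le_trans (ereal_inf_lbound _)); first by exists set0 => //; split => //; exact: open0.
apply: ereal_inf_lbound; exists (fun=> 0); last by rewrite (nf_form0l nfb)//; exact: (nf_zero nfb).
by split; [exact: (nf_zero nfb)|exact: aeW].
Qed.

Lemma continuous_dom_part (Om : set E) (g : E -> R) : F g -> continuous g ->
  (forall x, ~ Om x -> g x = 0) -> dom_part mu F Ef beta0 Om g.
Proof.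
move=> Fg cg gOm; split=> //; exists g; split; last 2 first.
- exact: aeW.
- move=> b hb; rewrite (_ : [set x | _] = set0) ?capacity_set0//.
  by rewrite -subset0 => x [nOm]; rewrite gOm.
- move=> b hb e e0; exists set0; split; first exact: open0.
  + by rewrite capacity_set0.
  + by rewrite setC0; apply/continuous_subspaceT.
Qed.

Variables (Om : set E) (V : (set E)^nat).
Hypotheses (hlc : locally_compact [set: E]) (hsep : separable_space E)
  (oV : forall n, open (V n)) (cV : forall n, compact (closure (V n)))
  (clV : forall n, closure (V n) `<=` V n.+1) (VOm : \bigcup_n V n = Om).

Let DV n : set (E -> R) := [set g | [/\ F g, continuous g, forall x, 0 <= g x &
  forall x, ~ V n.+1 x -> g x = 0]].

(** Regularity supplies a continuous [w] near [u], which is then truncated between 0 and [c phi].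
    This bounds its support, keeps its energy bounded and does not increase the L^2 distance to [u].
    Closure under midpoints upgrades the approximation to the form norm. *)
Let part_approx n (u : E -> R) c : F u -> 0 < c -> (forall x, 0 <= u x <= c) ->
  (forall x, ~ closure (V n) x -> u x = 0) -> forall e, 0 < e -> exists g, DV n g /\
  Q (fun x => g x - u x) (fun x => g x - u x) < e.
Proof.
move=> Fu c0 uc un e e0.
have [phi [Fphi cphi phi0 phi1 phiV]] := form_cutoff (@cV n) (oV n.+1) (@cV n.+1) (@clV n).
have Fc : F (fun x => c * phi x) by apply: (nf_scale nfQ).
(* The energy of [w] is at most [2 Q u u + 2]; the factors 6 and 4 are those of the bound for a
   minimum. *)
pose b := 6 * (2 * Q u u + 2) + 4 * Q (fun x => c * phi x) (fun x => c * phi x).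
suff [_ h] : F u /\ forall e, 0 < e -> exists v, [/\ DV n v, Q v v <= b &
    Q (fun x => v x - u x) (fun x => v x - u x) < e].
  by have [g [Dg _ ge]] := h e e0; exists g.
apply: (bounded_energy_closure hform hsym hbeta) => [g []//|g h||eps eps0].
- move=> [Fg cg g0 gV] [Fh ch h0 hV]; split.
  + exact: (nf_comb nfQ).
  + by move=> x; apply: cvgD; apply: cvgMr; [exact: cg|exact: ch].
  + by move=> x; rewrite addr_ge0// mulr_ge0// invr_ge0.
  + by move=> x nx; rewrite gV// hV// !mulr0 addr0.
- exact: (domain_sqint hform Fu).
have bb : 0 < beta - beta0 by rewrite subr_gt0.
have d0 : 0 < Num.min 1 ((beta - beta0) * eps) by rewrite lt_min ltr01 mulr_gt0.
have [w [Fw [cw _] uw]] := hreg.2 beta hbeta u Fu _ d0.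
rewrite lt_min in uw; have /andP[uw1 uw2] := uw.
have Fuw := nf_sub nfQ Fu Fw.
have Qw : Q w w <= 2 * Q u u + 2.
  have h1 := nf_le_mean nfQ Fuw Fu.
  have : Q w w = Q u u - 2 * Q (fun x => u x - w x) u + Q (fun x => u x - w x) (fun x => u x - w x).
    rewrite (nf_subl nfQ Fu Fw Fu) (nf_sub2 nfQ Fu Fw) (nf_sym nfQ Fw Fu); ring.
  have h2 := nf_le_mean nfQ Fuw (nf_scale nfQ (-1) Fu).
  rewrite (nf_sym nfQ Fuw (nf_scale nfQ (-1) Fu)) !(nf_scalel nfQ (-1) Fu) in h2 => //.
  - rewrite (nf_sym nfQ Fu (nf_scale nfQ (-1) Fu)) (nf_scalel nfQ (-1) Fu Fu) in h2.
    by rewrite (nf_sym nfQ Fu Fuw) in h2 => ->; lra.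
  - exact: (nf_scale nfQ).
have [Fm Qm] := min_form hform hsym hbeta Fw Fc.
have [Fv Qv] := pos_form hform hsym hbeta Fm.
exists (fun x => Num.max (Num.min (w x) (c * phi x)) 0); split.
- split => //.
  + move=> x; apply: (@continuous_max _ _ (fun x => Num.min (w x) (c * phi x)) (cst 0)); last exact: cvg_cst.
    by apply: (@continuous_min _ _ w (fun x => c * phi x)); [exact: cw|apply: cvgMr; exact: cphi].
  + by move=> x; rewrite le_max lexx orbT.
  + by move=> x nx; rewrite phiV// mulr0; apply/max_idPr; rewrite ge_min lexx orbT.
- apply: (le_trans Qv); apply: (le_trans Qm); rewrite /b.
  by rewrite lerD2r ler_wpM2l.
- have s1 := sc_le_form hform hbeta Fuw uw2; apply: le_lt_trans s1.
  apply: scalar2_le_ae.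
  + exact: (domain_sqint hform (nf_sub nfQ Fv Fu)).
  + exact: (domain_sqint hform Fuw).
  (* Since [0 <= u x <= c * phi x], truncating [w x] to this interval brings it no further from
     [u x]. *)
  apply: aeW => x; rewrite distrC.
  have /andP[u0 uc'] := uc x.
  have up : u x <= c * phi x.
    have [/phi1 h|/un ->] := pselect (closure (V n) x); last by rewrite mulr_ge0// ltW.
    by rewrite (le_trans uc')// ler_peMr// ltW.
  have p0 : 0 <= c * phi x by rewrite mulr_ge0// ltW.
  have l1 := ler_norm (u x - w x); have l2 := ler_norm (- (u x - w x)).
  rewrite normrN in l2; rewrite ler_norml.
  by case: (leP (w x) (c * phi x)) => h1; [case: (leP (w x) 0) => h2|
    case: (leP (c * phi x) 0) => h2]; apply/andP; split; lra.
Qed.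

(** The competitors are normalized continuous functions [g j] close to [u], for which membership in
    the part of the domain is immediate. The bound is the limit of their energies. *)
Lemma ereal_inf_part_le n (u : E -> R) c : F u -> 0 < c -> (forall x, 0 <= u x <= c) ->
  (forall x, ~ closure (V n) x -> u x = 0) ->
  let m := sc (fun x => \1_(closure (V n)) x) u in 0 < m ->
  (ereal_inf [set (Q f f)%:E | f in normalized_part mu F Ef beta0 Om] <=
   (m ^- 2 * Q u u)%:E)%E.
Proof.
move=> Fu c0 uc un m m0.
have approx j : exists g, DV n g /\ Q (fun x => g x - u x) (fun x => g x - u x) < j.+1%:R^-1.
  by apply: (part_approx Fu c0 uc un); rewrite invr_gt0.
have [g hg] := choice approx.
have Fg j : F (g j) by have [[]] := hg j.
have cg : Q (fun x => g j x - u x) (fun x => g j x - u x) @[j --> \oo] --> 0.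
  apply: (@squeeze_cvgr _ _ _ _ (cst 0) (fun j => j.+1%:R^-1)).
  - apply: nearW => j; rewrite (ltW (hg j).2) andbT (nf_ge0 nfQ)//.
    exact: (nf_sub nfQ).
  - by apply: cvg_near_cst; apply: nearW.
  - exact: cvg_harmonic.
have cQ := nf_cvg_diag nfQ Fu Fg cg.
(* The integral of a function supported in [closure (V n.+1)] is its scalar product with this
   indicator, hence continuous for L^2 convergence. *)
pose one (x : E) : R := \1_(closure (V n.+1)) x.
have one2 : sqint mu one by apply: sqint_indic_compact.
have u2 := domain_sqint hform Fu; have g2 j := domain_sqint hform (Fg j).
have onem : sc one u = m.
  apply: eq_Rintegral => x _; rewrite /one !indicE.
  have [/set_mem h|/negP h] := boolP (x \in closure (V n)).
    by rewrite mem_set//; apply: subset_closure; exact: clV.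
  by rewrite un ?mulr0// => /mem_set.
have cm : sc one (g j) @[j --> \oo] --> m.
  by rewrite -onem; apply: (nf_cvg_right nfS) => //; exact: (form_cvg_sqint hform hsym hbeta).
have key : (sc one (g j)) ^- 2 * Q (g j) (g j) @[j --> \oo] --> m ^- 2 * Q u u.
  apply: cvgM => //; apply: cvgV; first by rewrite expf_neq0// gt_eqF.
  exact: cvgM.
apply/lee_addgt0Pr => e e0.
have /cvgrPdist_lt/(_ _ m0) h1 := cm; have /cvgrPdist_lt/(_ _ e0) h2 := key.
have [j [h1j h2j]] : exists j, `|m - sc one (g j)| < m /\
  `|m ^- 2 * Q u u - (sc one (g j)) ^- 2 * Q (g j) (g j)| < e.
  have [N1 _ hN1] := h1; have [N2 _ hN2] := h2; exists (maxn N1 N2); split.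
    by apply: hN1; rewrite /= leq_maxl.
  by apply: hN2; rewrite /= leq_maxr.
set mj := sc one (g j) in h1j h2j.
have mj0 : 0 < mj by have := ler_norm (m - mj); lra.
have [[_ contg g0 gV] _] := hg j.
have gone x : one x * g j x = g j x.
  rewrite /one indicE; have [h|/negP h] := boolP (x \in closure (V n.+1)); first by rewrite mul1r.
  by rewrite gV ?mulr0// => /subset_closure /mem_set.
have gi : mu.-integrable setT (EFin \o g j).
  by have := sqint_integrable one2 (g2 j); under eq_fun do rewrite gone.
have gint : (\int[mu]_x (g j x)%:E = mj%:E)%E.
  rewrite /mj /scalar2; under eq_Rintegral do rewrite gone.
  by rewrite fineK//; exact: integrable_fin_num.
apply: (@le_trans _ _ (mj ^- 2 * Q (g j) (g j))%:E); last first.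
  by rewrite -EFinD lee_fin; have := ler_norm (- (m ^- 2 * Q u u - mj ^- 2 * Q (g j) (g j)));
    rewrite normrN; lra.
have Fs : F (fun x => mj^-1 * g j x) by exact: (nf_scale nfQ).
apply: ereal_inf_lbound; exists (fun x => mj^-1 * g j x); last first.
  congr EFin; rewrite (nf_scalel nfQ)// (nf_sym nfQ)// (nf_scalel nfQ)// mulrA.
  by rewrite -exprVn expr2.
split.
- apply: continuous_dom_part => //.
    by move=> x; apply: cvgMr; exact: contg.
  move=> x nOm; rewrite gV ?mulr0// => Vx; apply: nOm; rewrite -VOm; by exists n.+1.
- have := integrableZl measurableT mj^-1 gi; exact: eq_integrable.
- under eq_integral do rewrite EFinM.
  by rewrite integralZl// gint -EFinM mulVf// gt_eqF.
Qed.

End part_approximation.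

(** Every tail of the sequence still converges to [f] in L^2, so the supremum of the tail bounds [f]
    almost everywhere. *)
Lemma sqint_cvg_le_limn_esup {R : realType} {E : pointedMetricType R}
    (mu : {measure set (borel E) -> \bar R}) (g : nat -> E -> R) (f : E -> R) (b : R) :
  sqint mu f -> (forall n, sqint mu (g n)) -> (forall n x, 0 <= g n x <= b) ->
  scalar2 mu (fun x => g n x - f x) (fun x => g n x - f x) @[n --> \oo] --> 0 ->
  {ae mu, forall x, ((f x)%:E <= limn_esup (fun n => (g n x)%:E))%E}.
Proof.
move=> f2 g2 gb cg.
have h (m : nat) : {ae mu, forall x, forall a b : R,
    (forall n, a <= g (n + m)%N x <= b) -> a <= f x <= b}.
  apply: sqint_cvg_liminf => //.
  pose G n := scalar2 mu (fun x => g n x - f x) (fun x => g n x - f x).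
  by rewrite -/(G _) (_ : (fun n => _) = (fun n => G (n + m)%N))// (cvg_shiftn m G).
move/ae_foralln : h; apply: ae_mono => x hx.
rewrite limn_esup_lim; apply: lime_ge; first exact: is_cvg_esups.
apply: nearW => m; rewrite /esups /=.
set s := ereal_sup _.
have gs n : ((g (n + m)%N x)%:E <= s)%E.
  by apply: ereal_sup_ubound; exists (n + m)%N => //=; rewrite leq_addl.
have sb : (s <= b%:E)%E.
  by apply: ge_ereal_sup => _ [n _ <-]; rewrite lee_fin; have /andP[] := gb n x.
have s0 : (0 <= s)%E.
  by apply: le_trans (gs 0%N); rewrite lee_fin; have /andP[] := gb (0 + m)%N x.
have sfin : s \is a fin_num by rewrite ge0_fin_numE// (le_lt_trans sb)// ltry.
rewrite -(fineK sfin) lee_fin.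
suff /andP[] : 0 <= f x <= fine s by [].
apply: (hx m) => n; have /andP[-> _] := gb (n + m)%N x.
by rewrite /= -lee_fin fineK.
Qed.

(** * Variational potentials supported in [closure (V n)] *)

Section part_limit.
Context {R : realType} {E : pointedMetricType R}.
Hypothesis hlc : locally_compact [set: E].
Hypothesis hsep : separable_space E.
Notation ED := (cemetery_ext E).
Context {d : measure_display} {W : measurableType d}.
Variables (X : R -> W -> ED) (P : ED -> probability W R).
Hypothesis hX : hunt_process X P.
Variables (mu : {measure set (borel E) -> \bar R}) (F : set (E -> R))
  (Ef : (E -> R) -> (E -> R) -> R) (beta0 beta : R).
Hypotheses (hform : lower_bounded_semi_dirichlet_form mu F Ef beta0)
  (hsym : form_symmetric F Ef) (hreg : regular_form mu F Ef beta0)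
  (hassoc : associated_with X P mu F Ef beta0) (hbeta : beta0 < beta).
Variables (Om : set E) (V : (set E)^nat).
Hypotheses (oV : forall n, open (V n)) (cV : forall n, compact (closure (V n)))
  (clV : forall n, closure (V n) `<=` V n.+1) (VOm : \bigcup_n V n = Om).
Variable fr : E -> R.
Hypotheses (fr2 : sqint mu fr) (fr01 : forall x, 0 <= fr x <= 1).
Notation Q := (form_beta mu Ef beta).
Notation sc := (scalar2 mu).

Let nfQ := form_beta_nonneg_form hform hsym hbeta.
Let nfS := sqint_nonneg_form mu.
Let b0 : 0 < beta := beta_gt0 hform hbeta.
Local Notation f := (EFin \o ext0 fr).
Local Opaque green pen killed_green.

Let f0 (y : borel ED) : (0 <= f y)%E.
Proof. by case: y => [x|] /=; rewrite lee_fin//; have /andP[] := fr01 x. Qed.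
Let f1 (y : borel ED) : (f y <= 1)%E.
Proof. by case: y => [x|] /=; rewrite lee_fin//; have /andP[] := fr01 x. Qed.
Let mf : measurable_fun setT (f : borel ED -> \bar R).
Proof. apply/measurable_EFinP; apply: measurable_ext0; exact: sqint_measurable fr2. Qed.

Lemma part_limit n : exists u : E -> R, [/\ F u, forall x, 0 <= u x <= beta^-1,
  forall x, ~ closure (V n) x -> u x = 0,
  forall h, F h -> (forall x, ~ closure (V n) x -> h x = 0) -> Q u h = sc fr h &
  {ae mu, forall x, (killed_green X P (hit X (outside V n)) beta f (Some x) <= (u x)%:E <=
                     killed_green X P (hit X (outside V n.+1)) beta f (Some x))%E}].
Proof.
have oU : open (outside V n) by exact: open_outside.
set U := outside V n in oU *.
have UN : U None by move=> [].
pose v k := penr X P fr U beta k.+1%:R.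
have k0 k : 0 < k.+1%:R :> R by [].
pose chi (x : E) : R := \1_U (Some x).
have mU : measurable (U : set (borel ED)) by exact: sub_sigma_algebra.
have mchi : measurable_fun setT (chi : borel E -> R).
  apply: (@measurableT_comp _ _ _ _ _ _ (\1_U : borel ED -> R)) => //.
  exact: measurable_Some.
have chi01 x : chi x = 0 \/ chi x = 1.
  by rewrite /chi indicE; case: (_ \in _); [right|left].
have Fv k : F (v k) by exact: (penr_domain hlc hsep hX hform hassoc fr2 fr01 oU UN hbeta (k0 k)).
have vb k x : 0 <= v k x <= beta^-1.
  exact: (penr_bound hlc hsep hX hform fr2 fr01 oU hbeta (k0 k)).
have fr0 x : 0 <= fr x by have /andP[] := fr01 x.
have v0 k x : 0 <= v k x by have /andP[] := vb k x.
have [u [Fu cu chiu Quu]] := @penalization_limit _ _ mu F Ef beta0 beta hform hsym hbeta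
  fr chi v (fun k => k.+1%:R) fr0 mchi chi01 Fv v0 (fun=> erefl)
  (fun k h Fh => penr_variational hlc hsep hX hform hassoc fr2 fr01 oU UN hbeta (k0 k) Fh).
have cu2 := form_cvg_sqint hform hsym hbeta Fu Fv cu.
have u2 := domain_sqint hform Fu.
have uab := sqint_cvg_liminf u2 (fun k => domain_sqint hform (Fv k)) cu2.
pose K := closure (V n).
(* A version of [u] for which support and bounds hold everywhere. *)
pose u' x := \1_K x * Num.min (Num.max (u x) 0) beta^-1.
have uu' : {ae mu, forall x, u x = u' x}.
  move: chiu uab; apply: ae_mono2 => x cx /(_ 0 beta^-1 (fun k => vb k x))/andP[ux0 ux1].
  rewrite /u' max_l// min_l//.
  move: cx; rewrite /chi /U !indicE; have [Kx|nK] := pselect (K x).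
    by rewrite (mem_set Kx) mul1r.
  rewrite (memNset nK) mul0r mem_set ?mul1r// => -[y Ky [yx]].
  by apply: nK; rewrite -yx.
have mK : measurable (K : set (borel E)).
  by apply: closed_borel_measurable; exact: closed_closure.
have mu' : measurable_fun setT (u' : borel E -> R).
  apply: measurable_funM; first exact: measurable_indic.
  apply: measurable_minr => //; apply: measurable_maxr => //.
  exact: (sqint_measurable u2).
have u2' : sqint mu u' by exact: sqint_ae uu' u2.
have Fu' : F u' by exact: (lbsd_dom_ae hform Fu u2' uu').
exists u'; split => //.
- move=> x; rewrite /u' indicE; case: (x \in K); rewrite ?mul1r ?mul0r ?lexx ?invr_ge0 ?(ltW b0)//.
  by rewrite le_min le_max lexx orbT invr_ge0 (ltW b0) ge_min lexx orbT.
- by move=> x nK; rewrite /u' indicE memNset ?mul0r.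
- move=> h Fh hK; rewrite -(form_beta_ae _ hform Fu Fu' Fh Fh uu')//; last exact: aeW.
  rewrite (nf_sym nfQ)//.
  have c1 := nf_cvg_right nfQ Fu Fh Fv cu.
  have c2 : Q h (v k) @[k --> \oo] --> sc fr h; last exact: (cvg_unique _ c1 c2).
  apply: cvg_near_cst; apply: nearW => k; rewrite (nf_sym nfQ)//.
  have := penr_variational hlc hsep hX hform hassoc fr2 fr01 oU UN hbeta (k0 k) Fh.
  suff -> : sc (fun x => \1_U (Some x) * penr X P fr U beta k.+1%:R x) h = 0.
    by rewrite mulr0 addr0.
  transitivity (\int[mu]_(x in setT) (0 : R))%R; last by rewrite Rintegral_cst// mul0r.
  apply: eq_Rintegral => x _.
  rewrite indicE; have [Kx|nK] := pselect (K x); last by rewrite hK ?mulr0.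
  by rewrite memNset ?mul0r// => -[]; exists x.
have lim_u := sqint_cvg_le_limn_esup u2 (fun k => domain_sqint hform (Fv k)) vb cu2.
have both := ae_mono2 (fun x a b => conj a b) uab lim_u.
move: uu' both; apply: ae_mono2 => x <- [uxab ux_lim].
apply/andP; split; last first.
  (* The upper bound uses the hitting time of [outside V n.+1]: the path is then in the open set
     [outside V n], where penalized potentials tend to 0. *)
  apply: (le_trans ux_lim).
  under eq_fun do rewrite (penrE hlc hsep hX hform fr2 fr01 oU hbeta (k0 _) x).
  apply: (limn_esup_pen hlc hsep hX mf f0 f1 oU b0 (Some x)).
    exact: (outside_stopping_time hX).
  exact: (at_outside_hitS hX oV clV).
have kp k := killed_le_pen hlc hsep hX mf f0 f1 oU b0 (Some x) (k0 k).
have kg0 := killed_res_ge0 X P f0 (hit X U) beta (Some x).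
have pb := pen_bound hlc hsep hX mf f0 f1 mU b0 (k0 0%N) (Some x).
have kfin : killed_green X P (hit X U) beta f (Some x) \is a fin_num.
  rewrite ge0_fin_numE//; apply: le_lt_trans (ltry beta^-1).
  exact: le_trans (kp 0%N) pb.
rewrite -(fineK kfin) lee_fin.
suff /andP[] : fine (killed_green X P (hit X U) beta f (Some x)) <= u x <= beta^-1 by [].
apply: uxab => k; have /andP[_ ->] := vb k x; rewrite andbT -lee_fin fineK//.
by rewrite (penrE hlc hsep hX hform fr2 fr01 oU hbeta (k0 k) x).
Qed.

(** Since [fr <= 1], the energy [Q u u = <fr, u>] is at most the integral [m] of [u], so the bound
    [m^-2 Q u u] is at most [1 / m]. *)
Lemma ereal_inf_part_le_inv n (u : E -> R) c : F u -> 0 < c ->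
  (forall x, 0 <= u x <= c) -> (forall x, ~ closure (V n) x -> u x = 0) ->
  Q u u = sc fr u ->
  exists m : R, [/\ (\int[mu]_x (u x)%:E = m%:E)%E, Q u u <= m &
   ((0 < m)%R -> ereal_inf [set (Q g g)%:E | g in normalized_part mu F Ef beta0 Om] <= (m^-1)%:E)%E].
Proof.
move=> Fu c0 ub uK Quu.
pose one (x : E) : R := \1_(closure (V n)) x.
have one2 : sqint mu one by exact: (sqint_indic_compact hform hsym hreg hbeta).
have u2 := domain_sqint hform Fu.
have u0 x : 0 <= u x by have /andP[] := ub x.
have ou x : one x * u x = u x.
  rewrite /one indicE; have [h|h] := pselect (closure (V n) x).
    by rewrite (mem_set h) mul1r.
  by rewrite uK ?mulr0.
have Qm : Q u u <= sc one u.
  rewrite Quu /scalar2; apply: le_Rintegral => //; [exact: sqint_integrable..|move=> x _].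
  by rewrite ou; have /andP[f0' f1'] := fr01 x; rewrite ler_piMl.
exists (sc one u); split => //.
  rewrite /scalar2; under eq_Rintegral do rewrite ou.
  rewrite fineK//; apply: integrable_fin_num => //.
  by have := sqint_integrable one2 u2; under eq_fun do rewrite ou.
move=> m0.
apply: (le_trans (ereal_inf_part_le hform hsym hreg hbeta hlc hsep oV cV clV VOm Fu c0 ub uK m0)).
rewrite lee_fin -/(sc one u) -[X in _ <= X]mulr1 -[X in _ <= _ * X](mulVf (lt0r_neq0 m0)).
by rewrite mulrA -expr2 exprVn ler_wpM2l ?invr_ge0 ?exprn_ge0 ?(ltW m0).
Qed.

End part_limit.

(** The pointwise error in the approximation of the part of the domain. Subtracting the level [e]
    costs at most [min(f, e)], the potentials cost [a] and [b], and the minimum with [w^+] costs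
    [|f - w|]; each term can be made small in L^2. *)
Lemma truncation_error {R : realType} (f a b w e : R) :
  0 <= f -> 0 <= a -> 0 <= b -> 0 <= e ->
  `|Num.min (Num.max (Num.max (f - a - b) 0 - e) 0) (Num.max w 0) - f| <=
  Num.min f e + a + (b + `|f - w|).
Proof.
move=> f0 a0 b0 e0.
have n1 := ler_norm (f - w); have n2 := ler_norm (- (f - w)); rewrite normrN in n2.
set p := Num.max (f - a - b) 0.
have p0 : 0 <= p by rewrite le_max lexx orbT.
have pl : f - a - b <= p by rewrite le_max lexx.
have pu : p <= f by rewrite ge_max f0 andbT; lra.
set q := Num.max (p - e) 0.
have q0 : 0 <= q by rewrite le_max lexx orbT.
have ql : p - e <= q by rewrite le_max lexx.
have qu : q <= p by rewrite ge_max p0 andbT; lra.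
rewrite ler_norml.
by case: (leP f e) => h1; case: (leP w 0) => h2; [case: (leP q 0)|case: (leP q w)|
  case: (leP q 0)|case: (leP q w)] => h3; apply/andP; split; lra.
Qed.

Lemma within_closed_preimage {R : realType} {T : topologicalType} (A : set T)
    (g : T -> R) (e : R) : closed A -> {within A, continuous g} ->
  closed (A `&` [set x | e <= g x]).
Proof.
move=> cA cg; rewrite setIC (closed_setIS _ cA).
exact: ((@continuous_closedP (subspace A) R g).1 cg _ (@closed_ge R e)).
Qed.

(** * Approximation of the part of the domain on [Om] *)

Section dom_part_approximation.
Context {R : realType} {E : pointedMetricType R}.
Variables (mu : {measure set (borel E) -> \bar R}) (F : set (E -> R))
  (Ef : (E -> R) -> (E -> R) -> R) (beta0 beta : R).
Hypotheses (hform : lower_bounded_semi_dirichlet_form mu F Ef beta0)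
  (hsym : form_symmetric F Ef) (hreg : regular_form mu F Ef beta0)
  (hbeta : beta0 < beta).
Variables (Om : set E) (V : (set E)^nat).
Hypotheses (oV : forall n, open (V n)) (clV : forall n, closure (V n) `<=` V n.+1)
  (VOm : \bigcup_n V n = Om).
Notation Q := (form_beta mu Ef beta).
Notation sc := (scalar2 mu).

Let nfQ := form_beta_nonneg_form hform hsym hbeta.
Let nfS := sqint_nonneg_form mu.

Lemma capacity_lt A e : (capacity mu F Ef beta A < e%:E)%E ->
  exists U psi, [/\ open U, A `<=` U, F psi, forall x, 0 <= psi x &
    {ae mu, forall x, U x -> 1 <= psi x} /\ Q psi psi < e].
Proof.
move=> /ereal_inf_lt[_ [U [oU AU] <-]] /ereal_inf_lt[_ [psi [Fpsi psi1] <-]].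
rewrite lte_fin => Qe.
have [Fp Qp] := pos_form hform hsym hbeta Fpsi.
exists U, (fun x => Num.max (psi x) 0); split => //.
  by move=> x; rewrite le_max lexx orbT.
split; last exact: le_lt_trans Qp Qe.
by move: psi1; apply: ae_mono => x h /h h1; rewrite le_max h1.
Qed.

Lemma dom_part_clip f M : 0 < M -> dom_part mu F Ef beta0 Om f ->
  dom_part mu F Ef beta0 Om (fun x => Num.min (Num.max (f x) 0) M).
Proof.
move=> M0 [Ff [g [gq gf g0]]]; split; first by have [] := clip_form hform hsym hbeta Ff M0.
exists (fun x => Num.min (Num.max (g x) 0) M); split.
- move=> b hb e e0; have [G [oG Ge Gc]] := gq b hb e e0; exists G; split => //.
  move=> x; apply: (@continuous_comp (subspace (~` G)) R R g
    (fun r => Num.min (Num.max r 0) M) x (Gc x)).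
  apply: (@continuous_min _ _ (fun r : R => Num.max r 0) (cst M)); last exact: cvg_cst.
  by apply: (@continuous_max _ _ id (cst 0)); [exact: cvg_id|exact: cvg_cst].
- by move: gf; apply: ae_mono => x ->.
- move=> b hb; apply/le_anti; rewrite (capacity_ge0 hform hsym)// andbT -(g0 b hb).
  apply: le_ereal_inf => c [U [oU AU] <-]; exists U => //; split => //.
  apply: subset_trans AU => x [nOm h]; split => // gx0; apply: h.
  by rewrite gx0 max_l// min_l// ltW.
Qed.

(** The functions that can be tested against the potentials of all large [n]; continuity is not
    asked for. *)
Definition inner_functions : set (E -> R) := [set h | [/\ F h, forall x, 0 <= h x &
  exists n, forall x, ~ closure (V n) x -> h x = 0]].

Let sc_add_le (a b : E -> R) : sqint mu a -> sqint mu b ->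
  sc (fun x => a x + b x) (fun x => a x + b x) <= 2 * sc a a + 2 * sc b b.
Proof.
move=> a2 b2; have b2' := nf_scale nfS (-1) b2.
have := nf_sub_le nfS a2 b2'.
rewrite (nf_scalel nfS)// (nf_sym nfS)// (nf_scalel nfS)// !mulN1r opprK.
by rewrite (_ : (fun x => a x - -1 * b x) = fun x => a x + b x)//; apply/funext => x; ring.
Qed.

(* Outside small open sets U1, U2 a quasi-continuous version g is continuous and
   vanishes off Om, so {g >= e} minus U1 and U2 meets the compact support of w in a
   compact subset of Om.  Subtracting M psi1 + M psi2 + e, where psi_i >= 1 on
   U_i has small energy, and taking the minimum with w^+ thus leaves a function
   supported in some closure (V n); its energy stays bounded. *)
Lemma dom_part_approx f M : 0 < M -> (forall x, 0 <= f x <= M) ->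
  dom_part mu F Ef beta0 Om f -> exists h : nat -> E -> R,
    (forall j, inner_functions (h j)) /\
    Q (fun x => h j x - f x) (fun x => h j x - f x) @[j --> \oo] --> 0.
Proof.
move=> M0 fM [Ff [g [gq gf g0]]].
have f2 := domain_sqint hform Ff.
have bb : 0 < beta - beta0 by rewrite subr_gt0.
have f0 x : 0 <= f x by have /andP[] := fM x.
(* Subtracting both potentials leaves energy at most [4 Q f f + 6 M^2]. Cutting at a level costs a
   factor 4 and the minimum a factor 6, whence 24; the minimum also adds 4 times the energy of [w],
   itself at most [2 Q f f + 2]. *)
pose b := 24 * (4 * Q f f + 6 * M ^+ 2) + 8 * Q f f + 8.
suff h e : 0 < e -> exists v, [/\ inner_functions v, Q v v <= b &
    sc (fun x => v x - f x) (fun x => v x - f x) < e].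
  have [||_ h'] := bounded_energy_closure (D := inner_functions) hform hsym hbeta _ _ f2 h.
  - by move=> u [].
  - move=> u v [Fu u0 [n un]] [Fv v0 [m vm]]; split.
    + exact: (nf_comb nfQ).
    + by move=> x; rewrite addr_ge0// mulr_ge0// invr_ge0.
    + exists (maxn n m) => x nx; rewrite un ?vm ?mulr0 ?addr0// => h1; apply: nx.
        by apply: closure_subset h1; apply: (nested_nondecreasing clV); exact: leq_maxr.
      by apply: closure_subset h1; apply: (nested_nondecreasing clV); exact: leq_maxl.
  have /choice[h_ hh] j : exists v, inner_functions v /\
      Q (fun x => v x - f x) (fun x => v x - f x) < j.+1%:R^-1.
    have j0 : 0 < j.+1%:R^-1 :> R by rewrite invr_gt0.
    by have [v [Dv _ ve]] := h' _ j0; exists v.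
  exists h_; split; first by move=> j; have [] := hh j.
  apply: (@squeeze_cvgr _ _ _ _ (cst 0) (fun j => j.+1%:R^-1)).
  - apply: nearW => j; have [[Fh _ _] hj] := hh j; rewrite (ltW hj) andbT (nf_ge0 nfQ)//.
    exact: (nf_sub nfQ).
  - by apply: cvg_near_cst; apply: nearW.
  - exact: cvg_harmonic.
move=> e0.
(* Four error terms are added in two stages, each stage doubling the squared norms, so the total is
   4 times a sum of four terms below [e / 16]. *)
have e16 : 0 < e / 16 by rewrite divr_gt0.
have e16M : 0 < e / 16 / M ^+ 2 by rewrite divr_gt0// exprn_gt0.
pose eta := Num.min 1 ((beta - beta0) * (e / 16 / M ^+ 2)).
have eta0 : 0 < eta by rewrite lt_min ltr01 mulr_gt0.
have [G [oG Ge gc]] := gq beta hbeta eta eta0.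
have [U1 [psi1 [oU1 GU1 Fpsi1 psi10 [U1psi Qpsi1]]]] := capacity_lt Ge.
have gz := g0 beta hbeta.
have [U2 [psi2 [oU2 GU2 Fpsi2 psi20 [U2psi Qpsi2]]]] :
    exists U psi, [/\ open U, [set x | ~ Om x /\ g x <> 0] `<=` U, F psi, forall x, 0 <= psi x &
    {ae mu, forall x, U x -> 1 <= psi x} /\ Q psi psi < eta].
  by apply: capacity_lt; rewrite gz lte_fin.
have d0 : 0 < Num.min 1 ((beta - beta0) * (e / 16)) by rewrite lt_min ltr01 mulr_gt0.
have [w [Fw [cw kw]]] := hreg.2 beta hbeta f Ff _ d0.
rewrite lt_min => /andP[fw1 fw2].
have Ffw := nf_sub nfQ Ff Fw.
have sfw := sc_le_form hform hbeta Ffw fw2.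
have spsi psi : F psi -> Q psi psi < eta -> Q psi psi <= 1 /\
    sc (fun x => M * psi x) (fun x => M * psi x) < e / 16.
  move=> Fpsi; rewrite lt_min => /andP[/ltW q1 q2]; split => //.
  have s2 := domain_sqint hform Fpsi.
  rewrite (nf_scalel nfS _ s2 (nf_scale nfS M s2)) (nf_sym nfS s2 (nf_scale nfS M s2)).
  rewrite (nf_scalel nfS _ s2 s2) mulrA -expr2 mulrC -ltr_pdivlMr ?exprn_gt0//.
  exact: (sc_le_form hform hbeta Fpsi q2).
have [Q1 s1] := spsi _ Fpsi1 Qpsi1; have [Q2 s2] := spsi _ Fpsi2 Qpsi2.
(* A constant level need not be in L^2, but the actual loss [min(f, 1/(j+1))] is dominated by [f]
   and tends to 0 in L^2. *)
pose fd (j : nat) (x : E) := Num.min (f x) j.+1%:R^-1.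
have mfd j : measurable_fun setT (fd j : borel E -> R).
  by apply: measurable_minr => //; exact: (sqint_measurable f2).
have fd0 j x : 0 <= fd j x by rewrite /fd le_min f0 invr_ge0 ler0n.
have fdf j x : `|fd j x| <= `|f x|.
  by rewrite !ger0_norm// /fd ge_min lexx.
have fdcv : sc (fd j) (fd j) @[j --> \oo] --> 0.
  apply: (sqint_dominated_cvg f2) => // x.
  apply: (@squeeze_cvgr _ _ _ _ (cst 0) (fun j => j.+1%:R^-1)).
  - by apply: nearW => j; rewrite fd0 /fd ge_min lexx orbT.
  - by apply: cvg_near_cst; apply: nearW.
  - exact: cvg_harmonic.
have [j sj] : exists j, sc (fd j) (fd j) < e / 16.
  have /cvgrPdist_lt/(_ _ e16)[N _ hN] := fdcv; exists N; have := hN N (leqnn N).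
  by rewrite /= sub0r normrN; apply: le_lt_trans; exact: ler_norm.
pose dl : R := j.+1%:R^-1; have dl0 : 0 < dl by rewrite invr_gt0.
have FM1 : F (fun x => M * psi1 x) by exact: (nf_scale nfQ).
have FM2 : F (fun x => M * psi2 x) by exact: (nf_scale nfQ).
have QM psi : F psi -> Q psi psi <= 1 ->
    Q (fun x => M * psi x) (fun x => M * psi x) <= M ^+ 2.
  move=> Fpsi q1; have FM : F (fun x => M * psi x) by exact: (nf_scale nfQ).
  rewrite (nf_scalel nfQ _ Fpsi FM) (nf_sym nfQ Fpsi FM) (nf_scalel nfQ _ Fpsi Fpsi).
  by rewrite mulrA -expr2 ler_piMr// exprn_ge0// ltW.
have Fq1 := nf_sub nfQ Ff FM1; have Fq := nf_sub nfQ Fq1 FM2.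
have Qq : Q (fun x => f x - M * psi1 x - M * psi2 x) (fun x => f x - M * psi1 x - M * psi2 x) <=
    4 * Q f f + 6 * M ^+ 2.
  apply: (le_trans (nf_sub_le nfQ Fq1 FM2)).
  have := nf_sub_le nfQ Ff FM1; have := QM _ Fpsi1 Q1; have := QM _ Fpsi2 Q2; lra.
have [Fp1 Qp1] := pos_form hform hsym hbeta Fq.
have [Fp2 Qp2] := cut_form hform hsym hbeta Fp1 dl0.
have [Fwp Qwp] := pos_form hform hsym hbeta Fw.
have Qw : Q w w <= 2 * Q f f + 2.
  have := nf_sub_le nfQ Ff Ffw.
  rewrite (_ : (fun x => f x - (f x - w x)) = w); last by apply/funext => x; ring.
  lra.
have [Fp3 Qp3] := min_form hform hsym hbeta Fp2 Fwp.
set p1 := (fun x => Num.max (f x - M * psi1 x - M * psi2 x) 0) in Fp1 Qp1 Fp2 Qp2 Fp3 Qp3.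
set p2 := (fun x => Num.max (p1 x - dl) 0) in Fp2 Qp2 Fp3 Qp3.
set p3 := (fun x => Num.min (p2 x) _) in Fp3 Qp3.
pose K' := closure [set x | w x != 0] `&` (~` U2 `&` (~` U1 `&` [set x | dl <= g x])).
have cK' : compact K'.
  apply: compact_closedI => //; apply: closedI; first exact: open_closedC.
  apply: within_closed_preimage; first exact: open_closedC.
  apply: continuous_subspaceW gc; exact: subsetC.
have K'Om : K' `<=` \bigcup_n V n.
  move=> x [_ [nU2 [_ gx]]]; rewrite VOm; apply: contrapT => nOm; apply: nU2; apply: GU2.
  by split => // gx0; move: gx; rewrite /= gx0 leNgt dl0.
have [n K'n] := compact_sub_nondecreasing_cover cK' oV (nested_nondecreasing clV) K'Om.
pose v x := \1_(closure (V n)) x * p3 x.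
have p30 x : 0 <= p3 x by rewrite /p3 le_min !le_max !lexx !orbT.
have vp3 : {ae mu, forall x, p3 x = v x}.
  move: (ae_mono2 (fun x a b => conj a b) U1psi U2psi) gf; apply: ae_mono2 => x [h1 h2] gfx.
  rewrite /v indicE; have [Kx|nK] := pselect (closure (V n) x); first by rewrite (mem_set Kx) mul1r.
  rewrite (memNset nK) mul0r; apply: contrapT => /eqP p3x.
  have {}p3x : 0 < p3 x by rewrite lt_def p3x p30.
  apply: nK; apply: subset_closure; apply: K'n.
  move: p3x; rewrite /p3 lt_min => /andP[p2x wx].
  have wx0 : 0 < w x by move: wx; rewrite lt_max ltxx orbF.
  have p1x : dl < p1 x by move: p2x; rewrite /p2 lt_max ltxx orbF subr_gt0.
  have qx : dl < f x - M * psi1 x - M * psi2 x.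
    by move: p1x; rewrite /p1 lt_max => /orP[//|]; rewrite ltNge (ltW dl0).
  have m1 : 0 <= M * psi1 x by rewrite mulr_ge0 ?(ltW M0).
  have m2 : 0 <= M * psi2 x by rewrite mulr_ge0 ?(ltW M0).
  have /andP[_ fx] := fM x.
  split; first by apply: subset_closure; rewrite /= gt_eqF.
  split; first by move=> /h2 h; have : M <= M * psi2 x by [rewrite ler_peMr// ltW]; lra.
  split; first by move=> /h1 h; have : M <= M * psi1 x by [rewrite ler_peMr// ltW]; lra.
  by rewrite /= gfx; lra.
have mK : measurable (closure (V n) : set (borel E)).
  by apply: closed_borel_measurable; exact: closed_closure.
have p32 := domain_sqint hform Fp3.
have v2 : sqint mu v.
  apply: (sqint_ae _ vp3 p32); apply: measurable_funM; first exact: measurable_indic.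
  exact: (sqint_measurable p32).
have Fv : F v by exact: (lbsd_dom_ae hform Fp3 v2 vp3).
exists v; split.
- split => //; first by move=> x; rewrite mulr_ge0.
  by exists n => x nx; rewrite /v indicE memNset ?mul0r.
- rewrite -(form_beta_ae _ hform Fp3 Fv Fp3 Fv vp3 vp3) (le_trans Qp3)// /b.
  by lra.
have A2 : sqint mu (fd j) by exact: sqint_le f2.
have B2 := nf_scale nfS M (domain_sqint hform Fpsi1).
have C2 := nf_scale nfS M (domain_sqint hform Fpsi2).
have W2 : sqint mu (fun x => `|f x - w x|).
  apply: sqint_le (domain_sqint hform Ffw); last by move=> x; rewrite normr_id.
  by apply: measurableT_comp => //; exact: (sqint_measurable (domain_sqint hform Ffw)).
have sW : sc (fun x => `|f x - w x|) (fun x => `|f x - w x|) < e / 16.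
  rewrite (_ : sc _ _ = sc (fun x => f x - w x) (fun x => f x - w x))//.
  by apply: eq_Rintegral => x _; rewrite -normrM ger0_norm// -expr2 sqr_ge0.
have t1 := sc_add_le A2 B2; have t2 := sc_add_le C2 W2.
have AB2 : sqint mu (fun x => fd j x + M * psi1 x).
  by have := nf_lin nfS 1 A2 B2; under eq_fun do rewrite mul1r.
have CW2 : sqint mu (fun x => M * psi2 x + `|f x - w x|).
  by have := nf_lin nfS 1 C2 W2; under eq_fun do rewrite mul1r.
have ABCW2 : sqint mu (fun x => fd j x + M * psi1 x + (M * psi2 x + `|f x - w x|)).
  by have := nf_lin nfS 1 AB2 CW2; under eq_fun do rewrite mul1r.
have t3 := sc_add_le AB2 CW2.
apply: (@le_lt_trans _ _ (sc (fun x => fd j x + M * psi1 x + (M * psi2 x + `|f x - w x|))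
  (fun x => fd j x + M * psi1 x + (M * psi2 x + `|f x - w x|)))); last first.
  apply: le_lt_trans t3 _; lra.
apply: scalar2_le_ae => //; first exact: (nf_sub nfS).
move: vp3; apply: ae_mono => x <-.
have m1 : 0 <= M * psi1 x by rewrite mulr_ge0 ?(ltW M0).
have m2 : 0 <= M * psi2 x by rewrite mulr_ge0 ?(ltW M0).
rewrite [leRHS]ger0_norm; last by rewrite !addr_ge0.
exact: truncation_error (f0 x) m1 m2 (ltW dl0).
Qed.

End dom_part_approximation.

(** * Potentials and energies *)

(** The limit [l] may be non-measurable, as exit times can be. Multiplied by the indicator of the
    complement of a null set, the functions converge everywhere and the integrals are unchanged. *)
Lemma ae_monotone_convergence {R : realType} {d} {T : measurableType d}
    (m : {measure set T -> \bar R}) (g : nat -> T -> \bar R) (l : T -> \bar R) :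
  (forall n, measurable_fun setT (g n)) -> (forall n x, (0 <= g n x)%E) ->
  (forall x, (0 <= l x)%E) ->
  {ae m, forall x, {homo (fun n => g n x) : a b / (a <= b)%N >-> (a <= b)%E} /\
                   g n x @[n --> \oo] --> l x} ->
  (\int[m]_x g n x)%E @[n --> \oo] --> (\int[m]_x l x)%E.
Proof.
move=> mg g0 l0 [N [mN N0 hN]].
have out x : ~ N x -> {homo (fun n => g n x) : a b / (a <= b)%N >-> (a <= b)%E} /\
    g n x @[n --> \oo] --> l x.
  by move=> nx; apply: contrapT => h; apply: nx; exact: hN.
pose chi (x : T) : \bar R := (\1_(~` N) x)%:E.
have chiE (h : T -> \bar R) : (forall x, (0 <= h x)%E) ->
    (\int[m]_x h x = \int[m]_x (chi x * h x))%E.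
  move=> h0; apply: ge0_integral_ae_eq => //.
    by move=> x; rewrite mule_ge0// lee_fin.
  exists N; split => // x /= nx; apply: contrapT => xN; apply: nx.
  by rewrite /chi indicE mem_set// mul1e.
rewrite (chiE _ l0); under eq_fun do rewrite (chiE _ (g0 _)).
apply: ge0_nondecreasing_cvg_integral => //.
- move=> n; apply: emeasurable_funM => //; apply/measurable_EFinP.
  by apply: measurable_indic; exact: measurableC.
- by move=> n x _; rewrite mule_ge0// lee_fin.
- move=> x _ a b ab; have [xN|/out[mono _]] := pselect (N x).
    by rewrite /chi indicE memNset ?mul0e//; exact.
  by rewrite lee_wpmul2l// ?lee_fin// mono.
- move=> x _; have [xN|xN] := pselect (N x).
    rewrite /chi indicE memNset; last by exact.
    by rewrite mul0e; apply: cvg_near_cst; apply: nearW => n; rewrite mul0e.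
  have [_ cv] := out x xN; rewrite /chi indicE mem_set// mul1e.
  by under eq_fun do rewrite mul1e.
Qed.

(** * The lower bound for normalized functions *)

Section energy_lower_bound.
Context {R : realType} {E : pointedMetricType R}.
Variables (mu : {measure set (borel E) -> \bar R}) (F : set (E -> R))
  (Ef : (E -> R) -> (E -> R) -> R) (beta0 beta : R).
Hypotheses (hform : lower_bounded_semi_dirichlet_form mu F Ef beta0)
  (hsym : form_symmetric F Ef) (hreg : regular_form mu F Ef beta0)
  (hbeta : beta0 < beta).
Variables (Om : set E) (V : (set E)^nat).
Hypotheses (oV : forall n, open (V n)) (clV : forall n, closure (V n) `<=` V n.+1)
  (VOm : \bigcup_n V n = Om).
Notation Q := (form_beta mu Ef beta).
Notation sc := (scalar2 mu).

Let nfQ := form_beta_nonneg_form hform hsym hbeta.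
Let nfS := sqint_nonneg_form mu.

Variables (fr : nat -> E -> R) (c : R).
Hypotheses (fr2 : forall n, sqint mu (fr n)) (fr01 : forall n x, 0 <= fr n x <= 1)
  (fr_nd : forall n m x, (n <= m)%N -> fr n x <= fr m x)
  (fr_cvg : forall x, fr n x @[n --> \oo] --> (1 : R))
  (c0 : 0 <= c)
  (innerP : forall n h, inner_functions F V h -> (sc (fr n) h) ^+ 2 <= c * Q h h).

Let clip (f : E -> R) (M : R) (x : E) : R := Num.min (Num.max (f x) 0) M.

(** A clipped function is bounded and nonnegative, so inner functions approximate it in the form
    norm, and the inequality passes to the limit. *)
Let sc_clip f M n : 0 < M -> dom_part mu F Ef beta0 Om f ->
  (sc (fr n) (clip f M)) ^+ 2 <= c * Q f f.
Proof.
move=> M0 df; have [Ff _] := df.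
have dfM := dom_part_clip hform hsym hbeta M0 df.
have [Fc Qc] := clip_form hform hsym hbeta Ff M0.
have cb x : 0 <= clip f M x <= M.
  by rewrite /clip le_min le_max lexx orbT (ltW M0) ge_min lexx orbT.
have [h [Dh ch]] := dom_part_approx hform hsym hreg hbeta oV clV VOm M0 cb dfM.
have Fh j : F (h j) by have [] := Dh j.
have c1 := nf_cvg_diag nfQ Fc Fh ch.
have c2 := nf_cvg_right nfS (domain_sqint hform Fc) (fr2 n)
  (fun j => domain_sqint hform (Fh j)) (form_cvg_sqint hform hsym hbeta Fc Fh ch).
apply: (@le_trans _ _ (c * Q (clip f M) (clip f M))); last by rewrite ler_wpM2l.
have c3 : (sc (fr n) (h j)) ^+ 2 @[j --> \oo] --> (sc (fr n) (clip f M)) ^+ 2.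
  by have := cvgM c2 c2; exact.
have c4 : c * Q (h j) (h j) @[j --> \oo] --> c * Q (clip f M) (clip f M).
  by apply: cvgMr; exact: c1.
by apply: (ler_cvg_to c3 c4); apply: nearW => j; exact: innerP.
Qed.

(** Clips of [f] have energy at most [Q f f]. Paired with [fr n], they increase to the integral of
    the positive part of [f], which is at least 1. *)
Lemma normalized_energy_ge f : normalized_part mu F Ef beta0 Om f -> 1 <= c * Q f f.
Proof.
move=> [df fi f1]; have [Ff _] := df.
have B0 : 0 <= c * Q f f by rewrite mulr_ge0// (nf_ge0 nfQ).
have fc0 M x : 0 < M -> 0 <= clip f M x.
  by move=> M0; rewrite /clip le_min le_max lexx orbT ltW.
have mf := sqint_measurable (domain_sqint hform Ff).
have step n : (\int[mu]_x (fr n x * clip f n.+1%:R x)%:E <= (Num.sqrt (c * Q f f))%:E)%E.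
  have n0 : 0 < n.+1%:R :> R by [].
  have [Fc _] := clip_form hform hsym hbeta Ff n0.
  have i2 := sqint_integrable (fr2 n) (domain_sqint hform Fc).
  have -> : (\int[mu]_x (fr n x * clip f n.+1%:R x)%:E = (sc (fr n) (clip f n.+1%:R))%:E)%E.
    by rewrite fineK//; exact: integrable_fin_num.
  rewrite lee_fin; apply: le_trans (ler_norm _) _; rewrite -sqrtr_sqr.
  by apply: ler_wsqrtr; exact: sc_clip.
have cv : (\int[mu]_x (fr n x * clip f n.+1%:R x)%:E @[n --> \oo] -->
    \int[mu]_x (Num.max (f x) 0)%:E)%E.
  apply: ge0_nondecreasing_cvg_integral => //.
  - move=> n; apply/measurable_EFinP; apply: measurable_funM.
      exact: (sqint_measurable (fr2 n)).
    by apply: measurable_minr => //; apply: measurable_maxr.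
  - move=> n x _; rewrite lee_fin mulr_ge0 ?fc0//.
    by have /andP[] := fr01 n x.
  - move=> x _ a b ab; rewrite lee_fin ler_pM ?fc0 ?fr_nd//.
      by have /andP[] := fr01 a x.
    by rewrite /clip le_min !ge_min lexx/= ler_nat ltnS ab orbT.
  - move=> x _; apply: cvg_EFin; first exact: nearW.
    rewrite -[X in _ --> X]mul1r; apply: cvgM; first exact: fr_cvg.
    apply: cvg_near_cst; exists (Num.truncn (Num.max (f x) 0)) => // n /= hn.
    rewrite /clip; apply/min_idPl; apply: ltW.
    have := truncnS_gt (Num.max (f x) 0) => h; apply: (lt_le_trans h).
    by rewrite ler_nat ltnS.
have le1 : (\int[mu]_x (Num.max (f x) 0)%:E <= (Num.sqrt (c * Q f f))%:E)%E.
  by apply: (lee_cvg_to cv (cvg_cst _)); apply: nearW.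
have f1' : (1 <= (Num.sqrt (c * Q f f))%:E)%E.
  apply: le_trans le1; rewrite -f1 integralE.
  rewrite (_ : (fun x => (Num.max (f x) 0)%:E) = (fun x => (f x)%:E)^\+%E); last first.
    by apply/funext => x; rewrite funeposE EFin_max.
  by rewrite geeDl// oppe_le0; exact: integral_ge0.
rewrite lee_fin in f1'.
by rewrite -(sqr_sqrtr B0) -(expr1n _ 2) lerXn2r ?nnegrE ?sqrtr_ge0.
Qed.

End energy_lower_bound.

Lemma killed_green_le {R : realType} {E : pointedMetricType R} {d} {W : measurableType d}
    (X : R -> W -> cemetery_ext E) (P : cemetery_ext E -> probability W R)
    (g h : borel (cemetery_ext E) -> \bar R) (sigma : W -> \bar R) l y :
  (forall z, (0 <= g z)%E) -> (forall z, (g z <= h z)%E) ->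
  (killed_green X P sigma l g y <= killed_green X P sigma l h y)%E.
Proof.
move=> g0 gh; have h0 z : (0 <= h z)%E by exact: le_trans (gh z).
have pos (k : borel (cemetery_ext E) -> \bar R) w t : (forall z, (0 <= k z)%E) ->
    (0 <= (expw l t)%:E * (((t%:E < sigma w)%E%:R)%:E * k (Xpos X t w)))%E.
  by move=> k0; rewrite !mule_ge0// lee_fin ?expw_ge0.
apply: (ge0_le_integral_off_null (@measurable0 _ _)); rewrite ?measure0//.
- by move=> w; apply: integral_ge0 => t _; exact: pos.
- by move=> w; apply: integral_ge0 => t _; exact: pos.
move=> w _; apply: (ge0_le_integral_off_null (@measurable0 _ _)); rewrite ?measure0//.
- by move=> t; exact: pos.
- by move=> t; exact: pos.
by move=> t _; rewrite lee_wpmul2l ?lee_fin ?expw_ge0// lee_wpmul2l// lee_fin.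
Qed.

(** * The infimum as the inverse of the total exit potential *)

Section exit_energy.
Context {R : realType} {E : pointedMetricType R}.
Hypothesis hlc : locally_compact [set: E].
Hypothesis hsep : separable_space E.
Notation ED := (cemetery_ext E).
Context {d : measure_display} {W : measurableType d}.
Variables (X : R -> W -> ED) (P : ED -> probability W R).
Hypothesis hX : hunt_process X P.
Variables (mu : {measure set (borel E) -> \bar R}) (F : set (E -> R))
  (Ef : (E -> R) -> (E -> R) -> R) (beta0 : R).
Hypotheses (hform : lower_bounded_semi_dirichlet_form mu F Ef beta0)
  (hsym : form_symmetric F Ef) (hreg : regular_form mu F Ef beta0)
  (hassoc : associated_with X P mu F Ef beta0)
  (hsf : sigma_finite [set: borel E] mu).
Variables (Om : set E) (V : (set E)^nat).
Hypotheses (oV : forall n, open (V n)) (cV : forall n, compact (closure (V n)))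
  (clV : forall n, closure (V n) `<=` V n.+1) (VOm : \bigcup_n V n = Om).
Notation sc := (scalar2 mu).

Lemma exhausting_functions : exists fr : nat -> E -> R,
  [/\ forall n, sqint mu (fr n), forall n x, 0 <= fr n x <= 1,
      forall n m x, (n <= m)%N -> fr n x <= fr m x &
      forall x, fr n x @[n --> \oo] --> (1 : R)].
Proof.
have /sigma_finiteP[S [ST Snd Sfin]] := hsf.
exists (fun n x => \1_(S n) x); split.
- move=> n; have [mS Soo] := Sfin n; apply: sqintP; first exact: measurable_indic.
  rewrite (_ : (fun x => _) = fun x => (\1_(S n) x)%:E); last first.
    by apply/funext => x; rewrite indicE; case: (x \in _); rewrite ?expr1n ?expr0n.
  by rewrite integral_indic// setIT.
- by move=> n x; rewrite indicE ler0n lern1 leq_b1.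
- move=> n m x /Snd/subsetPset Snm; rewrite !indicE.
  have [h|h] := pselect (S n x); first by rewrite !mem_set//; exact: Snm.
  by rewrite (memNset h).
- move=> x; have [n _ Sx] : (\bigcup_i S i) x by rewrite -ST.
  apply: cvg_near_cst; exists n => // m /= /Snd/subsetPset Snm.
  by rewrite indicE mem_set//; exact: Snm.
Qed.

(** The [b]-potential of the constant 1 for the process killed on leaving [Om]. *)
Definition exit_potential b (x : E) : \bar R :=
  ((b^-1)%:E * expect P x (fun w => 1 - expeR (- (b%:E * exit_time X Om w))))%E.

Lemma exit_potential_ge0 b x : 0 < b -> (0 <= exit_potential b x)%E.
Proof.
move=> b0; rewrite mule_ge0 ?lee_fin ?invr_ge0 ?(ltW b0)//; apply: integral_ge0 => w _.
rewrite sube_ge0 ?orbT// -expeR0 lee_expeR oppe_le0.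
by rewrite mule_ge0// ?lee_fin ?(ltW b0)// (exit_time_ge0 X clV VOm).
Qed.

Local Opaque green pen killed_green.

(* u n is squeezed between the potentials killed on leaving closure (V n) and
   closure (V n.+1), hence the monotonicity. *)
Lemma exit_potential_approx (fr : nat -> E -> R) b : beta0 < b ->
  (forall n, sqint mu (fr n)) -> (forall n x, 0 <= fr n x <= 1) ->
  (forall n m x, (n <= m)%N -> fr n x <= fr m x) ->
  (forall x, fr n x @[n --> \oo] --> (1 : R)) ->
  exists u : nat -> E -> R, [/\ forall n, F (u n), forall n x, 0 <= u n x <= b^-1,
    forall n x, ~ closure (V n) x -> u n x = 0,
    forall n h, F h -> (forall x, ~ closure (V n) x -> h x = 0) ->
      form_beta mu Ef b (u n) h = sc (fr n) h &
    {ae mu, forall x, {homo (fun n => (u n x)%:E) : n m / (n <= m)%N >-> (n <= m)%E} /\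
      (u n x)%:E @[n --> \oo] --> exit_potential b x}].
Proof.
move=> hb fr2 fr01 fr_nd fr_cvg.
have b0 : 0 < b := beta_gt0 hform hb.
have pl n := part_limit hlc hsep hX hform hsym hassoc hb oV cV clV (fr2 n) (fr01 n) n.
have [u hu] := choice pl.
exists u; split; try by move=> n; have [] := hu n.
pose f n : borel ED -> \bar R := EFin \o ext0 (fr n).
have f0 n y : (0 <= f n y)%E.
  by case: y => [x|] /=; rewrite lee_fin//; have /andP[] := fr01 n x.
have f_nd n m y : (n <= m)%N -> (f n y <= f m y)%E.
  by move=> nm; case: y => [x|] /=; rewrite lee_fin//; exact: fr_nd.
have mf n : measurable_fun setT (f n).
  by apply/measurable_EFinP; apply: measurable_ext0; exact: sqint_measurable (fr2 n).
have f_cvg x : f n (Some x) @[n --> \oo] --> 1%E.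
  by apply: cvg_EFin; [exact: nearW|exact: fr_cvg].
pose G n x := killed_green X P (hit X (outside V n)) b (f n) (Some x).
have ae_all : {ae mu, forall x n, (G n x <= (u n x)%:E <=
    killed_green X P (hit X (outside V n.+1)) b (f n) (Some x))%E}.
  by apply/ae_foralln => n; have [] := hu n.
move: ae_all; apply: ae_mono => x hx.
have Gu n : (G n x <= (u n x)%:E)%E by have /andP[] := hx n.
have uG n : ((u n x)%:E <= G n.+1 x)%E.
  have /andP[_ h] := hx n; apply: (le_trans h); apply: killed_green_le => // y.
  exact: f_nd.
have u_nd : {homo (fun n => (u n x)%:E) : n m / (n <= m)%N >-> (n <= m)%E}.
  by apply/nondecreasing_seqP => n; exact: le_trans (uG n) (Gu n.+1).
have G_nd : {homo (fun n => G n x) : n m / (n <= m)%N >-> (n <= m)%E}.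
  by apply/nondecreasing_seqP => n; exact: le_trans (Gu n) (uG n).
split => //.
have cG : G n x @[n --> \oo] --> limn (G^~ x) by exact: ereal_nondecreasing_is_cvgn.
have -> : exit_potential b x = limn (G^~ x).
  rewrite /exit_potential (expect_exp_exit_time hlc hsep hX oV cV clV VOm mf f0 _ f_cvg)//.
    by rewrite muleA -EFinM mulVf ?gt_eqF// mul1e.
  by move=> y n m; exact: f_nd.
have cG' : G n.+1 x @[n --> \oo] --> limn (G^~ x).
  by rewrite (cvg_shiftS (fun n => G n x)).
apply: (squeeze_cvge _ cG cG').
by apply: nearW => n; rewrite Gu uG.
Qed.

Lemma exit_energy b : beta0 < b -> ((\int[mu]_x exit_potential b x)^-1)%E =
  ereal_inf [set (form_beta mu Ef b f f)%:E | f in normalized_part mu F Ef beta0 Om].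
Proof.
move=> hb; have b0 : 0 < b := beta_gt0 hform hb.
have nfQ := form_beta_nonneg_form hform hsym hb.
have [fr [fr2 fr01 fr_nd fr_cvg]] := exhausting_functions.
have [u [Fu ub uV uh ucv]] := exit_potential_approx hb fr2 fr01 fr_nd fr_cvg.
set I := (\int[mu]_x exit_potential b x)%E; set inf := ereal_inf _.
have u0 n x : 0 <= u n x by have /andP[] := ub n x.
have mu_ n : measurable_fun setT (fun x : borel E => (u n x)%:E).
  by apply/measurable_EFinP; exact: (sqint_measurable (domain_sqint hform (Fu n))).
have Icv : (\int[mu]_x (u n x)%:E @[n --> \oo] --> I)%E.
  apply: ae_monotone_convergence => // x.
  exact: exit_potential_ge0.
have [m hm] := choice (fun n => ereal_inf_part_le_inv hlc hsep hform hsym hreg hb oV cV clV VOm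
  (fr2 n) (fr01 n) (Fu n) (ltac:(by rewrite invr_gt0) : 0 < b^-1) (ub n) (uV n) (uh n _ (Fu n) (uV n))).
have mcv : (m n)%:E @[n --> \oo] --> I.
  by under eq_fun => n do have [<- _ _] := hm n.
have m_nd n k : (n <= k)%N -> m n <= m k.
  move=> nk; rewrite -lee_fin; have [<- _ _] := hm n; have [<- _ _] := hm k.
  have [N [mN N0 hN]] := ucv; apply: (ge0_le_integral_off_null mN N0) => x; rewrite ?lee_fin//.
  by move=> nx; apply: contrapT => h; apply: nx; apply: hN => -[h' _]; apply: h; exact: h'.
have mI n : ((m n)%:E <= I)%E.
  apply: (lee_cvg_to (cvg_cst _) mcv); exists n => // k /= nk.
  by rewrite lee_fin m_nd.
have mQ n : form_beta mu Ef b (u n) (u n) <= m n by have [] := hm n.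
have m0 n : 0 <= m n by apply: le_trans (mQ n); exact: (nf_ge0 nfQ).
have inf_le n : 0 < m n -> (inf <= ((m n)^-1)%:E)%E by have [] := hm n.
have inf0 : (0 <= inf)%E.
  by apply: le_ereal_inf_tmp => _ [f [[Ff _] _ _] <-]; rewrite lee_fin (nf_ge0 nfQ).
(* Only functions vanishing off [closure (V p)] may be tested against [u p], so [n] is raised to an
   index [p] that also covers the support of [h]. As [h] is nonnegative, this can only increase its
   pairing with [fr]. *)
have lower (c : R) : 0 <= c -> (I <= c%:E)%E -> forall f, normalized_part mu F Ef beta0 Om f ->
    1 <= c * form_beta mu Ef b f f.
  move=> c0 Ic f; apply: (normalized_energy_ge hform hsym hreg hb oV clV VOm fr2 fr01 fr_nd fr_cvg c0).
  move=> n h [Fh h0 [k hk]].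
  have [p np kp] : exists2 p, (n <= p)%N & (k <= p)%N.
    by exists (maxn n k); [exact: leq_maxl|exact: leq_maxr].
  have hp x : ~ closure (V p) x -> h x = 0.
    by move=> nx; apply: hk => kx; apply: nx; apply: closure_subset kx; exact: (nested_nondecreasing clV).
  have h2 := domain_sqint hform Fh.
  have fr0 j x : 0 <= fr j x by have /andP[] := fr01 j x.
  have s1 : sc (fr n) h <= sc (fr p) h.
    apply: le_Rintegral => //; [exact: sqint_integrable..|move=> x _].
    by rewrite ler_wpM2r// fr_nd.
  apply: (@le_trans _ _ ((sc (fr p) h) ^+ 2)).
    by rewrite lerXn2r ?nnegrE// scalar2_ge0.
  rewrite -(uh p h Fh hp); apply: (le_trans (nf_cauchy_schwarz nfQ (Fu p) Fh)).
  rewrite ler_wpM2r ?(nf_ge0 nfQ)//; apply: (le_trans (mQ p)).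
  by rewrite -lee_fin (le_trans (mI p)).
have I0 : (0 <= I)%E by apply: integral_ge0 => x _; exact: exit_potential_ge0.
case Ie : I I0 => [i| |//] I0.
- have i0 : 0 <= i by rewrite -lee_fin.
  have low := lower i i0 (ltac:(by rewrite Ie)).
  (* If the total potential is 0, the lower bound would read [1 <= 0]: no normalized function exists
     and both sides are [+oo]. *)
  rewrite inver; have [i_0|i_0] := eqVneq i 0.
    rewrite /inf (_ : [set _ | _ in _] = set0) ?ereal_inf0//.
    by rewrite -subset0 => y [f /low]; rewrite i_0 mul0r leNgt ltr01.
  have {}i0 : 0 < i by rewrite lt_def i_0.
  apply/le_anti/andP; split.
    apply: le_ereal_inf_tmp => _ [f /low h <-]; rewrite lee_fin.
    by rewrite -[leLHS]mulr1 ler_pdivrMl.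
  have mcv' : m n @[n --> \oo] --> i.
    by move: mcv; rewrite Ie => /fine_cvgP[_].
  have mcvV : (m n)^-1 @[n --> \oo] --> i^-1 by apply: cvgV => //; rewrite gt_eqF.
  apply: (lee_cvg_to (cvg_cst inf) (_ : ((m n)^-1)%:E @[n --> \oo] --> (i^-1)%:E)).
    by apply: cvg_EFin; [exact: nearW|exact: mcvV].
  have /cvgrPdist_lt/(_ _ i0)[N _ hN] := mcv'; exists N => // n /hN/= h.
  by apply: inf_le; have := ler_norm (i - m n); lra.
- rewrite invey; apply/le_anti; rewrite inf0/=; apply/lee_addgt0Pr => e e0.
  rewrite add0e; rewrite Ie in mcv.
  have /cvgeyPge/(_ e^-1)[N _ hN] := mcv.
  have h := hN N (leqnn N); rewrite /= lee_fin in h.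
  have mN0 : 0 < m N by apply: lt_le_trans h; rewrite invr_gt0.
  apply: (le_trans (inf_le N mN0)); rewrite lee_fin.
  by rewrite -[leRHS]invrK lef_pV2 ?posrE ?invr_gt0.
Qed.

End exit_energy.

Lemma integral_expw_small {R : realType} (s : \bar R) : (0 <= s)%E ->
  (\int[lebesgue_measure]_t ((expw j.+1%:R^-1 t)%:E * ((t%:E < s)%E%:R)%:E))%E
    @[j --> \oo] --> s.
Proof.
move=> s0.
have mlt : measurable_fun setT (fun t : R => ((t%:E < s)%E%:R : R)).
  apply: measurable_indic_bool.
  rewrite -[X in measurable X]setTI; exact: measurable_lte.
have eqs : (\int[lebesgue_measure]_t ((0 <= t)%R%:R * (t%:E < s)%E%:R : R)%:E = s)%E.
  pose A := [set t : R | (0 <= t)%R && (t%:E < s)%E].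
  have -> : (fun t : R => ((0 <= t)%R%:R * (t%:E < s)%E%:R : R)%:E) = (fun t => (\1_A t)%:E).
    apply/funext => t; rewrite indicE; congr EFin; rewrite -natrM mulnb.
    by congr (nat_of_bool _)%:R; apply/idP/idP => [h|/set_mem//]; rewrite mem_set.
  case: s s0 @A {mlt} => [r| |//] s0 A.
    have AE : A = [set` `[0, r[%R].
      by apply/seteqP; split => t; rewrite /A /= in_itv/= lte_fin.
    rewrite AE integral_indic//.
    rewrite setIT; transitivity (@lebesgue_measure R [set` `[0, r[%R]) => //.
    rewrite lebesgue_measure_itv/= lte_fin.
    move: s0; rewrite lee_fin le_eqVlt => /orP[/eqP <-|->]; first by rewrite ltxx.
    by rewrite oppr0 adde0.
  have AE : A = [set` `[0, +oo[%R].
    by apply/seteqP; split => t; rewrite /A /= in_itv/= ltry ?andbT.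
  rewrite AE integral_indic//.
  rewrite setIT; transitivity (@lebesgue_measure R [set` `[0, +oo[%R]) => //.
  by rewrite lebesgue_measure_itv/= ltry.
rewrite -[X in _ --> X]eqs; apply: ge0_nondecreasing_cvg_integral => //.
- move=> j; apply: emeasurable_funM; apply/measurable_EFinP => //.
  exact: measurable_expw.
- by move=> j t _; rewrite mule_ge0// lee_fin ?expw_ge0.
- move=> t _ a b ab; rewrite lee_wpmul2r ?lee_fin// le_expw//.
  by rewrite lef_pV2 ?posrE// ler_nat ltnS.
- move=> t _; under eq_fun do rewrite -EFinM.
  apply: cvg_EFin; first exact: nearW.
  apply: cvgMl; rewrite /expw -[X in _ --> X]mul1r; apply: cvgMl.
  have h : - (j.+1%:R^-1 * t) @[j --> \oo] --> (0 : R).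
    by rewrite -oppr0 -(mul0r t); apply: cvgN; apply: cvgMl; exact: cvg_harmonic.
  rewrite -[X in _ --> X]expR0; apply: (continuous_cvg _ _ h); exact: continuous_expR.
Qed.

(** * Integrated exit potentials and the limit of vanishing index *)

Section exit_mean.
Context {R : realType} {E : pointedMetricType R}.
Hypothesis hlc : locally_compact [set: E].
Hypothesis hsep : separable_space E.
Notation ED := (cemetery_ext E).
Context {d : measure_display} {W : measurableType d}.
Variables (X : R -> W -> ED) (P : ED -> probability W R).
Hypothesis hX : hunt_process X P.
Variables (mu : {measure set (borel E) -> \bar R}) (F : set (E -> R))
  (Ef : (E -> R) -> (E -> R) -> R) (beta0 : R).
Hypotheses (hform : lower_bounded_semi_dirichlet_form mu F Ef beta0)
  (hsym : form_symmetric F Ef) (hreg : regular_form mu F Ef beta0)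
  (hassoc : associated_with X P mu F Ef beta0)
  (hsf : sigma_finite [set: borel E] mu).
Variables (Om : set E) (V : (set E)^nat).
Hypotheses (oV : forall n, open (V n)) (cV : forall n, compact (closure (V n)))
  (clV : forall n, closure (V n) `<=` V n.+1) (VOm : \bigcup_n V n = Om).

(** The exit formula with constant sources 1 expresses the potential by a functional measurable in
    the path, to which convergence theorems apply. *)
Lemma exit_potential_sup_hit b x : 0 < b -> exit_potential X P Om b x =
  (\int[P (Some x)]_w \int[lebesgue_measure]_t
     ((expw b t)%:E * ((t%:E < sup_hit X V w)%E%:R)%:E))%E.
Proof.
move=> b0; pose f (n : nat) (y : borel ED) : \bar R := 1%E.
have mf n : measurable_fun setT (f n) by exact: measurable_cst.
have f0 n y : (0 <= f n y)%E by [].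
have fnd y : {homo f^~ y : n m / (n <= m)%N >-> (n <= m)%E} by [].
have f1 x' : f n (Some x' : ED) @[n --> \oo] --> 1%E by exact: cvg_cst.
rewrite /exit_potential (expect_exp_exit_time hlc hsep hX oV cV clV VOm mf f0 fnd f1)//.
rewrite (integral_sup_hit hlc hsep hX cV clV mf f0 fnd f1)//.
by rewrite muleA -EFinM mulVf ?gt_eqF// mul1e.
Qed.

Lemma exit_potential_small x :
  {homo (fun j => exit_potential X P Om j.+1%:R^-1 x) : n m / (n <= m)%N >-> (n <= m)%E} /\
  exit_potential X P Om j.+1%:R^-1 x @[j --> \oo] --> expect P x (exit_time X Om).
Proof.
have b0 (j : nat) : 0 < j.+1%:R^-1 :> R by rewrite invr_gt0.
under eq_fun do rewrite exit_potential_sup_hit//.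
pose g (j : nat) w := (\int[lebesgue_measure]_t
     ((expw j.+1%:R^-1 t)%:E * ((t%:E < sup_hit X V w)%E%:R)%:E) : \bar R)%E.
have g0 j w : (0 <= g j w)%E.
  by apply: integral_ge0 => t _; rewrite mule_ge0// lee_fin ?expw_ge0.
have g_nd w a b : (a <= b)%N -> (g a w <= g b w)%E.
  move=> ab; apply: (ge0_le_integral_off_null (@measurable0 _ _)); rewrite ?measure0//.
  - by move=> t; rewrite mule_ge0// lee_fin ?expw_ge0.
  - by move=> t; rewrite mule_ge0// lee_fin ?expw_ge0.
  move=> t _; rewrite lee_wpmul2r ?lee_fin// le_expw//.
  by rewrite lef_pV2 ?posrE// ler_nat ltnS.
have mg j : measurable_fun setT (g j).
  rewrite (_ : g j = fun w => ((j.+1%:R)%:E * (1 - expeR (- (j.+1%:R^-1%:E * sup_hit X V w))))%E).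
    apply: emeasurable_funM => //; apply: emeasurable_funB => //.
    apply: measurableT_comp; first exact: measurable_expeR.
    apply: measurableT_comp => //; apply: emeasurable_funM => //.
    exact: (measurable_sup_hit hX cV clV).
  apply/funext => w; rewrite -integral_expw_lt//; last exact: sup_hit_ge0.
  by rewrite muleA -EFinM mulfV ?mul1e// gt_eqF.
split.
  move=> a b ab; apply: (ge0_le_integral_off_null (@measurable0 _ _)); rewrite ?measure0//.
  - exact: g0.
  - exact: g0.
  - by move=> w _; exact: g_nd.
apply: (ae_monotone_convergence (m := P (Some x)) mg g0) => [w|].
  exact: (exit_time_ge0 X clV VOm).
have := sup_hit_ae hX oV cV clV VOm (Some x); apply: ae_mono => w <-; split.
  by move=> a b; exact: g_nd.
exact: integral_expw_small (sup_hit_ge0 X V w).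
Qed.

(** The limit superior of the variational potentials is a Borel version of the exit potential.
    Linearity and monotone convergence of integrals under [mu] go through it. *)
Lemma exit_potential_ae_measurable b : beta0 < b -> exists g : borel E -> \bar R,
  [/\ measurable_fun setT g, forall x, (0 <= g x)%E &
      {ae mu, forall x, g x = exit_potential X P Om b x}].
Proof.
move=> hb.
have [fr [fr2 fr01 fr_nd fr_cvg]] := exhausting_functions hsf.
have [u [Fu ub _ _ ucv]] := exit_potential_approx hlc hsep hX hform hsym hassoc
  oV cV clV VOm hb fr2 fr01 fr_nd fr_cvg.
exists (fun x => limn_esup (fun n => (u n x)%:E)); split.
- apply: measurable_fun_limn_esup => n; apply/measurable_EFinP.
  exact: (sqint_measurable (domain_sqint hform (Fu n))).
- move=> x; rewrite limn_esup_lim; apply: lime_ge; first exact: is_cvg_esups.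
  apply: nearW => m; apply: (@le_trans _ _ (u m x)%:E).
    by rewrite lee_fin; have /andP[] := ub m x.
  by apply: ereal_sup_ubound; exists m => /=.
- move: ucv; apply: ae_mono => x [_ cv].
  exact: (cvg_limn_einf_sup cv).2.
Qed.

Lemma expect_mu_exit b : beta0 < b ->
  expect_mu P mu (fun w => 1 - expeR (- (b%:E * exit_time X Om w)))%E =
  (b%:E * \int[mu]_x exit_potential X P Om b x)%E.
Proof.
move=> hb; have b0 : 0 < b := beta_gt0 hform hb.
have [g [mg g0 gE]] := exit_potential_ae_measurable hb.
have e0 x := exit_potential_ge0 X P clV VOm x b0.
rewrite -(ge0_integral_ae_eq g0 e0 gE) -ge0_integralZl//; last by rewrite lee_fin ltW.
have eE x : expect P x (fun w => 1 - expeR (- (b%:E * exit_time X Om w)))%E =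
    (b%:E * exit_potential X P Om b x)%E.
  by rewrite /exit_potential muleA -EFinM mulfV ?mul1e// gt_eqF.
transitivity (\int[mu]_x (b%:E * exit_potential X P Om b x))%E.
  by apply: eq_integral => x _; exact: eE.
apply: ge0_integral_ae_eq.
- by move=> x; rewrite mule_ge0// lee_fin ltW.
- by move=> x; rewrite mule_ge0// lee_fin ltW.
- by move: gE; apply: ae_mono => x ->.
Qed.

Lemma exit_mean_cvg : beta0 = 0 ->
  {homo (fun j => \int[mu]_x exit_potential X P Om j.+1%:R^-1 x)%E :
     n m / (n <= m)%N >-> (n <= m)%E} /\
  (\int[mu]_x exit_potential X P Om j.+1%:R^-1 x)%E @[j --> \oo] -->
    expect_mu P mu (exit_time X Om).
Proof.
move=> b00.
have b0 (j : nat) : 0 < j.+1%:R^-1 :> R by rewrite invr_gt0.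
have hb (j : nat) : beta0 < j.+1%:R^-1 by rewrite b00.
have e0 j x := exit_potential_ge0 X P clV VOm x (b0 j).
have [g hg] := choice (fun j => exit_potential_ae_measurable (hb j)).
split.
  move=> a b ab; apply: (ge0_le_integral_off_null (@measurable0 _ _)); rewrite ?measure0//.
  by move=> x _; exact: (exit_potential_small x).1.
have gI j : (\int[mu]_x exit_potential X P Om j.+1%:R^-1 x = \int[mu]_x g j x)%E.
  have [mg g0 gE] := hg j; apply/esym; exact: ge0_integral_ae_eq.
under eq_fun do rewrite gI.
apply: ae_monotone_convergence.
- by move=> j; have [] := hg j.
- by move=> j; have [] := hg j.
- move=> x; apply: integral_ge0 => w _; exact: (exit_time_ge0 X clV VOm).
have gE : {ae mu, forall x j, g j x = exit_potential X P Om j.+1%:R^-1 x}.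
  by apply/ae_foralln => j; have [] := hg j.
move: gE; apply: ae_mono => x gx; have [h1 h2] := exit_potential_small x; split.
  by move=> a b ab; rewrite !gx h1.
by under eq_fun do rewrite gx.
Qed.

End exit_mean.

Theorem corollary1p3 (R : realType) (E : pointedMetricType R)
  (hlc : locally_compact [set: E]) (hsep : separable_space E)
  (mu : {measure set (borel E) -> \bar R})
  (hsf : sigma_finite [set: borel E] mu) (hsupp : full_support mu)
  (F : set (E -> R)) (Ef : (E -> R) -> (E -> R) -> R) (beta0 : R)
  (hform : lower_bounded_semi_dirichlet_form mu F Ef beta0)
  (hsym : form_symmetric F Ef)
  (hreg : regular_form mu F Ef beta0)
  (d : measure_display) (W : measurableType d)
  (X : R -> W -> cemetery_ext E) (P : cemetery_ext E -> probability W R)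
  (hX : hunt_process X P)
  (hassoc : associated_with X P mu F Ef beta0)
  (Om : set E) (hOm : open Om) :
  (forall beta : R, beta0 < beta ->
     (beta%:E / expect_mu P mu
        (fun w => 1 - expeR (- (beta%:E * exit_time X Om w))))%E =
     ereal_inf [set (form_beta mu Ef beta f f)%:E |
       f in normalized_part mu F Ef beta0 Om]) /\
  (part_transient X P mu Om -> beta0 = 0 ->
     ((expect_mu P mu (exit_time X Om))^-1)%E =
     ereal_inf [set (Ef f f)%:E | f in normalized_part mu F Ef beta0 Om]).
Proof.
have [V [oV cV clV VOm]] := open_exhaustion hlc hsep hOm.
have energy b : beta0 < b -> _ := exit_energy hlc hsep hX hform hsym hreg hassoc hsf
  oV cV clV VOm (b := b).
have I0 b : beta0 < b -> (0 <= \int[mu]_x exit_potential X P Om b x)%E.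
  move=> hb; apply: integral_ge0 => x _.
  exact: (exit_potential_ge0 X P clV VOm x (beta_gt0 hform hb)).
split=> [b hb|_ b00].
  have b0 := beta_gt0 hform hb.
  rewrite -energy// (expect_mu_exit hlc hsep hX hform hsym hassoc hsf oV cV clV VOm hb).
  (* The degenerate cases follow the conventions that the inverse of 0 is [+oo] and the inverse of
     [+oo] is 0. *)
  have := I0 b hb; case: (\int[mu]_x _)%E => [r| |//] r0.
    rewrite -EFinM !inver mulf_eq0 (gt_eqF b0) /=.
    have [_|r1] := eqVneq r 0; first by rewrite gt0_muley// lte_fin.
    by rewrite -EFinM invfM mulVKf// gt_eqF.
  by rewrite gt0_muley ?lte_fin// invey mule0.
have [I_nd I_cvg] := exit_mean_cvg hlc hsep hX hform hsym hassoc hsf oV cV clV VOm b00.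
set T := expect_mu P mu _ in I_cvg *.
pose J (j : nat) := (\int[mu]_x exit_potential X P Om j.+1%:R^-1 x)%E.
have hb (j : nat) : beta0 < j.+1%:R^-1 by rewrite b00 invr_gt0.
have J0 j : (0 <= J j)%E by exact: I0.
have JT j : (J j <= T)%E.
  by apply: (lee_cvg_to (cvg_cst _) I_cvg); exists j => // k /= jk; exact: I_nd.
have T0 : (0 <= T)%E := le_trans (J0 0%N) (JT 0%N).
have Ef0 f : F f -> 0 <= Ef f f.
  by move=> Ff; have := lbsd_ge0 hform Ff; rewrite /form_beta b00 mul0r addr0.
apply/le_anti/andP; split.
  (* For a fixed [f], the inverse of the mean exit time is below the infimum at each index
     [1/(j+1)], hence below the energy of [f] at that index, which tends to [Ef f f]. *)
  apply: le_ereal_inf_tmp => _ [f nf <-].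
  have cv : ((Ef f f + j.+1%:R^-1 * scalar2 mu f f)%:E @[j --> \oo] --> (Ef f f)%:E)%E.
    apply: cvg_EFin; first exact: nearW.
    rewrite -[X in _ --> X]addr0 -(mul0r (scalar2 mu f f)).
    by apply: cvgD; [exact: cvg_cst|apply: cvgMl; exact: cvg_harmonic].
  apply: (lee_cvg_to (cvg_cst _) cv); apply: nearW => j.
  apply: (@le_trans _ _ (J j)^-1%E); first by rewrite lee_pV2 ?inE.
  by rewrite energy//; apply: ereal_inf_lbound; exists f.
set inf := ereal_inf _.
have inf0 : (0 <= inf)%E.
  by apply: le_ereal_inf_tmp => _ [f [[Ff _] _ _] <-]; rewrite lee_fin Ef0.
(* Energies grow with the index, so the infimum is at most the inverse of every [J j]. After
   inversion this bounds all [J j] at once, and their limit is the mean exit time. *)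
rewrite inve_pge ?inE//; apply: (lee_cvg_to I_cvg (cvg_cst _)); apply: nearW => j.
rewrite -[leLHS]/(J j) inve_pge ?inE// energy//.
apply: le_ereal_inf_tmp => _ [f nf <-]; have [[Ff _] _ _] := nf.
apply: (@le_trans _ _ (Ef f f)%:E); first by apply: ereal_inf_lbound; exists f.
rewrite lee_fin lerDl mulr_ge0 ?invr_ge0//.
exact: (nf_ge0 (sqint_nonneg_form mu) (domain_sqint hform Ff)).
Qed.
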